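(* Fix integers $\Delta>0$, $k\ge 2$ and a complex number $\lambda$ with $|\lambda|\neq1$. There is a deterministic algorithm which, given a hypergraph $H=(V,E)$ with $n$ vertices, maximum degree at most $\Delta$ and hyperedges of size at most $k$, hyperedge activities $\varphi_e:\{+,-\}^{e}\to\mathbb C$ ($e\in E$) that are symmetric, normalized by $\varphi_e(-,\dots,-)=1$, and satisfy $|\varphi_e(+,\dots,+)|\ge\frac14\sum_{\sigma\in\{+,-\}^{e}}|\varphi_e(\sigma)|$ for every $e$, and $\varepsilon\in(0,1)$, outputs $\hat Z$ with $|\hat Z-Z_H^{\varphi}(\lambda)|\le\varepsilon|Z_H^{\varphi}(\lambda)|$ in time polynomial in $n$ and $1/\varepsilon$ (the degree may depend on $\Delta,k,\lambda$; arithmetic on input numbers is unit cost).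
   Context: The degree of a vertex in a hypergraph is the number of hyperedges containing it. A family of hyperedge activities is symmetric if $\varphi_e(\sigma)=\overline{\varphi_e(-\sigma)}$ for all $e$ and $\sigma\in\{+,-\}^e$, where $-\sigma$ flips all spins and the bar is complex conjugation. The partition function of the two-spin system is $Z_H^{\varphi}(\lambda)=\sum_{\sigma:V\to\{+,-\}}\prod_{e\in E}\varphi_e(\sigma|_e)\,\lambda^{|\{v:\sigma(v)=+\}|}$. *)

(* Defs.v *)
From HB Require Import structures.
From mathcomp Require Import all_boot all_order all_algebra.
From mathcomp Require Import Rstruct reals.
From mathcomp.real_closed Require Import complex.
From Stdlib Require Rdefinitions.
Set Implicit Arguments. Unset Strict Implicit. Unset Printing Implicit Defensive.
Import Order.TTheory GRing.Theory Num.Theory.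
Local Open Scope ring_scope.

Notation RR := Rdefinitions.R.
Notation CC := (RR[i]).

Definition cmod (z : CC) : RR := Num.sqrt (complex.Re z ^+ 2 + complex.Im z ^+ 2).

(* Hypergraphs on vertex set 'I_n, with hyperedge set E : {set {set 'I_n}}.  *)
(* A spin configuration sigma : V -> {+,-} (resp. sigma : e -> {+,-}) is     *)
(* represented by the set of vertices carrying spin +.                       *)
(* An activity family phi assigns to a hyperedge e and a set S \subset e     *)
(* (the +-vertices of sigma in {+,-}^e) the complex number phi_e(sigma).      *)

Definition vdegree n (E : {set {set 'I_n}}) (v : 'I_n) : nat :=
  #|[set e in E | v \in e]|.

Definition max_degree_le n (E : {set {set 'I_n}}) (D : nat) : Prop :=
  forall v : 'I_n, (vdegree E v <= D)%N.

Definition edge_size_le n (E : {set {set 'I_n}}) (k : nat) : Prop :=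
  forall e, e \in E -> (#|e| <= k)%N.

(* symmetric: phi_e(sigma) = conj (phi_e(-sigma)); -sigma has +-set e :\: S *)
Definition symmetric_activities n (E : {set {set 'I_n}})
  (phi : {set 'I_n} -> {set 'I_n} -> CC) : Prop :=
  forall e, e \in E -> forall S : {set 'I_n}, S \subset e -> phi e S = conjc (phi e (e :\: S)).

Definition normalized_activities n (E : {set {set 'I_n}})
  (phi : {set 'I_n} -> {set 'I_n} -> CC) : Prop :=
  forall e, e \in E -> phi e set0 = 1.

Definition dominant_activities n (E : {set {set 'I_n}})
  (phi : {set 'I_n} -> {set 'I_n} -> CC) : Prop :=
  forall e, e \in E ->
    (4%:R)^-1 * (\sum_(S : {set 'I_n} | S \subset e) cmod (phi e S)) <= cmod (phi e e).

Definition partition_function n (E : {set {set 'I_n}})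
  (phi : {set 'I_n} -> {set 'I_n} -> CC) (lam : CC) : CC :=
  \sum_(sigma : {set 'I_n}) (\prod_(e in E) phi e (sigma :&: e)) * lam ^+ #|sigma|.

(* Model of computation: a deterministic real-RAM (unit-cost arithmetic).    *)
(* Two memories with indirect addressing: natural-number cells N : nat->nat  *)
(* (unit-cost addition, truncated subtraction, comparison) and real cells    *)
(* Rm : nat -> R (unit-cost + - * /, comparison, arbitrary real constants,   *)
(* conversion nat -> real).  Complex numbers are handled as pairs of reals.  *)

Inductive instr : Type :=
| NConst  (d c : nat)
| NAdd    (d a b : nat)
| NSub    (d a b : nat)
| NLoad   (d a : nat)
| NStore  (a s : nat)
| RConst  (d : nat) (c : RR)
| RAdd    (d a b : nat)
| RSub    (d a b : nat)
| RMul    (d a b : nat)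
| RDiv    (d a b : nat)          (* Rm[d] := Rm[a] / Rm[b] (x / 0 = 0) *)
| RLoad   (d a : nat)
| RStore  (a s : nat)
| OfNat   (d a : nat)
| JmpNLt  (a b l : nat)
| JmpRLt  (a b l : nat)
| Jmp     (l : nat)
| Halt.

Definition program := seq instr.

Record state := State { pc : nat; nmem : nat -> nat; rmem : nat -> RR }.

Definition updN (f : nat -> nat) (d v : nat) : nat -> nat :=
  fun i => if i == d then v else f i.
Definition updR (f : nat -> RR) (d : nat) (v : RR) : nat -> RR :=
  fun i => if i == d then v else f i.

(* One step; None means the machine has halted (Halt or pc out of range). *)
Definition step (P : program) (s : state) : option state :=
  let: State p N Rm := s in
  match nth Halt P p with
  | NConst d c => Some (State p.+1 (updN N d c) Rm)
  | NAdd d a b => Some (State p.+1 (updN N d (N a + N b)%N) Rm)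
  | NSub d a b => Some (State p.+1 (updN N d (N a - N b)%N) Rm)
  | NLoad d a => Some (State p.+1 (updN N d (N (N a))) Rm)
  | NStore a s0 => Some (State p.+1 (updN N (N a) (N s0)) Rm)
  | RConst d c => Some (State p.+1 N (updR Rm d c))
  | RAdd d a b => Some (State p.+1 N (updR Rm d (Rm a + Rm b)))
  | RSub d a b => Some (State p.+1 N (updR Rm d (Rm a - Rm b)))
  | RMul d a b => Some (State p.+1 N (updR Rm d (Rm a * Rm b)))
  | RDiv d a b => Some (State p.+1 N (updR Rm d (Rm a / Rm b)))
  | RLoad d a => Some (State p.+1 N (updR Rm d (Rm (N a))))
  | RStore a s0 => Some (State p.+1 N (updR Rm (N a) (Rm s0)))
  | OfNat d a => Some (State p.+1 N (updR Rm d (N a)%:R))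
  | JmpNLt a b l => Some (State (if (N a < N b)%N then l else p.+1) N Rm)
  | JmpRLt a b l => Some (State (if Rm a < Rm b then l else p.+1) N Rm)
  | Jmp l => Some (State l N Rm)
  | Halt => None
  end.

Fixpoint exec (P : program) (t : nat) (s : state) : state :=
  match t with
  | 0 => s
  | t'.+1 => match step P s with Some s1 => exec P t' s1 | None => s end
  end.

Definition halted (P : program) (s : state) : bool :=
  if step P s is None then true else false.

Definition halts_within (P : program) (s : state) (t : nat) (s' : state) : Prop :=
  exec P t s = s' /\ halted P s'.

Definition init_state (ni : seq nat) (ri : seq RR) : state :=
  State 0 (fun i => nth 0%N ni i) (fun i => nth 0 ri i).

Definition subset_of_index n (e : {set 'I_n}) (j : nat) : {set 'I_n} :=
  [set v in e | odd (j %/ 2 ^ index v (enum e))].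

Definition encode_nat n (E : {set {set 'I_n}}) : seq nat :=
  [:: n; #|E|] ++ flatten [seq #|e| :: [seq val v | v : 'I_n <- enum e] | e : {set 'I_n} <- enum E].

Definition encode_real n (E : {set {set 'I_n}})
  (phi : {set 'I_n} -> {set 'I_n} -> CC) (lam : CC) (eps : RR) : seq RR :=
  [:: complex.Re lam; complex.Im lam; eps] ++
  flatten [seq flatten [seq [:: complex.Re (phi e (subset_of_index e j));
                                complex.Im (phi e (subset_of_index e j))]
                       | j <- iota 0 (2 ^ #|e|)] | e : {set 'I_n} <- enum E].

Definition output (s : state) : CC := Complex (rmem s 0) (rmem s 1).

(* Main.v *)
(** Let [Z_T] be the polynomial of configurations whose + spins lie in [T].  Each
    edge polynomial is a convex combination of products [(1 + p) (1 + q)] with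
    [p q] the product of all variables of the edge, hence has no zero in the open
    polydisc; Asano contraction transfers this to [Z_T], so for a vertex [v] not in
    [T] one has [Z_(v + T) = A + x B] with [A <> 0] and [|B| <= |A|] on the open
    disc.  By Cauchy's estimates the Taylor coefficients of [Z_(v + T) / Z_T] are
    bounded by 1, and truncation at order [m] costs [O(|lam| ^ m)].

    These truncations are computable: by Moebius inversion the ratio is, up to
    [O(x ^ (m + 1))], the product over connected [S] containing [v], of size at
    most [m], of the alternating products of [Z_U] over [U] included in [S], since
    that product is 1 for disconnected [S] and [1 + O(x ^ |S|)] in general.  The
    sets visited by the [D ^ (2 m)] walks of length [2 m] from [v] include all
    these [S], and [m] is logarithmic in [n / eps].  Symmetry gives
    [Z(lam) = lam ^ n * conj (Z(1 / conj lam))], which handles [|lam| > 1]. *)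
Require Import Defs.
From HB Require Import structures.
From mathcomp Require Import all_boot all_order all_algebra.
From mathcomp Require Import Rstruct reals.
From mathcomp.real_closed Require Import complex.
From mathcomp Require Import cyclic separable cyclotomic.
From mathcomp Require Import ring lra zify.
Import Order.TTheory GRing.Theory Num.Theory.
Local Open Scope ring_scope.
Set Implicit Arguments.
Unset Strict Implicit.

(** Zero-freeness serves twice at each vertex: it makes [Z_T] an admissible denominator, and a
    variable of its own for [v] gives [|B| <= |A|]. The latter also bounds the ratio below by
    [1 - |lam|], so the additive truncation error at a vertex is a relative one, and the errors of
    the [n] telescoping factors add up to at most twice their sum.

    Neither power series nor contour integrals occur: quotients are cross-multiplied congruences of
    polynomials, and Cauchy's formula is an average over roots of unity whose remainder is sent to
    0.

    A walk may leave the vertices up to [v], and its trace there may be disconnected. This is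
    harmless: Moebius inversion is exact, so any family of sets will do whose omitted factors are
    trivial. But no set may count twice, hence the table of codes.

    The machine cannot multiply naturals, and the input fills its memory from cell 0 on, so that the
    first free address depends on the input, which is therefore moved first. As [lam] is fixed, it
    is a constant of the program, and its two input cells are the first scratch space. *)

Lemma cmodE (z : CC) : (cmod z)%:C%C = `|z|.
Proof. by rewrite normc_def. Qed.

Lemma cmod_ge0 (z : CC) : 0 <= cmod z.
Proof. exact: sqrtr_ge0. Qed.

Lemma cmodM (z w : CC) : cmod (z * w) = cmod z * cmod w.
Proof. by apply: complexI; rewrite rmorphM /= !cmodE normrM. Qed.

Lemma cmodD (z w : CC) : cmod (z + w) <= cmod z + cmod w.
Proof. by rewrite -lecR rmorphD /= !cmodE ler_normD. Qed.

Lemma cmodN (z : CC) : cmod (- z) = cmod z.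
Proof. by apply: complexI; rewrite !cmodE normrN. Qed.

Lemma cmod0 : cmod 0 = 0.
Proof. by apply: complexI; rewrite cmodE normr0. Qed.

Lemma cmod1 : cmod 1 = 1.
Proof. by apply: complexI; rewrite cmodE normr1. Qed.

Lemma cmod_eq0 (z : CC) : (cmod z == 0) = (z == 0).
Proof. by rewrite -(inj_eq (@complexI RR)) cmodE normr_eq0. Qed.

Lemma cmodV (z : CC) : cmod z^-1 = (cmod z)^-1.
Proof. by apply: complexI; rewrite cmodE normfV fmorphV /= cmodE. Qed.

Lemma cmodX (z : CC) j : cmod (z ^+ j) = cmod z ^+ j.
Proof. by apply: complexI; rewrite cmodE normrX rmorphXn /= cmodE. Qed.

Lemma cmod_conj (z : CC) : cmod (conjc z) = cmod z.
Proof. by case: z => a b; rewrite /cmod /= sqrrN. Qed.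

Lemma cmodR (x : RR) : 0 <= x -> cmod x%:C%C = x.
Proof. by move=> x0; apply: complexI; rewrite cmodE ger0_norm // lecR. Qed.

Lemma cmod_gt0 (z : CC) : (0 < cmod z) = (z != 0).
Proof. by rewrite lt_def cmod_eq0 cmod_ge0 andbT. Qed.

Lemma cmod_sum I (r : seq I) (P : pred I) (F : I -> CC) :
  cmod (\sum_(i <- r | P i) F i) <= \sum_(i <- r | P i) cmod (F i).
Proof.
elim/big_rec2: _ => [|i x y _ le_yx]; first by rewrite cmod0.
by rewrite (le_trans (cmodD _ _)) // lerD2l.
Qed.

Lemma cmod_prod I (r : seq I) (P : pred I) (F : I -> CC) :
  cmod (\prod_(i <- r | P i) F i) = \prod_(i <- r | P i) cmod (F i).
Proof. by elim/big_rec2: _ => [|i x y _ <-]; rewrite ?cmod1 ?cmodM. Qed.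

Lemma cmod_subl (z w : CC) : cmod z - cmod w <= cmod (z - w).
Proof. by rewrite lerBlDr -{1}(subrK w z) cmodD. Qed.

Lemma Re_ge_cmod (z : CC) : - cmod z <= complex.Re z.
Proof.
apply: lerNnormlW; rewrite -(@ler_pXn2r _ 2) ?nnegrE ?cmod_ge0 ?normr_ge0 //.
by rewrite sqr_sqrtr ?addr_ge0 ?sqr_ge0 // real_normK ?num_real // lerDl sqr_ge0.
Qed.

Lemma cmod_sqr (z : CC) : cmod z ^+ 2 = complex.Re z ^+ 2 + complex.Im z ^+ 2.
Proof. by rewrite sqr_sqrtr // addr_ge0 ?sqr_ge0. Qed.

(** * The Lee-Yang theorem *)

Definition monom (I : finType) (x : I -> CC) (S : {set I}) : CC := \prod_(v in S) x v.

(** A function on sets stands for the multiaffine polynomial with these coefficients, as Asano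
    contraction needs one variable per vertex. In the end [v] receives its own value, the vertices
    of [T] a common one, and the rest 0. *)
Definition zero_free (I : finType) (f : {set I} -> CC) :=
  forall x : I -> CC, (forall v, cmod (x v) < 1) -> \sum_S f S * monom x S != 0.

Lemma cmod_prod_lt1 (I : finType) (S : {set I}) (x : I -> CC) :
  (forall v, v \in S -> cmod (x v) < 1) -> S != set0 -> cmod (monom x S) < 1.
Proof.
move=> xlt /set0Pn[v vS]; rewrite cmod_prod (bigD1 v) //=.
have le1 : \prod_(i in S | i != v) cmod (x i) <= 1.
  by apply: prodr_ile1 => i /andP[iS _]; rewrite cmod_ge0 ltW // xlt.
by rewrite (le_lt_trans _ (xlt v vS)) // ler_piMr ?cmod_ge0.
Qed.

Lemma monomU (I : finType) (x : I -> CC) (S T : {set I}) :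
  [disjoint S & T] -> monom x (S :|: T) = monom x S * monom x T.
Proof. by move=> dST; rewrite /monom -bigU //; apply: eq_bigl => v; rewrite inE. Qed.

(* The multiplier [1 - conj X] depends on the product [X] only, so all the
   pairs of factors of one edge lie in a common half-plane. *)
Lemma half_plane (p q : CC) : cmod p < 1 -> cmod q < 1 ->
  0 < complex.Re ((1 - conjc (p * q)) * (1 + p) * (1 + q)).
Proof.
move=> p1 q1.
have := Re_ge_cmod p; have := Re_ge_cmod q; have := cmod_sqr p; have := cmod_sqr q.
have := cmod_ge0 p; have := cmod_ge0 q.
move: p1 q1; move: (cmod p) (cmod q) => a b.
case: p q => [p1 p2] [q1 q2] /= a1 b1 b0 a0 eb ea lq lp.
suff -> : ((1 - (p1 * q1 - p2 * q2)) * (1 + p1) - (0 - - (p1 * q2 + p2 * q1)) * (0 + p2)) *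
  (1 + q1) -
  ((1 - (p1 * q1 - p2 * q2)) * (0 + p2) + (0 - - (p1 * q2 + p2 * q1)) * (1 + p1)) * (0 + q2) =
  1 - a ^+ 2 * b ^+ 2 + p1 * (1 - b ^+ 2) + q1 * (1 - a ^+ 2).
  have h1 : - a * (1 - b ^+ 2) <= p1 * (1 - b ^+ 2) by apply: ler_wpM2r => //; nra.
  have h2 : - b * (1 - a ^+ 2) <= q1 * (1 - a ^+ 2) by apply: ler_wpM2r => //; nra.
  (* With [p1 = - a] and [q1 = - b] the right-hand side becomes exactly this product. *)
  have : 0 < (1 - a) * (1 - b) * (1 - a * b) by rewrite !mulr_gt0 ?subr_gt0 //; nra.
  nra.
by rewrite ea eb; ring.
Qed.

Lemma big_subsetU (R : Type) (idx : R) (op : Monoid.com_law idx) (I : finType)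
    (C D : {set I}) (F : {set I} -> {set I} -> R) : [disjoint C & D] ->
  \big[op/idx]_(W : {set I} | W \subset C :|: D) F (W :&: C) (W :&: D) =
  \big[op/idx]_(T : {set I} | T \subset C) \big[op/idx]_(U : {set I} | U \subset D) F T U.
Proof.
move=> dCD; rewrite pair_big /=.
have cap0 : C :&: D = set0 by apply/eqP; rewrite setI_eq0.
have restr (T U : {set I}) : T \subset C -> U \subset D ->
    ((T :|: U) :&: C, (T :|: U) :&: D) = (T, U).
  move=> TC UD; congr pair; apply/setP => v; rewrite !inE.
    have := subsetP TC v; have := subsetP UD v; move/setP/(_ v): cap0; rewrite !inE.
    by case: (v \in C); case: (v \in D); case: (v \in T); case: (v \in U) => // _ h1 h2;
      try (by have := h1 isT); try (by have := h2 isT).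
  have := subsetP TC v; have := subsetP UD v; move/setP/(_ v): cap0; rewrite !inE.
  by case: (v \in C); case: (v \in D); case: (v \in T); case: (v \in U) => // _ h1 h2;
    try (by have := h1 isT); try (by have := h2 isT).
rewrite (reindex_onto (fun p : {set I} * {set I} => p.1 :|: p.2)
  (fun W => (W :&: C, W :&: D))) /=; last first.
  by move=> W WCD; rewrite -setIUr; apply/setIidPl.
apply: eq_big => [[T U]|[T U]] /=.
  apply/andP/andP => [[_ /eqP[<- <-]]|[TC UD]]; first by rewrite !subsetIr.
  by rewrite restr // eqxx setUSS.
by case/andP => _ /eqP[-> ->].
Qed.

Lemma big_subset1 (R : Type) (idx : R) (op : Monoid.com_law idx) (I : finType)
    (v : I) (F : {set I} -> R) :
  \big[op/idx]_(U : {set I} | U \subset [set v]) F U = op (F set0) (F [set v]).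
Proof.
rewrite (bigD1 set0) ?sub0set //= (bigD1 [set v]) /=; last first.
  by rewrite subxx /=; apply/set0Pn; exists v; rewrite inE.
by rewrite big1 ?Monoid.mulm1 // => U; rewrite subset1; do 2 case: eqP.
Qed.

Lemma big_subsetU1 (R : Type) (idx : R) (op : Monoid.com_law idx) (I : finType)
    (v : I) (D : {set I}) (F : {set I} -> R) : v \notin D ->
  \big[op/idx]_(W : {set I} | W \subset v |: D) F W =
  op (\big[op/idx]_(T : {set I} | T \subset D) F T)
     (\big[op/idx]_(T : {set I} | T \subset D) F (v |: T)).
Proof.
move=> vD; have dis : [disjoint D & [set v]] by rewrite disjoint_sym disjoints1.
have := big_subsetU op (fun T U => F (T :|: U)) dis.
under eq_bigr => W _ do rewrite -setIUr.
under [in RHS]eq_bigr => T _ do rewrite big_subset1 setU0 setUC.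
rewrite big_split /= setUC => <-.
by apply: eq_bigr => W /setIidPl ->.
Qed.

Lemma set_elim (I : finType) (P : {set I} -> Prop) : P set0 ->
  (forall (A : {set I}) v, v \notin A -> P A -> P (v |: A)) -> forall A, P A.
Proof.
move=> P0 PS A; have [n] := ubnP #|A|; elim: n A => // n IH A An.
have [->//|[v vA]] := set_0Vmem A.
rewrite -(setD1K vA); apply: PS; first by rewrite !inE eqxx.
by apply: IH; rewrite (cardsD1 v) vA in An.
Qed.

Lemma monom0 (I : finType) (x : I -> CC) : monom x set0 = 1.
Proof. by rewrite /monom big_set0. Qed.

Lemma monom1 (I : finType) (x : I -> CC) v : monom x [set v] = x v.
Proof. by rewrite /monom big_set1. Qed.

Lemma monomU1 (I : finType) (x : I -> CC) v (S : {set I}) :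
  v \notin S -> monom x (v |: S) = x v * monom x S.
Proof. by move=> vS; rewrite monomU ?monom1 // disjoints1. Qed.

Lemma sum_monom_subset (I : finType) (x : I -> CC) (A : {set I}) :
  \sum_(U : {set I} | U \subset A) monom x U = \prod_(v in A) (1 + x v).
Proof.
elim/set_elim: A => [|A v vA IH].
  rewrite big_set0 (big_pred1 set0) ?monom0 // => U.
  by rewrite /= subset0.
rewrite big_subsetU1 // big_setU1 //= -IH mulrDl mul1r mulr_sumr; congr (_ + _).
apply: eq_bigr => U UA; rewrite monomU1 //.
by apply: contra vA => /(subsetP UA).
Qed.

Lemma ReD (z w : CC) : complex.Re (z + w) = complex.Re z + complex.Re w.
Proof. by case: z w => ? ? [? ?]. Qed.

Lemma Re_sum J (r : seq J) (P : pred J) (F : J -> CC) :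
  complex.Re (\sum_(i <- r | P i) F i) = \sum_(i <- r | P i) complex.Re (F i).
Proof. by elim/big_rec2: _ => // i x y _ <-; rewrite ReD. Qed.

Lemma ReZ (a : RR) (z : CC) : complex.Re (a%:C%C * z) = a * complex.Re z.
Proof. by case: z => ? ? /=; rewrite mul0r subr0. Qed.

(** The diagonal [s = t] suffices: a zero of [A + D z] in the disc makes [A / D], the product of the
    two roots of [A + (B + C) s + D s^2], smaller than 1 in modulus, so one of these roots lies in
    the disc. *)
Lemma asano (A B C D : CC) :
  (forall s t, cmod s < 1 -> cmod t < 1 -> A + B * s + C * t + D * (s * t) != 0) ->
  forall z, cmod z < 1 -> A + D * z != 0.
Proof.
move=> nz z z1; apply/eqP => AD0.
have c0 : cmod 0 < 1 by rewrite cmod0.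
have A0 : A != 0 by have := nz 0 0 c0 c0; rewrite !mulr0 !addr0.
have AE : A = - (D * z) by apply/eqP; rewrite -addr_eq0 AD0.
have D0 : D != 0 by apply: contraNneq A0 => D0; rewrite AE D0 mul0r oppr0.
have cAD : cmod (A / D) < 1.
  by rewrite AE mulNr cmodN mulrAC divff // mul1r.
pose d := sqrtc ((B + C) ^+ 2 - 4%:R * A * D).
have d2 : d ^+ 2 = (B + C) ^+ 2 - 4%:R * A * D by apply: sqr_sqrtc.
have two : (2%:R : CC) != 0 by rewrite pnatr_eq0.
pose r1 := (- (B + C) + d) / (2%:R * D); pose r2 := (- (B + C) - d) / (2%:R * D).
have r12 : r1 * r2 = A / D.
  have -> : r1 * r2 = ((B + C) ^+ 2 - d ^+ 2) / (2%:R * D) ^+ 2.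
    by rewrite /r1 /r2; field; rewrite D0.
  by rewrite d2; field; rewrite D0.
have root1 : A + B * r1 + C * r1 + D * (r1 * r1) = 0.
  have -> : A + B * r1 + C * r1 + D * (r1 * r1) =
    (d ^+ 2 - ((B + C) ^+ 2 - 4%:R * A * D)) / (4%:R * D).
    by rewrite /r1; field; rewrite D0.
  by rewrite d2 subrr mul0r.
have root2 : A + B * r2 + C * r2 + D * (r2 * r2) = 0.
  have -> : A + B * r2 + C * r2 + D * (r2 * r2) =
    (d ^+ 2 - ((B + C) ^+ 2 - 4%:R * A * D)) / (4%:R * D).
    by rewrite /r2; field; rewrite D0.
  by rewrite d2 subrr mul0r.
have n1 : ~~ (cmod r1 < 1) by apply/negP => h; have := nz _ _ h h; rewrite root1 eqxx.
have n2 : ~~ (cmod r2 < 1) by apply/negP => h; have := nz _ _ h h; rewrite root2 eqxx.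
move: cAD; rewrite -r12 cmodM; move: n1 n2; rewrite -!leNgt => n1 n2.
by rewrite ltNge mulr_ege1.
Qed.


(** [Q U] is the product of the polynomials of [f] and [g], in separate variables [x] and [y], after
    the variables of [U] have been contracted: only pairs of sets that agree on [U] survive, and
    there [y] is absorbed into [x]. Contracting [v] is one use of [asano], whose four coefficients
    are sorted by membership of [v] in the two sets. *)
Lemma hadamard_step (I : finType) (f g : {set I} -> CC) (U : {set I}) (v : I) :
  let Q U x y := \sum_(p : {set I} * {set I})
    f p.1 * g p.2 * (monom x p.1 * monom y (p.2 :\: U)) *+ (p.1 :&: U == p.2 :&: U) in
  v \notin U ->
  (forall x y, (forall u, cmod (x u) < 1) -> (forall u, cmod (y u) < 1) -> Q U x y != 0) ->
  (forall x y, (forall u, cmod (x u) < 1) -> (forall u, cmod (y u) < 1) -> Q (v |: U) x y != 0).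
Proof.
move=> Q vU QU x y x1 y1.
pose k p := f p.1 * g p.2 * (monom x (p.1 :\ v) * monom y ((p.2 :\: U) :\ v))
   *+ (p.1 :&: U == p.2 :&: U).
pose A := \sum_p k p *+ ((v \notin p.1) && (v \notin p.2)).
pose B := \sum_p k p *+ ((v \in p.1) && (v \notin p.2)).
pose C := \sum_p k p *+ ((v \notin p.1) && (v \in p.2)).
pose D := \sum_p k p *+ ((v \in p.1) && (v \in p.2)).
pose upd (x : I -> CC) s u := if u == v then s else x u.
have upd1 x' s : (forall u, cmod (x' u) < 1) -> cmod s < 1 -> forall u, cmod (upd x' s u) < 1.
  by move=> x'1 s1 u; rewrite /upd; case: eqP.
have updm x' s (S : {set I}) : monom (upd x' s) S = monom x' (S :\ v) * (if v \in S then s else 1).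
  have updD (S' : {set I}) : v \notin S' -> monom (upd x' s) S' = monom x' S'.
    by move=> vS; apply: eq_bigr => u uS; rewrite /upd; case: eqP uS vS => // -> ->.
  have [vS|vS] := boolP (v \in S).
    rewrite -{1}(setD1K vS) monomU1 ?inE ?eqxx //= updD ?inE ?eqxx //.
    by rewrite /upd eqxx mulrC.
  rewrite mulr1 -updD ?inE ?eqxx //.
  by congr monom; apply/setP => u; rewrite !inE; case: eqP vS => // -> /negbTE->.
have QE s t : Q U (upd x s) (upd y t) = A + B * s + C * t + D * (s * t).
  rewrite /A /B /C /D !mulr_suml -!big_split; apply: eq_bigr => -[S T] _ /=.
  rewrite !updm /k /= !inE vU /=.
  by case: (S :&: U == _); case: (v \in S); case: (v \in T); rewrite /= ?mulr1n ?mulr0n; ring.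
have -> : Q (v |: U) x y = A + D * x v.
  rewrite /A /D mulr_suml -big_split; apply: eq_bigr => -[S T] _ /=.
  have -> : (S :&: (v |: U) == T :&: (v |: U)) =
            (S :&: U == T :&: U) && ((v \in S) == (v \in T)).
    apply/eqP/andP => [/setP e|[/eqP/setP e1 /eqP e2]].
      split; last by have := e v; rewrite !inE eqxx !andbT => ->.
      apply/eqP/setP => u; have := e u; rewrite !inE.
      by case: (u \in U); rewrite ?andbF // orbT.
    apply/setP => u; have := e1 u; rewrite !inE; case: eqP => [->|_] //=.
    by rewrite !andbT e2.
  have -> : T :\: (v |: U) = (T :\: U) :\ v by apply/setP => u; rewrite !inE; case: eqP.
  have mS : monom x S = monom x (S :\ v) * (if v \in S then x v else 1).
    rewrite -updm; apply: eq_bigr => u _; rewrite /upd; by case: eqP => [->|].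
  rewrite mS /k /=.
  by case: (S :&: U == _); case: (v \in S); case: (v \in T); rewrite /= ?mulr1n ?mulr0n; ring.
apply: (asano (B := B) (C := C)) => // s t s1 t1.
by rewrite -QE; apply: QU; apply: upd1.
Qed.

(** Contraction of all variables leads from the product of the two polynomials at [U = set0] to the
    coefficientwise product at [U = setT], where the two sets must coincide. *)
Lemma zero_free_hadamard (I : finType) (f g : {set I} -> CC) :
  zero_free f -> zero_free g -> zero_free (fun S => f S * g S).
Proof.
move=> zf zg x x1.
pose Q U x y := \sum_(p : {set I} * {set I})
    f p.1 * g p.2 * (monom x p.1 * monom y (p.2 :\: U)) *+ (p.1 :&: U == p.2 :&: U).
have QU U x' y : (forall u, cmod (x' u) < 1) -> (forall u, cmod (y u) < 1) -> Q U x' y != 0.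
  elim/set_elim: U x' y => [|U v vU IH]; last exact: hadamard_step.
  move=> x' y x'1 y1; have -> : Q set0 x' y =
     (\sum_S f S * monom x' S) * (\sum_T g T * monom y T).
    rewrite big_distrlr pair_big; apply: eq_bigr => -[S T] _ /=.
    by rewrite !setI0 eqxx setD0 mulr1n; ring.
  by rewrite mulf_neq0 ?zf ?zg.
have -> : \sum_S f S * g S * monom x S = Q setT x x; last exact: QU.
rewrite /Q -(pair_bigA _ (fun S T => f S * g T * (monom x S * monom x (T :\: setT))
   *+ (S :&: setT == T :&: setT))) /=.
apply: eq_bigr => S _; rewrite (bigD1 S) //= eqxx setDT monom0 mulr1 big1 ?addr0 // => T TS.
by rewrite !setIT eq_sym (negbTE TS).
Qed.

(** Pairing [S] with its complement in [e] writes twice the polynomial as a combination of [1 + X]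
    and of products [(1 + p) (1 + q)] with [p q = X]; the constant 1/4 makes the coefficient [2 - s]
    of [1 + X] nonnegative. The multiplier [kap] then sends every nonzero product to the right
    half-plane. *)
Lemma edge_nonzero (I : finType) (e : {set I}) (phi : {set I} -> CC) (x : I -> CC) :
  e != set0 -> phi set0 = 1 ->
  (forall S : {set I}, S \subset e -> phi S = conjc (phi (e :\: S))) ->
  4%:R^-1 * (\sum_(S : {set I} | S \subset e) cmod (phi S)) <= cmod (phi e) ->
  (forall v, cmod (x v) < 1) -> \sum_(S : {set I} | S \subset e) phi S * monom x S != 0.
Proof.
move=> e0 phi0 sym dom x1.
have phie : phi e = 1 by rewrite sym // setDv phi0; apply: conjc1.
pose X := monom x e; pose P := \sum_(S : {set I} | S \subset e) phi S * monom x S.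
pose mid (S : {set I}) := [&& S \subset e, S != set0 & S != e].
have X1 : cmod X < 1 by apply: cmod_prod_lt1.
have split_e (R : nmodType) (F : {set I} -> R) :
    \sum_(S : {set I} | S \subset e) F S = F set0 + (F e + \sum_(S | mid S) F S).
  rewrite (bigD1 set0) ?sub0set //= (bigD1 e) /=; last by rewrite subxx.
  by congr (_ + (_ + _)); apply: eq_bigl => S; rewrite /mid andbA.
pose s := \sum_(S | mid S) cmod (phi S).
(* Both [phi set0] and [phi e] are 1, so the hypothesis reads [2 + s <= 4]. *)
have s2 : s <= 2%:R.
  move: dom; rewrite split_e phi0 phie cmod1 -/s => dom; lra.
have midC (S : {set I}) : mid (e :\: S) && (e :\: (e :\: S) == S) = mid S.
  apply/andP/idP => [[/and3P[_ h1 h2] /eqP h]|/and3P[h1 h2 h3]].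
    rewrite /mid; apply/and3P; split; first by rewrite -h subsetDl.
      by apply: contraNneq h2 => ->; rewrite setD0.
    by apply: contraNneq h1 => h0; rewrite h0 setDv.
  rewrite /mid subsetDl setDDr setDv set0U /=; split; last by apply/eqP/setIidPr.
  apply/andP; split.
    apply: contraNneq h3 => /eqP; rewrite setD_eq0 => h; by rewrite eqEsubset h1.
  apply: contraNneq h2 => h; rewrite -subset0; apply/subsetP => v vS.
  by have := subsetP h1 v vS; rewrite -h inE vS.
pose t S := phi S * monom x S + conjc (phi S) * monom x (e :\: S).
pose w S := (cmod (phi S))%:C%C * (1 + X) + t S.
pose kap := 1 - conjc X.
(* The factor 2 arises because the sum over [S] meets each complementary pair twice. *)
have PE : 2%:R * P = (2%:R - s)%:C%C * (1 + X) + \sum_(S | mid S) w S.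
  rewrite /P split_e phi0 phie monom0 -/X !mul1r /w /t !big_split /= -mulr_suml.
  rewrite -(rmorph_sum (real_complex RR)) -/s /=.
  have -> : \sum_(S | mid S) conjc (phi S) * monom x (e :\: S) =
            \sum_(S | mid S) phi S * monom x S.
    rewrite [RHS](reindex_onto (fun S => e :\: S) (fun S => e :\: S)) /=; last first.
      by move=> S /and3P[Se _ _]; rewrite setDDr setDv set0U; apply/setIidPr.
    rewrite (eq_bigl _ _ midC); apply: eq_bigr => S /and3P[Se _ _].
    by rewrite (sym S Se) conjcK.
  rewrite rmorphB /= rmorph_nat; ring.
have kX : 0 < complex.Re (kap * (1 + X)).
  have := half_plane X1 (_ : cmod 0 < 1); rewrite cmod0 mulr0 => /(_ ltr01) h.
  have := cmod_sqr X; have := cmod_ge0 X; move: X1; rewrite /kap.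
  case: (X) => X1 X2 /= cX1 cX0 cX2.
  suff : 0 < 1 - cmod (X1 +i* X2)%C ^+ 2 by rewrite cX2; nra.
  by nra.
have wpos S : mid S -> phi S != 0 -> 0 < complex.Re (kap * w S).
  move=> /and3P[Se S0 Sne] phiS; pose c := cmod (phi S).
  have c0 : 0 < c by rewrite cmod_gt0.
  have c0' : c%:C%C != 0 by rewrite -cmod_eq0 cmodR ?gt_eqF // ltW.
  (* The phase of [phi S] is shared out as [u] and [conjc u], which cancel in the product [p q]. *)
  pose u := phi S / c%:C%C.
  have u1 : cmod u = 1 by rewrite cmodM cmodV cmodR ?ltW // divff ?gt_eqF.
  have uu : u * conjc u = 1.
    by rewrite -sqr_normc -cmodE u1 /= expr1n.
  have cu : conjc u = conjc (phi S) / c%:C%C.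
    by rewrite /u -!(fmorphV (real_complex RR)) rmorphM; congr (_ * _); apply: conjc_real.
  pose p := u * monom x S; pose q := conjc u * monom x (e :\: S).
  have p1 : cmod p < 1 by rewrite cmodM u1 mul1r cmod_prod_lt1.
  have q1 : cmod q < 1.
    rewrite cmodM cmod_conj u1 mul1r cmod_prod_lt1 //.
    by apply: contraNneq Sne => /eqP; rewrite setD_eq0 => h; rewrite eqEsubset Se.
  have XE : X = p * q.
    rewrite /p /q mulrACA uu mul1r -monomU; last by rewrite -setI_eq0; apply/eqP/setP => v; rewrite !inE; case: (v \in S).
    congr monom; apply/setP => v; rewrite !inE.
    by have := subsetP Se v; case: (v \in S) => //= ->.
  have wE : w S = c%:C%C * ((1 + p) * (1 + q)).
    have -> : (1 + p) * (1 + q) = 1 + X + p + q by rewrite XE; ring.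
    by rewrite /w /t /p /q cu /u; field.
  rewrite wE mulrCA ReZ mulr_gt0 //.
  by have := half_plane p1 q1; rewrite -XE -/kap mulrA.
have w0 S : mid S -> phi S = 0 -> w S = 0.
  move=> mS phiS; rewrite /w /t phiS cmod0 !mul0r add0r.
  by rewrite (_ : conjc 0 = 0) ?mul0r ?addr0 //; apply: conjc0.
have wge S : mid S -> 0 <= complex.Re (kap * w S).
  move=> mS; have [phiS|phiS] := eqVneq (phi S) 0; last exact/ltW/wpos.
  by rewrite w0 // mulr0.
suff : 0 < complex.Re (kap * (2%:R * P)).
  by apply: contraTneq => P0; rewrite /P P0 !mulr0 ltxx.
rewrite PE mulrDr ReD mulrCA ReZ mulr_sumr Re_sum.
have [s_lt2|s_ge2] := ltP s 2%:R.
  by rewrite ltr_pwDl ?sumr_ge0 // mulr_gt0 // subr_gt0.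
(* In the boundary case the term [1 + X] disappears, but [s = 2] forces some proper nonempty [S]
   with nonzero [phi S], and this term is strictly positive. *)
have {s_ge2} sE : s = 2%:R by apply/eqP; rewrite eq_le s2.
rewrite sE subrr mul0r add0r.
have sN0 : s <> 0 by apply/eqP; rewrite sE pnatr_eq0.
have [S /andP[mS cS]] := psumr_neq0P (fun S _ => cmod_ge0 (phi S)) sN0.
rewrite (bigD1 S mS) /= ltr_pwDl ?wpos //; first by rewrite -cmod_eq0 gt_eqF.
by apply: sumr_ge0 => T /andP[mT _]; apply: wge.
Qed.

Lemma eq_zero_free (I : finType) (f g : {set I} -> CC) :
  f =1 g -> zero_free f -> zero_free g.
Proof.
move=> fg zf x x1; have := zf x x1; congr (_ != _).
by apply: eq_bigr => S _; rewrite fg.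
Qed.

Lemma prod1D_neq0 (I : finType) (x : I -> CC) (A : {set I}) :
  (forall v, cmod (x v) < 1) -> \prod_(v in A) (1 + x v) != 0.
Proof.
move=> x1; apply/prodf_neq0 => v _; apply/eqP => /eqP.
rewrite addrC addr_eq0 => /eqP xv; have := x1 v.
by rewrite xv cmodN cmod1 ltxx.
Qed.

(** One activity is read as a function on all vertex sets, so that edges can be multiplied
    coefficientwise; a vertex outside the edge is free and contributes [1 + x v]. *)
Lemma sum_by_edge (I : finType) (e : {set I}) (F : {set I} -> CC) (x : I -> CC) :
  \sum_S F (S :&: e) * monom x S =
  (\sum_(S : {set I} | S \subset e) F S * monom x S) * \prod_(v in ~: e) (1 + x v).
Proof.
have dis : [disjoint e & ~: e] by rewrite -setI_eq0 setICr.
rewrite -sum_monom_subset big_distrlr /=.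
rewrite -(big_subsetU _ (fun T U => F T * monom x T * monom x U) dis) /= setUCr.
apply: eq_big => [W|W _]; first by rewrite subsetT.
rewrite -mulrA -monomU; last first.
  by rewrite -setI_eq0 setIACA setICr setI0.
by rewrite -setIUr setUCr setIT.
Qed.

Definition weight (I : finType) (E : {set {set I}}) (phi : {set I} -> {set I} -> CC)
  (S : {set I}) : CC := \prod_(e in E) phi e (S :&: e).

(** Edge by edge: [weight] is a coefficientwise product, so each edge is one use of
    [zero_free_hadamard]. *)
Theorem lee_yang n (E : {set {set 'I_n}}) (phi : {set 'I_n} -> {set 'I_n} -> CC) :
  symmetric_activities E phi -> normalized_activities E phi -> dominant_activities E phi ->
  zero_free (weight E phi).
Proof.
elim/set_elim: E => [|E e eE IH] sym nor dom.
  move=> x x1; rewrite (eq_bigr (monom x)) => [|S _]; last by rewrite /weight big_set0 mul1r.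
  rewrite (eq_bigl (fun S : {set 'I_n} => S \subset setT)); last by move=> S; rewrite subsetT.
  by rewrite sum_monom_subset; apply: prod1D_neq0.
have eU f : f \in E -> f \in e |: E by move=> fE; rewrite !inE fE orbT.
have ee : e \in e |: E by rewrite !inE eqxx.
apply: (@eq_zero_free _ (fun S => phi e (S :&: e) * weight E phi S)).
  by move=> S; rewrite /weight big_setU1.
apply: zero_free_hadamard; last first.
  by apply: IH => f /eU; [apply: sym | apply: nor | apply: dom].
move=> x x1; rewrite (sum_by_edge e (phi e)) mulf_neq0 ?prod1D_neq0 //.
(* The empty hyperedge is excluded from [edge_nonzero]; by normalization it contributes the constant
   1. *)
have [e0|e0] := eqVneq e set0.
  rewrite (big_pred1 set0) => [|S]; last by rewrite /= e0 subset0.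
  by rewrite nor // monom0 mulr1 oner_neq0.
by apply: edge_nonzero => //; [apply: nor | apply: sym | apply: dom].
Qed.

(** * Ratios of restricted partition functions *)

Definition restr_poly (I : finType) (c : {set I} -> CC) (T : {set I}) : {poly CC} :=
  \sum_(W : {set I} | W \subset T) c W *: 'X^#|W|.

Lemma horner_restr_poly (I : finType) (c : {set I} -> CC) (T : {set I}) x :
  (restr_poly c T).[x] = \sum_(W : {set I} | W \subset T) c W * x ^+ #|W|.
Proof. by rewrite horner_sum; apply: eq_bigr => W _; rewrite hornerZ hornerXn. Qed.

Lemma restr_polyU1 (I : finType) (c : {set I} -> CC) (T : {set I}) v : v \notin T ->
  restr_poly c (v |: T) = restr_poly c T + 'X * restr_poly (fun W => c (v |: W)) T.
Proof.
move=> vT; rewrite /restr_poly big_subsetU1 //= mulr_sumr; congr (_ + _).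
apply: eq_bigr => W WT; rewrite cardsU1 (contra (subsetP WT v)) //= add1n exprS.
by rewrite -scalerAr.
Qed.

(** If [|B| > |A|], then [y = - A / B] lies in the disc and is a zero of [A + y B], which is the
    polynomial at [y] on [v], [x] on [T] and 0 elsewhere. *)
Lemma restr_poly_ratio (I : finType) (c : {set I} -> CC) (T : {set I}) v x :
  zero_free c -> v \notin T -> cmod x < 1 ->
  (restr_poly c T).[x] != 0 /\
  cmod (restr_poly (fun W => c (v |: W)) T).[x] <= cmod (restr_poly c T).[x].
Proof.
move=> zf vT x1; set A := _.[x]; set B := _.[x].
have nz y : cmod y < 1 -> A + y * B != 0.
  move=> y1; pose z u := if u == v then y else if u \in T then x else 0.
  have := zf z; suff -> : \sum_S c S * monom z S = A + y * B.
    by apply=> u; rewrite /z; do 2 case: ifP => // _; rewrite cmod0.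
  have mz (W : {set I}) : W \subset T -> monom z W = x ^+ #|W|.
    move=> WT; rewrite -prodr_const; apply: eq_bigr => u uW.
    by rewrite /z (subsetP WT) //; case: eqP => // uv; rewrite -uv (subsetP WT) in vT.
  rewrite (bigID (fun S : {set I} => S \subset v |: T)) /= addrC big1 ?add0r => [|S].
    rewrite big_subsetU1 //= /A /B !horner_restr_poly mulr_sumr; congr (_ + _).
      by apply: eq_bigr => W WT; rewrite mz.
    apply: eq_bigr => W WT; rewrite monomU1 ?mz ?(contra (subsetP WT v)) //.
    by rewrite /z eqxx mulrCA.
  case/subsetPn => u uS; rewrite !inE => /norP[uv uT].
  by rewrite /monom (bigD1 u uS) /= /z (negbTE uv) (negbTE uT) mul0r mulr0.
have A0 : A != 0 by have := nz 0; rewrite mul0r addr0 cmod0; apply.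
split=> //; rewrite leNgt; apply/negP => AB.
have B0 : B != 0 by rewrite -cmod_gt0 (le_lt_trans (cmod_ge0 A)).
have /nz : cmod (- (A / B)) < 1.
  by rewrite cmodN cmodM cmodV ltr_pdivrMr ?mul1r // cmod_gt0.
by rewrite mulNr divfK // subrr eqxx.
Qed.

(** * Truncated power series *)

(** Congruence modulo ['X^m], by coefficients because these are what the program computes. *)
Definition eqmX (K : nzRingType) (m : nat) (p q : {poly K}) :=
  forall i, (i < m)%N -> p`_i = q`_i.

Lemma eqmX_sym (K : nzRingType) m (p q : {poly K}) : eqmX m p q -> eqmX m q p.
Proof. by move=> pq i im; rewrite pq. Qed.

Lemma eqmX_trans (K : nzRingType) m (q p r : {poly K}) :
  eqmX m p q -> eqmX m q r -> eqmX m p r.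
Proof. by move=> pq qr i im; rewrite pq ?qr. Qed.

Lemma eqmX_mul (K : nzRingType) m (p q p' q' : {poly K}) :
  eqmX m p p' -> eqmX m q q' -> eqmX m (p * q) (p' * q').
Proof.
move=> pp qq i im; rewrite !coefM; apply: eq_bigr => j _.
rewrite pp ?qq //; first exact: leq_ltn_trans (leq_subr _ _) im.
exact: leq_ltn_trans (leq_ord j) im.
Qed.

Lemma eqmX_mull (K : nzRingType) m (p q r : {poly K}) : eqmX m q r -> eqmX m (p * q) (p * r).
Proof. by move=> qr; apply: eqmX_mul. Qed.

Lemma eqmX_prod (K : comNzRingType) m J (s : seq J) (P : pred J) (F G : J -> {poly K}) :
  (forall j, P j -> eqmX m (F j) (G j)) ->
  eqmX m (\prod_(j <- s | P j) F j) (\prod_(j <- s | P j) G j).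
Proof. by move=> FG; elim/big_ind2: _ => // *; apply: eqmX_mul. Qed.

(** A series with constant coefficient 1 is invertible; the coefficients are compared in increasing
    order. *)
Lemma eqmX_cancel (K : nzRingType) m (a p q : {poly K}) :
  a`_0 = 1 -> eqmX m (a * p) (a * q) -> eqmX m p q.
Proof.
move=> a0 apq i; have [k] := ubnP i; elim: k i => // k IH i ik im.
have := apq i im; rewrite !coefM !big_ord_recl /= a0 !mul1r subn0.
rewrite (eq_bigr (fun j : 'I_i => a`_(lift ord0 j) * q`_(i - lift ord0 j))); first exact: addIr.
move=> j _; rewrite IH //; have := ltn_ord j; rewrite /= /bump /=; lia.
Qed.

Lemma small_pow (C d t : RR) : 0 < d -> 0 < t < 1 -> 0 <= C ->
  exists N0, forall N, (N0 <= N)%N -> C * t ^+ N < d.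
Proof.
move=> d0 /andP[t0 t1] C0; pose u := t^-1 - 1.
have u0 : 0 < u by rewrite subr_gt0 invf_gt1.
have bern N : 1 + N%:R * u <= (t^-1) ^+ N.
  elim: N => [|N IH]; first by rewrite mul0r addr0.
  have tE : t^-1 = 1 + u by rewrite addrC subrK.
  rewrite exprS; apply: (@le_trans _ _ ((1 + u) * (1 + N%:R * u))).
    rewrite -natr1; have : 0 <= N%:R * u * u by rewrite !mulr_ge0 // ltW.
    lra.
  by rewrite -tE ler_wpM2l // invr_ge0 ltW.
have b0 : 0 <= C / d / u by rewrite !divr_ge0 // ltW.
exists (Num.bound (C / d / u)) => N NN; have := archi_boundP b0.
rewrite ltr_pdivrMr // ltr_pdivrMr // => h.
have tN : 0 < t ^+ N by rewrite exprn_gt0.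
rewrite -ltr_pdivlMr // -exprVn (lt_le_trans h) // mulrC ler_pM2l //.
apply: le_trans (bern N); rewrite (@le_trans _ _ (N%:R * u)) ?lerDr //.
by rewrite ler_wpM2r ?ler_nat // ltW.
Qed.

Lemma le_of_small_pow (a b C t : RR) n0 : 0 < t < 1 -> 0 <= C ->
  (forall N, (n0 <= N)%N -> a <= b + C * t ^+ N) -> a <= b.
Proof.
move=> t01 C0 ab; rewrite leNgt; apply/negP; rewrite -subr_gt0 => d0.
have [N0 small] := small_pow d0 t01 C0.
have := ab (maxn n0 N0) (leq_maxl _ _); have := small (maxn n0 N0) (leq_maxr _ _); lra.
Qed.

(** The coefficients of [q / (1 - a x)], a convolution with the geometric series of [a]. *)
Definition geo (a : CC) (q : nat -> CC) (k : nat) : CC := \sum_(i < k.+1) a ^+ (k - i) * q i.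

Lemma geoS a q k : geo a q k.+1 = q k.+1 + a * geo a q k.
Proof.
rewrite /geo big_ord_recr /= subnn mul1r addrC mulr_sumr; congr (_ + _).
by apply: eq_bigr => i _; rewrite mulrA -exprS subSn // leq_ord.
Qed.

Lemma geo_horner a q x M :
  (1 - a * x) * (\sum_(k < M.+1) geo a q k * x ^+ k) =
  \sum_(k < M.+1) q k * x ^+ k - a * geo a q M * x ^+ M.+1.
Proof.
elim: M => [|M IH].
  by rewrite !big_ord1 /geo big_ord1 /= subnn !expr0 expr1; ring.
by rewrite big_ord_recr /= mulrDr IH [in RHS]big_ord_recr /= !geoS !exprS; ring.
Qed.

Lemma geo_poly a q M :
  eqmX M ((1 - a%:P * 'X) * \poly_(k < M) geo a q k) (\poly_(k < M) q k).
Proof.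
move=> i iM; rewrite mulrBl mul1r -mulrA coefB coefCM coefXM !coef_poly iM.
case: i iM => [|i] iM /=; first by rewrite mulr0 subr0 /geo big_ord1 subnn mul1r.
by rewrite ltnW // geoS addrK.
Qed.

(** Division by [1 - a x] costs a factor [1 / (1 - s)]: the recursion [geoS] preserves the bound
    since [K + s K / (1 - s) = K / (1 - s)]. *)
Lemma geo_bound a q (s K : RR) : cmod a <= 1 -> 0 < s < 1 ->
  (forall k, cmod (q k) * s ^+ k <= K) ->
  forall k, cmod (geo a q k) * s ^+ k <= K / (1 - s).
Proof.
move=> a1 /andP[s0 s1] qK.
have s10 : 0 < 1 - s by rewrite subr_gt0.
have K0 : 0 <= K by apply: le_trans (qK 0%N); rewrite mulr_ge0 ?cmod_ge0 ?exprn_ge0 ?ltW.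
elim=> [|k IH].
  rewrite /geo big_ord1 subnn mul1r; apply: le_trans (qK 0%N) _.
  by rewrite ler_pdivlMr // ler_piMr //; lra.
rewrite geoS; apply: le_trans (_ : (cmod (q k.+1) + cmod (geo a q k)) * s ^+ k.+1 <= _).
  rewrite ler_wpM2r ?exprn_ge0 ?(ltW s0) // (le_trans (cmodD _ _)) // lerD2l cmodM.
  by rewrite ler_piMl ?cmod_ge0.
rewrite mulrDl; apply: le_trans (_ : K + s * (K / (1 - s)) <= _).
  apply: lerD; first exact: qK.
  by rewrite exprS mulrCA ler_pM2l.
rewrite le_eqVlt; apply/orP; left; apply/eqP; field; lra.
Qed.

(** The vertices of a regular polygon replace the circle in Cauchy's formula. *)
Lemma primitive_root_exists N : (0 < N)%N -> exists z : CC, N.-primitive_root z.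
Proof.
move=> N0; have [r pE] := closed_field_poly_normal ('X^N - 1 : {poly CC}).
rewrite (monicP (monicXnsubC _ N0)) scale1r in pE.
have r_uniq : uniq r by rewrite -separable_prod_XsubC -pE separable_Xn_sub_1 // pnatr_eq0 -lt0n.
have r_unity : all N.-unity_root r.
  by apply/allP => z zr; rewrite /root_of_unity -[1]/(1%R) pE root_prod_XsubC.
have /hasP[z _ zN] : has N.-primitive_root r.
  by apply: has_prim_root => //; rewrite -ltnS -(size_prod_XsubC r id) -pE size_XnsubC.
by exists z.
Qed.

(** The discrete Cauchy formula, exact for polynomials of degree below [N]: for [i] other than [k]
    the sum over [j] is a full geometric sum of a nontrivial root of unity. *)
Lemma coef_average N (z : CC) (g : nat -> CC) (x : CC) k :
  N.-primitive_root z -> (k < N)%N ->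
  \sum_(j < N) (\sum_(i < N) g i * (x * z ^+ j) ^+ i) * z ^- (j * k) = N%:R * (g k * x ^+ k).
Proof.
move=> zN kN; have z0 : z != 0 by apply/eqP => z0; have := prim_expr_order zN;
  rewrite z0 expr0n gtn_eqF ?(leq_ltn_trans _ kN) // => /eqP; rewrite eq_sym oner_eq0.
under eq_bigr => j _ do rewrite mulr_suml.
rewrite exchange_big (bigD1 (Ordinal kN)) //= [X in _ + X]big1 ?addr0 => [|i ik].
  rewrite (eq_bigr (fun=> g k * x ^+ k)) ?sumr_const ?card_ord ?mulr_natl // => j _.
  by rewrite exprMn -exprM -!mulrA divff ?mulr1 // expf_neq0.
pose w := z ^+ i / z ^+ k.
have wN : w ^+ N = 1.
  by rewrite /w expr_div_n -!exprM ![(_ * N)%N]mulnC !exprM (prim_expr_order zN) !expr1n divr1.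
have w1 : w != 1.
  apply: contraNneq ik => w1; apply/eqP/val_inj => /=.
  have /eqP : z ^+ i = z ^+ k by rewrite -[LHS](divfK (expf_neq0 k z0)) -/w w1 mul1r.
  by rewrite (eq_prim_root_expr zN) !modn_small // => /eqP.
have : (w - 1) * (\sum_(j < N) w ^+ j) = 0 by rewrite -subrX1 wN subrr.
move/eqP; rewrite mulf_eq0 subr_eq0 (negbTE w1) /= => /eqP sw0.
rewrite (eq_bigr (fun j : 'I_N => g i * x ^+ i * w ^+ j)) => [|j _].
  by rewrite -mulr_sumr sw0 mulr0.
by rewrite exprMn /w expr_div_n -!exprM !mulrA mulnC [(k * j)%N]mulnC.
Qed.

(** Division by one linear factor at a time, which is why the denominator comes factored.
    Coefficients are bounded at a radius [s] larger than [r], so that the truncation error at radius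
    [r = s t] decays like [t ^ M]. *)
Lemma quotient_series (B : {poly CC}) (rs : seq CC) (r : RR) :
  0 < r < 1 -> all (fun a => cmod a <= 1) rs ->
  exists t s C (g : nat -> CC), [/\ 0 < s < 1, 0 < t < 1, r = s * t, 0 <= C &
   [/\ forall k, cmod (g k) * s ^+ k <= C,
     forall M, eqmX M (\prod_(a <- rs) (1 - a%:P * 'X) * \poly_(k < M) g k) B &
     forall x M, cmod x <= r -> cmod (\sum_(k < M.+1) g k * x ^+ k -
        B.[x] / (\prod_(a <- rs) (1 - a%:P * 'X)).[x]) <= C * t ^+ M]].
Proof.
move=> /andP[r0 r1] rs1; pose s := (1 + r) / 2%:R; pose t := r / s.
have s01 : 0 < s < 1 by rewrite /s; lra.
have [s0 s1] := andP s01.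
have t01 : 0 < t < 1 by rewrite /t divr_gt0 // ltr_pdivrMr // mul1r /s; lra.
have [t0 t1] := andP t01.
have rE : r = s * t by rewrite /t mulrC divfK // gt_eqF.
exists t, s.
suff [C [g [C0 gC gB gx]]] : exists C (g : nat -> CC), [/\ 0 <= C,
     forall k, cmod (g k) * s ^+ k <= C,
     forall M, eqmX M (\prod_(a <- rs) (1 - a%:P * 'X) * \poly_(k < M) g k) B &
     forall x M, cmod x <= r -> cmod (\sum_(k < M.+1) g k * x ^+ k -
        B.[x] / (\prod_(a <- rs) (1 - a%:P * 'X)).[x]) <= C * t ^+ M].
  by exists C, g.
elim: rs rs1 => [_|a rs IH /= /andP[a1 /IH{IH}[C [g [C0 gC gB gx]]]]].
  pose C1 := \sum_(k < size B) cmod B`_k.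
  have C10 : 0 <= C1 by apply: sumr_ge0 => *; apply: cmod_ge0.
  have Bk k : cmod B`_k <= C1.
    have [kB|kB] := ltnP k (size B); last by rewrite nth_default // cmod0.
    rewrite /C1 (bigD1 (Ordinal kB)) //= lerDl; apply: sumr_ge0 => *; exact: cmod_ge0.
  have tB : 0 < t ^+ size B by rewrite exprn_gt0.
  have CC1 : C1 <= C1 / t ^+ size B.
    by rewrite ler_pdivlMr // ler_piMr // exprn_ile1 ?ltW.
  (* Truncation of [B] is exact once [M.+1 >= size B]; before that the tail is at most [C1], and
     dividing by [t ^+ size B] makes up for the factor [t ^+ M]. *)
  exists (C1 / t ^+ size B), (fun k => B`_k); split.
  - by rewrite divr_ge0 // ltW.
  - move=> k; apply: le_trans CC1; apply: le_trans (Bk k).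
    by rewrite ler_piMr ?cmod_ge0 // exprn_ile1 ?ltW.
  - by move=> M i iM; rewrite big_nil mul1r coef_poly iM.
  move=> x M xr; rewrite big_nil hornerC divr1.
  have [BM|BM] := leqP (size B) M.+1.
    rewrite (horner_coef_wide _ BM) subrr cmod0.
    by rewrite mulr_ge0 ?divr_ge0 ?exprn_ge0 // ltW.
  have [d Bd] : exists d, size B = (M.+1 + d)%N by exists (size B - M.+1)%N; rewrite subnKC // ltnW.
  have -> : B.[x] = \sum_(i < M.+1 + d) B`_i * x ^+ i by rewrite horner_coef Bd.
  rewrite big_split_ord /= opprD addNKr cmodN.
  apply: le_trans (cmod_sum _ _ _) _.
  apply: (@le_trans _ _ C1).
    rewrite /C1 Bd big_split_ord /= -[leLHS]add0r; apply: lerD.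
      by apply: sumr_ge0 => *; apply: cmod_ge0.
    apply: ler_sum => i _; rewrite cmodM cmodX ler_piMr ?cmod_ge0 //.
    by rewrite exprn_ile1 ?cmod_ge0 // (le_trans xr) // ltW.
  rewrite -mulrA ler_peMr // mulrC ler_pdivlMr // mul1r.
  by apply: ler_wiXn2l; [exact: ltW|exact: ltW|exact: ltnW (ltnW BM)].
have s10 : 0 < 1 - s by rewrite subr_gt0.
have r10 : 0 < 1 - r by rewrite subr_gt0.
(* [C] is the previous error, [C / (1 - s)] comes from the remainder term of [geo_horner], and
   [1 - r] bounds [|1 - a x|] from below. *)
exists ((C + C / (1 - s)) / (1 - r)), (geo a g).
have C2 : 0 <= C / (1 - s) by rewrite divr_ge0 // ltW.
have gC' := geo_bound a1 s01 gC.
split.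
- by apply: divr_ge0; [exact: addr_ge0|exact: ltW].
- move=> k; apply: le_trans (gC' k) _.
  rewrite ler_pdivlMr //; apply: (@le_trans _ _ (C / (1 - s))).
    by rewrite ler_piMr // lerBlDr lerDl ltW.
  by rewrite lerDr.
- move=> M; rewrite big_cons mulrAC mulrC.
  by apply: eqmX_trans (gB M); apply: eqmX_mull; apply: geo_poly.
move=> x M xr; rewrite big_cons hornerM; set A := (\prod_(_ <- _) _).[x].
have -> : (1 - a%:P * 'X).[x] = 1 - a * x by rewrite !hornerE.
have ax : cmod (a * x) <= r.
  by rewrite cmodM (le_trans _ xr) // ler_piMl ?cmod_ge0.
have ax1 : 1 - r <= cmod (1 - a * x).
  by apply: le_trans (cmod_subl _ _); rewrite cmod1; lra.
have ax0 : 1 - a * x != 0 by rewrite -cmod_gt0 (lt_le_trans r10).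
have xM : cmod (a * geo a g M * x ^+ M.+1) <= C / (1 - s) * t ^+ M.
  rewrite !cmodM cmodX; apply: le_trans (_ : cmod (geo a g M) * r ^+ M <= _).
    apply: ler_pM; [by rewrite mulr_ge0 ?cmod_ge0|by rewrite exprn_ge0 ?cmod_ge0| |].
      by rewrite ler_piMl ?cmod_ge0.
    rewrite exprS (le_trans (_ : _ <= cmod x ^+ M)) //.
      by rewrite ler_piMl ?exprn_ge0 ?cmod_ge0 // (le_trans xr) // ltW.
    by apply: lerXn2r => //; rewrite nnegrE ?cmod_ge0 ?(ltW r0).
  by rewrite rE exprMn mulrA ler_wpM2r ?exprn_ge0 // ltW.
have -> : \sum_(k < M.+1) geo a g k * x ^+ k - B.[x] / ((1 - a * x) * A) =
   ((\sum_(k < M.+1) g k * x ^+ k - B.[x] / A) - a * geo a g M * x ^+ M.+1) / (1 - a * x).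
  by rewrite addrAC -geo_horner invfM; move: (A^-1) => A'; field.
rewrite cmodM cmodV ler_pdivrMr; last exact: lt_le_trans ax1.
rewrite [leRHS]mulrAC; apply: (@le_trans _ _ ((C + C / (1 - s)) * t ^+ M)).
  apply: le_trans (cmodD _ _) _; rewrite cmodN mulrDl; apply: lerD => //.
  exact: gx.
rewrite ler_wpM2r ?exprn_ge0 ?(ltW t0) // -mulrA ler_peMr ?addr_ge0 //.
by rewrite mulrC ler_pdivlMr // mul1r.
Qed.

(** The roots lie outside the open disc, so their inverses have modulus at most 1; the constant
    coefficient 1 fixes the scalar. *)
Lemma poly_prod_roots (A : {poly CC}) : A`_0 = 1 -> (forall x, cmod x < 1 -> A.[x] != 0) ->
  exists2 rs, all (fun a : CC => cmod a <= 1) rs & A = \prod_(a <- rs) (1 - a%:P * 'X).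
Proof.
move=> A0 nz; have [zs AE] := closed_field_poly_normal A.
have l0 : lead_coef A != 0.
  by rewrite lead_coef_eq0; apply/eqP => A00; move: A0 (oner_neq0 CC); rewrite A00 coef0 => <-; rewrite eqxx.
have zge z : z \in zs -> 1 <= cmod z.
  move=> zz; rewrite leNgt; apply/negP => /nz.
  by rewrite AE hornerZ mulf_eq0 -rootE root_prod_XsubC zz orbT.
have zs0 z : z \in zs -> z != 0 by move=> /zge z1; rewrite -cmod_gt0; apply: lt_le_trans z1.
exists [seq z^-1 | z <- zs].
  by rewrite all_map; apply/allP => z zz /=; rewrite cmodV invf_le1 ?zge // cmod_gt0 zs0.
have XE : \prod_(z <- zs) ('X - z%:P) =
  (\prod_(z <- zs) - z) *: \prod_(z <- zs) (1 - (z^-1)%:P * 'X).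
  elim: zs {AE zge} zs0 => [|z zs IH] zs0; first by rewrite !big_nil scale1r.
  rewrite !big_cons IH => [|u uz]; last by rewrite zs0 // inE uz orbT.
  have z0 : z != 0 by rewrite zs0 // mem_head.
  rewrite -scalerAr [- z * _]mulrC -scalerA; congr (_ *: _).
  rewrite scalerAl scalerBr; congr (_ * _).
  by rewrite -!mul_polyC mulr1 mulrA -polyCM mulNr divff // !polyCN polyC1 mulN1r opprK addrC.
have EA : A = (lead_coef A * \prod_(z <- zs) - z) *: \prod_(z <- zs) (1 - (z^-1)%:P * 'X).
  by rewrite -scalerA -XE -AE.
suff e1 : lead_coef A * \prod_(z <- zs) - z = 1 by rewrite {1}EA e1 scale1r big_map.
have p0 : (\prod_(z <- zs) (1 - (z^-1)%:P * 'X))`_0 = 1.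
  rewrite -horner_coef0 horner_prod big1 // => z _.
  by rewrite !(hornerE, mulr0, subr0).
by have := congr1 (fun p : {poly CC} => p`_0) EA; rewrite /= coefZ p0 mulr1 A0.
Qed.

(** Cauchy's estimate: the mean over the [M.+1]-st roots of unity isolates [g k] in the truncation,
    whose values on the circle are at most [1 + C t ^ M]; then [M] grows. *)
Lemma quotient_coef_bound (A B : {poly CC}) (g : nat -> CC) (r t C : RR) k :
  0 < r < 1 -> 0 < t < 1 -> 0 <= C ->
  (forall x, cmod x <= r -> A.[x] != 0 /\ cmod B.[x] <= cmod A.[x]) ->
  (forall x M, cmod x <= r -> cmod (\sum_(k < M.+1) g k * x ^+ k - B.[x] / A.[x]) <= C * t ^+ M) ->
  cmod (g k) * r ^+ k <= 1.
Proof.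
move=> /andP[r0 r1] t01 C0 AB gx; apply: (@le_of_small_pow _ _ C t k) => // M kM.
have [z zN] := primitive_root_exists (ltn0Sn M).
have z1 : cmod z = 1.
  have : cmod z ^+ M.+1 = 1 by rewrite -cmodX (prim_expr_order zN) cmod1.
  by move/eqP; rewrite pexpr_eq1 ?cmod_ge0 // => /eqP.
have := coef_average g r%:C%C zN kM => /(congr1 cmod).
rewrite !cmodM cmodX cmodR ?(ltW r0) // -[M.+1%:R](rmorph_nat (real_complex RR)) cmodR ?ler0n // => avg.
have N0 : 0 < M.+1%:R :> RR by rewrite ltr0n.
rewrite -(ler_pM2l N0) -avg; apply: le_trans (cmod_sum _ _ _) _.
rewrite -[X in X%:R * _]card_ord mulr_natl -sumr_const; apply: ler_sum => j _.
rewrite cmodM cmodV cmodX z1 expr1n invr1 mulr1; set x := _ * z ^+ j.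
have xr : cmod x <= r by rewrite cmodM cmodR ?(ltW r0) // cmodX z1 expr1n mulr1.
have [Ax ABx] := AB x xr; have gxM := gx x M xr.
rewrite -[X in cmod X](subrK (B.[x] / A.[x])) (le_trans (cmodD _ _)) // addrC lerD //.
by rewrite cmodM cmodV ler_pdivrMr ?mul1r // cmod_gt0.
Qed.

(* Both [|B| <= |A|] and the absence of zeros hold on the open disc only;
   Cauchy's bound on each smaller circle passes to the limit. *)
Lemma ratio_truncation (A B f : {poly CC}) m lam :
  A`_0 = 1 -> (forall x, cmod x < 1 -> A.[x] != 0 /\ cmod B.[x] <= cmod A.[x]) ->
  cmod lam < 1 -> eqmX m.+1 (A * f) (A + 'X * B) ->
  cmod (\sum_(i < m.+1) f`_i * lam ^+ i - (A + 'X * B).[lam] / A.[lam])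
    <= cmod lam ^+ m.+1 / (1 - cmod lam).
Proof.
move=> A0 AB lam1 Af.
have [rs rs1 AE] := poly_prod_roots A0 (fun x x1 => proj1 (AB x x1)).
have l0 := cmod_ge0 lam.
(* One series for each radius below 1; [gu] shows that they all agree, as the formal quotient of [B]
   by [A] is unique. *)
have gen (r : RR) : 0 < r < 1 -> exists g : nat -> CC, [/\ forall k, cmod (g k) * r ^+ k <= 1,
    forall M, eqmX M (A * \poly_(k < M) g k) B &
    exists t C : RR, [/\ 0 < t < 1, 0 <= C & forall x M, cmod x <= r ->
     cmod (\sum_(k < M.+1) g k * x ^+ k - B.[x] / A.[x]) <= C * t ^+ M]].
  move=> r01; have [r0 r1] := andP r01.
  have [t [s [C [g [s01 t01 rE C0 [gC gB gx]]]]]] := quotient_series B r01 rs1.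
  rewrite -AE in gB gx.
  exists g; split=> //; last by exists t, C.
  move=> k; have := (quotient_coef_bound k r01 t01 C0 _ gx); apply=> x xr.
  exact/AB/(le_lt_trans xr).
have gu g g' : (forall M, eqmX M (A * \poly_(k < M) g k) B) ->
    (forall M, eqmX M (A * \poly_(k < M) g' k) B) -> g =1 g' .
  move=> gB g'B k; have := eqmX_cancel A0 (eqmX_trans (gB k.+1) (eqmX_sym (g'B k.+1))).
  by move=> /(_ k (ltnSn _)); rewrite !coef_poly ltnSn.
pose r : RR := (1 + cmod lam) / 2%:R.
have r01 : 0 < r < 1 by rewrite /r; lra.
have lr : cmod lam <= r by rewrite /r; lra.
have [g [_ gB [t [C [t01 C0 gx]]]]] := gen r r01.
have g1 k : cmod (g k) <= 1.
  apply: (@le_of_small_pow _ _ 0 2%:R^-1 0) => [||N _]; [lra|exact: lexx|].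
  rewrite mul0r addr0 leNgt; apply/negP => gk.
  pose d : RR := cmod (g k) - 1; have d0 : 0 < d by rewrite subr_gt0.
  have bern (q : RR) : 0 <= q <= 1 -> 1 - k%:R * q <= (1 - q) ^+ k.
    move=> /andP[q0 q1]; elim: (k) => [|j IH]; first by rewrite mul0r subr0.
    rewrite exprS; apply: le_trans (_ : (1 - q) * (1 - j%:R * q) <= _).
      have := mulr_ge0 (mulr_ge0 (ler0n RR j) q0) q0; rewrite -natr1; lra.
    by rewrite ler_wpM2l // subr_ge0.
  (* With [|g k| = 1 + d], the estimate at radius [1 - q] contradicts Bernoulli's inequality,
     because [k (1 + d) q < d] for this [q]. *)
  pose q : RR := d / (2%:R * (k.+1%:R * (1 + d))).
  have k0 : 0 < k.+1%:R :> RR by rewrite ltr0n.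
  have kd0 : 0 < k.+1%:R * (1 + d) by rewrite mulr_gt0 // addr_gt0.
  have q0 : 0 < q by rewrite divr_gt0 // mulr_gt0.
  have kq : k.+1%:R * (1 + d) * q = d / 2%:R.
    have k0' : k.+1%:R != 0 :> RR by rewrite gt_eqF.
    have d0' : 1 + d != 0 by rewrite gt_eqF // addr_gt0.
    rewrite /q; move: (k.+1%:R : RR) k0' => K K0; by field; rewrite K0 d0'.
  have k1 : 1 <= k.+1%:R :> RR by rewrite ler1n.
  have q1 : q < 1 by nra.
  have [|g' [g'1 g'B _]] := gen (1 - q); first lra.
  have := g'1 k; rewrite -(gu _ _ gB g'B) => gq.
  have := bern q; rewrite ltW //= ltW // => /(_ isT) bq.
  have : (1 + d) * (1 - k%:R * q) <= 1.
    apply: le_trans gq; rewrite (_ : cmod (g k) = 1 + d); last by rewrite /d; lra.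
    by rewrite ler_wpM2l // ltW // addr_gt0.
  rewrite -natr1 in kq; have : 0 < (1 + d) * q by rewrite mulr_gt0 // addr_gt0.
  nra.
(* The factor ['X] shifts indices: [m] coefficients of [g] give [m.+1] of [f], and the tail starts
   at [lam ^+ m.+1]. *)
have fE : eqmX m.+1 f (1 + 'X * \poly_(k < m.+1) g k).
  apply: (eqmX_cancel A0); apply: (eqmX_trans Af) => i im.
  rewrite mulrDr mulr1 !coefD; congr (_ + _).
  rewrite mulrCA !coefXM; case: i im => [|i] im //=.
  by rewrite gB // ltnW.
have -> : \sum_(i < m.+1) f`_i * lam ^+ i = 1 + lam * \sum_(k < m) g k * lam ^+ k.
  rewrite big_ord_recl fE // expr0 mulr1 coefD coef1 coefXM addr0; congr (_ + _).
  rewrite mulr_sumr; apply: eq_bigr => k _; have := ltn_ord k => km.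
  rewrite fE //= coefD coef1 coefXM /= add0r coef_poly leqW // exprS; ring.
have [Al _] := AB lam lam1.
have -> : 1 + lam * \sum_(k < m) g k * lam ^+ k - (A + 'X * B).[lam] / A.[lam] =
   lam * (\sum_(k < m) g k * lam ^+ k - B.[lam] / A.[lam]).
  by rewrite hornerD hornerM hornerX; field.
rewrite cmodM exprS -mulrA ler_wpM2l //.
apply: (@le_of_small_pow _ _ C t m) => // M mM.
have [d Md] : exists d, M.+1 = (m + d)%N by exists (M.+1 - m)%N; rewrite subnKC // ltnW.
have := gx lam M lr; rewrite Md big_split_ord /=.
set S1 := \sum_(i < m) _; set S2 := \sum_(i < d) _ => h.
have S2b : cmod S2 <= cmod lam ^+ m / (1 - cmod lam).
  rewrite ler_pdivlMr ?subr_gt0 //.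
  apply: le_trans (_ : (\sum_(i < d) cmod lam ^+ (m + i)) * (1 - cmod lam) <= _).
    apply: ler_wpM2r; first by rewrite subr_ge0 ltW.
    apply: le_trans (cmod_sum _ _ _) _.
    by apply: ler_sum => i _; rewrite cmodM cmodX ler_piMl // exprn_ge0.
  rewrite (eq_bigr (fun i : 'I_d => cmod lam ^+ m * cmod lam ^+ i)) => [|i _]; last by rewrite exprD.
  rewrite -mulr_sumr -mulrA ler_piMr ?exprn_ge0 //.
  have := subrX1 (cmod lam) d; set s := \sum_(i < d) _ => e.
  have -> : s * (1 - cmod lam) = 1 - cmod lam ^+ d by rewrite -[RHS]opprB e; ring.
  by rewrite lerBlDr lerDl exprn_ge0.
have -> : S1 - B.[lam] / A.[lam] = (S1 + S2 - B.[lam] / A.[lam]) - S2 by ring.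
apply: le_trans (cmodD _ _) _; rewrite cmodN addrC; exact: lerD.
Qed.

(** * Cluster factors *)

Definition toggle (I : finType) (w : I) (S : {set I}) : {set I} :=
  [set u | (u \in S) (+) (u == w)].

Lemma toggleK (I : finType) (w : I) : involutive (toggle w).
Proof. by move=> S; apply/setP => u; rewrite !inE -addbA addbb addbF. Qed.

Lemma toggle_in (I : finType) (w u : I) S : u != w -> (u \in toggle w S) = (u \in S).
Proof. by move=> /negbTE uw; rewrite inE uw addbF. Qed.

Lemma odd_toggle (I : finType) (w : I) S : odd #|toggle w S| = ~~ odd #|S|.
Proof.
have [wS|wS] := boolP (w \in S).
  have -> : toggle w S = S :\ w.
    by apply/setP => u; rewrite !inE; case: eqP => [->|]; rewrite ?wS ?addbF.
  by rewrite (cardsD1 w S) wS /= negbK.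
have -> : toggle w S = w |: S.
  by apply/setP => u; rewrite !inE; case: eqP => [->|]; rewrite ?(negbTE wS) ?addbF.
by rewrite cardsU1 wS.
Qed.

(** An involution that reverses the parity [p] and preserves all else matches the factors of one
    parity with those of the other. *)
Lemma toggle_prod (K : comNzRingType) (I : finType) (w : I) (P p : pred {set I})
    (h : {set I} -> K) :
  (forall S, P (toggle w S) = P S) -> (forall S, p (toggle w S) = ~~ p S) ->
  (forall S, P S -> h (toggle w S) = h S) ->
  \prod_(S | P S && p S) h S = \prod_(S | P S && ~~ p S) h S.
Proof.
move=> Pw pw hw; rewrite (reindex_inj (inv_inj (toggleK w))) /=.
by apply: eq_big => [S|S /andP[PS _]]; rewrite ?Pw ?pw // hw // -Pw.
Qed.

(** Together with [odd_prod], the numerator and denominator of the alternating product, kept apart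
    so that no polynomial has to be inverted. *)
Definition even_prod (K : comNzRingType) (I : finType) (f : {set I} -> K) (S : {set I}) : K :=
  \prod_(U : {set I} | (U \subset S) && ~~ odd #|S :\: U|) f U.

Definition odd_prod (K : comNzRingType) (I : finType) (f : {set I} -> K) (S : {set I}) : K :=
  \prod_(U : {set I} | (U \subset S) && odd #|S :\: U|) f U.

Lemma toggle_sub (I : finType) (w : I) (U S : {set I}) :
  w \in S -> (toggle w U \subset S) = (U \subset S).
Proof.
move=> wS; apply/subsetP/subsetP => sub u.
  have [->//|uw] := eqVneq u w; by rewrite -(toggle_in U uw); apply: sub.
by have [->//|uw] := eqVneq u w; rewrite toggle_in //; apply: sub.
Qed.

Lemma odd_setD_toggle (I : finType) (w : I) (U S : {set I}) :
  w \in S -> odd #|S :\: toggle w U| = ~~ odd #|S :\: U|.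
Proof.
move=> wS; rewrite -(odd_toggle w); congr (odd #|pred_of_set _|); apply/setP => u.
by rewrite !inE; case: eqP => [->|]; rewrite ?wS ?addbF ?addbT ?andbT //= negbK.
Qed.

Lemma odd_toggle_setD (I : finType) (w : I) (U S : {set I}) :
  w \notin U -> odd #|toggle w S :\: U| = ~~ odd #|S :\: U|.
Proof.
move=> wU; rewrite -(odd_toggle w); congr (odd #|pred_of_set _|); apply/setP => u.
by rewrite !inE; case: eqP => [->|]; rewrite ?(negbTE wU) ?addbF.
Qed.

Lemma even_odd_prod (K : comNzRingType) (I : finType) (w : I) (S : {set I}) (h : {set I} -> K) :
  w \in S -> (forall U : {set I}, U \subset S -> h (toggle w U) = h U) -> even_prod h S = odd_prod h S.
Proof.
move=> wS hw; rewrite /even_prod /odd_prod.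
rewrite (@toggle_prod K I w (fun U : {set I} => U \subset S) (fun U => ~~ odd #|S :\: U|)) //.
- by apply: eq_bigl => U; rewrite negbK.
- by move=> U; apply: toggle_sub.
- by move=> U; rewrite odd_setD_toggle.
Qed.

(** [f (U :&: C)] does not see [d] and [f (U :&: D)] does not see [c], so each of these two
    functions has equal even and odd products. *)
Lemma split_even_odd (K : comNzRingType) (I : finType) (C D : {set I}) (f : {set I} -> K) c d :
  [disjoint C & D] -> c \in C -> d \in D ->
  (forall U : {set I}, U \subset C :|: D -> f U = f (U :&: C) * f (U :&: D)) ->
  even_prod f (C :|: D) = odd_prod f (C :|: D).
Proof.
move=> dCD cC dD fE; set S := C :|: D.
have dC : d \notin C by rewrite (disjointFl dCD).
have cD : c \notin D by rewrite (disjointFr dCD).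
have capt w (A : {set I}) U : w \notin A -> toggle w U :&: A = U :&: A.
  move=> wA; apply/setP => u; rewrite !inE.
  by case: eqP => [->|]; rewrite ?(negbTE wA) ?andbF // addbF.
transitivity (even_prod (fun U => f (U :&: C)) S * even_prod (fun U => f (U :&: D)) S).
  by rewrite -big_split; apply: eq_bigr => U /andP[US _]; rewrite fE.
transitivity (odd_prod (fun U => f (U :&: C)) S * odd_prod (fun U => f (U :&: D)) S).
  congr (_ * _).
    by apply: (@even_odd_prod _ _ d) => [|U _]; rewrite ?inE ?dD ?orbT // capt.
  by apply: (@even_odd_prod _ _ c) => [|U _]; rewrite ?inE ?cC ?orbT // capt.
by rewrite -big_split; apply: eq_bigr => U /andP[US _]; rewrite [RHS]fE.
Qed.

(** After the products are exchanged, [f U] occurs for all [S] between [v |: U] and [v |: T], sorted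
    by the parity of [S :\: U]. These occurrences cancel unless [v |: U] is all of [v |: T], which
    leaves [U = v |: T] and [U = T]. *)
Lemma mobius_prod (K : comNzRingType) (I : finType) (f : {set I} -> K) v (T : {set I}) :
  v \notin T ->
  f (v |: T) * \prod_(S : {set I} | (v \in S) && (S \subset v |: T)) odd_prod f S =
  f T * \prod_(S : {set I} | (v \in S) && (S \subset v |: T)) even_prod f S.
Proof.
move=> vT; set T' := v |: T; pose P (U S : {set I}) := [&& v \in S, S \subset T' & U \subset S].
have exch (q : {set I} -> {set I} -> bool) :
  \prod_(S : {set I} | (v \in S) && (S \subset T')) \prod_(U : {set I} | (U \subset S) && q S U) f U =
  \prod_(U : {set I}) \prod_(S | P U S && q S U) f U.
  rewrite (exchange_big_dep predT) //=; apply: eq_bigr => U _.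
  by apply: eq_bigl => S; rewrite /P -!andbA.
rewrite /odd_prod /even_prod exch exch.
have TT' : T != T'.
  by apply: contraNneq vT => ->; rewrite !inE eqxx.
have splitT (G : {set I} -> K) :
    \prod_U G U = G T' * (G T * \prod_(U | (U != T') && (U != T)) G U).
  by rewrite (bigD1 T') //= (bigD1 T).
rewrite !splitT.
have PT' S : P T' S = (S == T').
  rewrite /P eqEsubset; case: (S \subset T'); rewrite ?andbF //=.
  by apply/andP/idP => [[]//|h]; split=> //; apply: (subsetP h); rewrite !inE eqxx.
have PT S : P T S = (S == T').
  rewrite -PT' /P; case: (boolP (v \in S)) => //= vS; congr (_ && _).
  by rewrite subUset sub1set vS.
have -> : \prod_(S | P T' S && odd #|S :\: T'|) f T' = 1.
  by rewrite big_pred0 // => S; rewrite PT'; case: eqP => // ->; rewrite setDv cards0.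
have -> : \prod_(S | P T S && ~~ odd #|S :\: T|) f T = 1.
  rewrite big_pred0 // => S; rewrite PT; case: eqP => // ->.
  by rewrite setDUl setDv setU0 (setDidPl _) ?cards1 // disjoints1.
have -> : \prod_(S | P T' S && ~~ odd #|S :\: T'|) f T' = f T'.
  rewrite (big_pred1 T') // => S; rewrite PT' /=; case: eqP => // ->.
  by rewrite setDv cards0.
have -> : \prod_(S | P T S && odd #|S :\: T|) f T = f T.
  rewrite (big_pred1 T') // => S; rewrite PT /=; case: eqP => // ->.
  by rewrite setDUl setDv setU0 (setDidPl _) ?cards1 // disjoints1.
rewrite !mul1r [RHS]mulrCA; congr (_ * (_ * _)).
apply: eq_bigr => U /andP[UT' UT].
have [UsT'|UsT'] := boolP (U \subset T'); last first.
  rewrite !big_pred0 // => S; rewrite /P; case: (boolP (U \subset S)); rewrite ?andbF //.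
    by move=> US; case: (boolP (S \subset T')); rewrite ?andbF // => /(subset_trans US); rewrite (negbTE UsT').
  by move=> US; case: (boolP (S \subset T')); rewrite ?andbF // => /(subset_trans US); rewrite (negbTE UsT').
(* A free element [w], different from [v]: adding it to [S] or removing it reverses the parity. *)
have /subsetPn[w wT' wU] : ~~ (T' \subset v |: U).
  apply/negP => sub; have [vU|vU] := boolP (v \in U).
    by move: UT'; rewrite eqEsubset UsT' (subset_trans sub) // subUset subxx sub1set vU.
  have E : U = T.
    apply/setP => u; have := subsetP UsT' u; have := subsetP sub u; rewrite !inE.
    by case: eqP => [->|_ /= h1 h2]; [rewrite (negbTE vU) (negbTE vT)|apply/idP/idP].
  by rewrite E eqxx in UT.
move: wU; rewrite !inE => /norP[wv wU].
apply: (@toggle_prod K I w (P U) (fun S => odd #|S :\: U|)) => // S.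
  rewrite /P toggle_sub // toggle_in 1?eq_sym //; congr [&& _, _ & _].
  apply/subsetP/subsetP => sub u uU.
    have uw : u != w by apply: contraNneq wU => <-.
    by rewrite -(toggle_in S uw) sub.
  have uw : u != w by apply: contraNneq wU => <-.
  by rewrite toggle_in // sub.
by rewrite odd_toggle_setD.
Qed.

(** Functions of [Y] whose Moebius transform [psi] is divisible by ['X^#|X|] at every [X]. Two of
    them that agree on the proper subsets of [S] can differ at [S] only in order [#|S|]. *)
Definition graded (I : finType) (Psi : {set I} -> {poly CC}) := exists psi : {set I} -> {poly CC},
  (forall X : {set I}, eqmX #|X| (psi X) 0) /\
  (forall Y : {set I}, Psi Y = \sum_(X : {set I} | X \subset Y) psi X).

Lemma eqmX_leq m m' (p q : {poly CC}) : (m <= m')%N -> eqmX m' p q -> eqmX m p q.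
Proof. by move=> le pq i im; apply: pq; apply: leq_trans le. Qed.

Lemma eqmX0_mul m m' (p q : {poly CC}) :
  eqmX m p 0 -> eqmX m' q 0 -> eqmX (m + m') (p * q) 0.
Proof.
move=> p0 q0 i im; rewrite coefM coef0 big1 // => j _.
have [jm|jm] := ltnP j m; first by rewrite p0 // coef0 mul0r.
rewrite q0 ?coef0 ?mulr0 // ltn_subLR; last exact: leq_ord.
by apply: leq_trans im _; rewrite leq_add2r.
Qed.

Lemma graded1 (I : finType) : graded (fun=> 1 : {poly CC}) (I := I).
Proof.
exists (fun X : {set I} => (X == set0)%:R); split=> [X|Y].
  by case: eqP => [->|_] //; rewrite cards0.
by rewrite (bigD1 set0) ?sub0set //= eqxx big1 ?addr0 // => X /andP[_ /negbTE->].
Qed.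

(** The transform of a product sums over pairs with union [X]; the orders add, and
    [#|A :|: B| <= #|A| + #|B|]. *)
Lemma graded_mul (I : finType) (Psi Psi' : {set I} -> {poly CC}) : graded Psi -> graded Psi' -> graded (fun Y => Psi Y * Psi' Y).
Proof.
move=> [psi [ord E]] [psi' [ord' E']].
exists (fun X => \sum_(p : {set I} * {set I} | p.1 :|: p.2 == X) psi p.1 * psi' p.2); split.
  move=> X i iX; rewrite coef_sum coef0 big1 // => -[A B] /= /eqP AB.
  rewrite (eqmX0_mul (ord A) (ord' B)) ?coef0 // (leq_trans iX) // -AB.
  by rewrite cardsU leq_subr.
move=> Y; rewrite E E' big_distrlr pair_big /= (exchange_big_dep
   (fun p : {set I} * {set I} => p.1 :|: p.2 \subset Y)) /=; last by move=> X [A B] XY /eqP->.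
apply: eq_big => [[A B]|[A B] /= /andP[AY BY]]; first by rewrite subUset.
rewrite (big_pred1 (A :|: B)) // => X /=; rewrite eq_sym andbC.
by case: eqP => //= ->; rewrite subUset AY BY.
Qed.

Lemma graded_prod (I : finType) J (r : seq J) (P : pred J) (F : J -> {set I} -> {poly CC}) :
  (forall j, P j -> graded (F j)) -> graded (fun Y => \prod_(j <- r | P j) F j Y).
Proof.
move=> gF; elim: r => [|j r IH].
  by have [psi [o E]] := graded1 I; exists psi; split=> // Y; rewrite big_nil.
case Pj: (P j); last first.
  by have [psi [o E]] := IH; exists psi; split=> // Y; rewrite big_cons Pj.
have [psi [o E]] := graded_mul (gF j Pj) IH; exists psi; split=> // Y.
by rewrite big_cons Pj.
Qed.

(** By induction the transforms agree strictly below [S], so only the two terms at [S] itself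
    remain. *)
Lemma graded_eq (I : finType) (S : {set I}) (Psi Psi' : {set I} -> {poly CC}) : graded Psi -> graded Psi' ->
  (forall Y : {set I}, Y \proper S -> Psi Y = Psi' Y) -> eqmX #|S| (Psi S) (Psi' S).
Proof.
move=> [psi [ord E]] [psi' [ord' E']] eqPsi.
have eqp (X : {set I}) : X \proper S -> psi X = psi' X.
  have [k] := ubnP #|X|; elim: k X => // k IH X Xk XS.
  have := eqPsi X XS; rewrite E E' (bigD1 X) // [RHS](bigD1 X) //=.
  rewrite (eq_bigr psi') => [/addIr //|A /andP[AX nAX]].
  have pAX : A \proper X by rewrite properEneq nAX AX.
  apply: IH; last exact: proper_trans pAX XS.
  by apply: leq_trans (proper_card pAX) _; rewrite -ltnS.
rewrite E E' (bigD1 S) // [X in eqmX _ _ X](bigD1 S) //=.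
rewrite (eq_bigr psi') => [|A /andP[AS nAS]]; last by rewrite eqp // properEneq nAS AS.
by move=> i iS; rewrite !coefD ord // ord'.
Qed.

(** Both products become functions of [Y] when the polynomial of [U] is replaced by that of
    [U :&: Y]. For a proper subset [Y] of [S], an element of [S] outside [Y] can be toggled in [U]
    without effect, so there the two products are equal. *)
Lemma even_odd_order (I : finType) (c : {set I} -> CC) (S : {set I}) :
  eqmX #|S| (even_prod (restr_poly c) S) (odd_prod (restr_poly c) S).
Proof.
have gU U : graded (fun Y => restr_poly c (U :&: Y)).
  exists (fun X : {set I} => if X \subset U then c X *: 'X^#|X| else 0); split=> [X i iX|Y].
    by case: ifP => // _; rewrite coefZ coefXn coef0 ltn_eqF // mulr0.
  rewrite -big_mkcondr; apply: eq_bigl => W; rewrite subsetI andbC //.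
have gE (P : pred {set I}) : graded (fun Y => \prod_(U | P U) restr_poly c (U :&: Y)).
  exact: graded_prod.
have := graded_eq (S := S) (gE (fun U : {set I} => (U \subset S) && ~~ odd #|S :\: U|))
                   (gE (fun U : {set I} => (U \subset S) && odd #|S :\: U|)).
have capS (P : pred {set I}) :
    \prod_(U : {set I} | (U \subset S) && P U) restr_poly c (U :&: S) =
    \prod_(U : {set I} | (U \subset S) && P U) restr_poly c U.
  by apply: eq_bigr => U /andP[US _]; rewrite (setIidPl US).
rewrite !capS.
apply=> Y /properP[YS [w wS wY]].
apply: (@even_odd_prod _ _ w S (fun U => restr_poly c (U :&: Y))) => // U US.
congr restr_poly; apply/setP => u; rewrite !inE.
by case: eqP => [->|_]; rewrite ?(negbTE wY) ?andbF // addbF.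
Qed.

Lemma restr_poly_coef0 (I : finType) (c : {set I} -> CC) T : c set0 = 1 -> (restr_poly c T)`_0 = 1.
Proof.
move=> c0; rewrite coef_sum (bigD1 set0) ?sub0set //= big1 => [|W /andP[_ W0]].
  by rewrite c0 scale1r cards0 expr0 coef1 addr0.
by rewrite coefZ coefXn eq_sym cards_eq0 (negbTE W0) mulr0.
Qed.

Lemma coef0_prod1 J (r : seq J) (P : pred J) (F : J -> {poly CC}) :
  (forall j, P j -> (F j)`_0 = 1) -> (\prod_(j <- r | P j) F j)`_0 = 1.
Proof.
move=> F1; elim/big_ind: _ => // [|x y x1 y1]; first by rewrite coef1.
by rewrite coef0M x1 y1 mulr1.
Qed.

(** Since [mobius_prod] is exact, the factors outside [F] may be cancelled as soon as they are
    trivial modulo ['X^m]; which further sets [F] contains is immaterial. *)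
Lemma cluster_congruence (I : finType) (c : {set I} -> CC) v (T : {set I})
    (F : {set {set I}}) m :
  c set0 = 1 -> v \notin T ->
  (forall S : {set I}, S \in F -> (v \in S) && (S \subset v |: T)) ->
  (forall S : {set I}, v \in S -> S \subset v |: T -> S \notin F ->
     eqmX m (even_prod (restr_poly c) S) (odd_prod (restr_poly c) S)) ->
  eqmX m (restr_poly c (v |: T) * \prod_(S in F) odd_prod (restr_poly c) S)
         (restr_poly c T * \prod_(S in F) even_prod (restr_poly c) S).
Proof.
move=> c0 vT Fsub Fout.
pose R := \prod_(S : {set I} | [&& v \in S, S \subset v |: T & S \notin F])
   odd_prod (restr_poly c) S.
have R1 : R`_0 = 1.
  by apply: coef0_prod1 => S _; apply: coef0_prod1 => U _; apply: restr_poly_coef0.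
apply: (eqmX_cancel R1).
have splitF (G : {set I} -> {poly CC}) :
    \prod_(S : {set I} | (v \in S) && (S \subset v |: T)) G S =
    \prod_(S in F) G S * \prod_(S : {set I} | [&& v \in S, S \subset v |: T & S \notin F]) G S.
  rewrite (bigID (mem F)) /=; congr (_ * _); apply: eq_bigl => S; last by rewrite andbA.
  by apply/andP/idP => [[]//|SF]; rewrite Fsub.
have := mobius_prod (restr_poly c) vT; rewrite !splitF -/R => E.
rewrite mulrCA [R * _]mulrC E [R * _]mulrCA [R * _]mulrC.
apply: eqmX_mull; apply: eqmX_mull.
by apply: eqmX_prod => S /and3P[vS ST SF]; apply: Fout.
Qed.

(** * Subset codes and walks *)

Lemma base_digits (b : nat) (d : nat -> nat) l : (forall t, (d t < b)%N) ->
  (\sum_(t < l) d t * b ^ t < b ^ l)%N /\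
  (forall r, (r < l)%N -> ((\sum_(t < l) d t * b ^ t) %/ b ^ r) %% b = d r)%N.
Proof.
move=> db; have b0 : (0 < b)%N by exact: leq_ltn_trans (db 0%N).
elim: l d db => [|l IH] d db; first by rewrite big_ord0 expn0.
have [IH1 IH2] := IH (fun t => d t.+1) (fun t => db t.+1).
have E : (\sum_(t < l.+1) d t * b ^ t = d 0 + b * \sum_(t < l) d t.+1 * b ^ t)%N.
  rewrite big_ord_recl /= expn0 muln1 big_distrr /=; congr (_ + _)%N.
  by apply: eq_bigr => i _; rewrite /= /bump /= expnS mulnCA.
rewrite E; split=> [|[|r] rl].
- rewrite expnS; apply: (@leq_trans (b * (\sum_(t < l) d t.+1 * b ^ t).+1)).
    by rewrite mulnS ltn_add2r.
  by rewrite leq_mul2l IH1 orbT.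
- by rewrite expn0 divn1 [(d 0 + _)%N]addnC [(b * _)%N]mulnC modnMDl modn_small.
by rewrite expnS divnMA [(d 0 + _)%N]addnC [(b * _)%N]mulnC divnMDl // (divn_small (db 0%N)) addn0 IH2.
Qed.

Lemma base2_digits (b : nat -> bool) l :
  (\sum_(t < l) b t * 2 ^ t < 2 ^ l)%N /\
  (forall r, (r < l)%N -> odd ((\sum_(t < l) b t * 2 ^ t) %/ 2 ^ r) = b r).
Proof.
have [h1 h2] := @base_digits 2 b l (fun t => leq_b1 (b t)).
split=> // r rl; have := h2 r rl; rewrite modn2 => /(congr1 odd).
by rewrite !oddb.
Qed.

(** The binary number that the program assembles from the indicator array of [T] in order to look up
    an activity. *)
Definition subset_index n (S T : {set 'I_n}) : nat :=
  (\sum_(t < #|S|) (nth 0%N [seq val u | u <- enum S] t \in [seq val u | u <- enum T]) * 2 ^ t)%N.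

Lemma subset_index_lt n (S T : {set 'I_n}) : (subset_index S T < 2 ^ #|S|)%N.
Proof. exact: (base2_digits (fun t => nth 0%N _ t \in _) _).1. Qed.

Lemma mem_val_enum n (T : {set 'I_n}) (u : 'I_n) : (val u \in [seq val x | x <- enum T]) = (u \in T).
Proof. by rewrite mem_map ?mem_enum //; apply: val_inj. Qed.

Lemma subset_indexK n (S T : {set 'I_n}) : subset_of_index S (subset_index S T) = T :&: S.
Proof.
apply/setP => u; rewrite !inE andbC; case: (boolP (u \in S)) => uS; rewrite ?andbF // !andbT.
have iu : (index u (enum S) < #|S|)%N by rewrite cardE index_mem mem_enum.
rewrite (base2_digits (fun t => nth 0%N _ t \in _) _).2 //.
by rewrite (nth_map u) -?cardE // nth_index ?mem_enum // mem_val_enum.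
Qed.

Lemma subset_of_index_sub n (S : {set 'I_n}) j : subset_of_index S j \subset S.
Proof. by apply/subsetP => u; rewrite inE => /andP[]. Qed.

Lemma big_subset_of_index (R : Type) (idx : R) (op : Monoid.com_law idx) n (S : {set 'I_n})
    (F : {set 'I_n} -> R) :
  \big[op/idx]_(U : {set 'I_n} | U \subset S) F U =
  \big[op/idx]_(j < 2 ^ #|S|) F (subset_of_index S j).
Proof.
pose h (j : 'I_(2 ^ #|S|)) : {set 'I_n} := subset_of_index S j.
pose h' (U : {set 'I_n}) : 'I_(2 ^ #|S|) := Ordinal (subset_index_lt S U).
have hK : {in [pred U : {set 'I_n} | U \subset S], cancel h' h}.
  by move=> U /setIidPl US; rewrite /h subset_indexK US.
have h'inj : {in [pred U : {set 'I_n} | U \subset S] &, injective h'}.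
  by move=> U V US VS E; rewrite -(hK U US) -(hK V VS) E.
have him : h' @: [set U : {set 'I_n} | U \subset S] = setT.
  apply/eqP; rewrite eqEcard subsetT /= cardsT card_ord card_in_imset.
    by rewrite -card_powerset; apply: subset_leq_card; apply/subsetP => U; rewrite !inE.
  by move=> U V; rewrite !inE; apply: h'inj.
rewrite (reindex_onto h h') /=; last by move=> U US; rewrite -{2}(hK U US).
apply: eq_bigl => j; rewrite subset_of_index_sub /=.
have : j \in setT by rewrite inE.
by rewrite -him => /imsetP[U]; rewrite inE => US ->; rewrite hK ?eqxx.
Qed.

(** Elements are enumerated in increasing order, so the program finds a position by counting smaller
    elements. *)
Lemma index_enum_rank n (S : {set 'I_n}) (v : 'I_n) :
  v \in S -> index v (enum S) = #|[set u in S | (u < v)%N]|.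
Proof.
move=> vS.
have so : sorted (fun x y : 'I_n => (x < y)%N) (enum S).
  rewrite {1}/enum_mem -enumT; apply: sorted_filter; first by move=> x y z; apply: ltn_trans.
  have := iota_ltn_sorted 0 n; rewrite -val_enum_ord sorted_map.
  by apply: sub_sorted => x y.
have tr : transitive (fun x y : 'I_n => (x < y)%N) by move=> x y z; apply: ltn_trans.
have un := enum_uniq S.
rewrite cardE -(size_map id); set i := index v _.
have iS : (i < size (enum S))%N by rewrite index_mem mem_enum.
have -> : size [seq id u | u <- enum [set u in S | (u < v)%N]] = count (fun u : 'I_n => (u < v)%N) (enum S).
  rewrite size_map -size_filter; apply: perm_size.
  apply: uniq_perm; [exact: enum_uniq|exact: filter_uniq un|] => u.
  by rewrite mem_enum [RHS]mem_filter mem_enum !inE andbC.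
rewrite -(cat_take_drop i (enum S)) count_cat.
have nthv j : (j < size (enum S))%N -> (nth v (enum S) j < v)%N = (j < i)%N.
  move=> jS; have vE : v = nth v (enum S) i by rewrite nth_index // mem_enum.
  have [ji|ij|->] := ltngtP j i.
  - by rewrite {2}vE; apply: (sorted_ltn_nth tr v so) ji.
  - apply/negbTE; rewrite -leqNgt ltnW // {1}vE; exact: (sorted_ltn_nth tr v so) ij.
  by rewrite -vE ltnn.
have -> : count (fun u : 'I_n => (u < v)%N) (take i (enum S)) = i.
  apply/eqP; rewrite -[X in _ == X](size_takel (ltnW iS)) -all_count; apply/(all_nthP v) => j.
  rewrite (size_takel (ltnW iS)) => ji; rewrite nth_take // nthv //; exact: ltn_trans iS.
rewrite (_ : count _ _ = 0%N) ?addn0 //; apply/eqP; rewrite -leqn0 leqNgt -has_count -all_predC.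
apply/(all_nthP v) => j; rewrite size_drop => ji; rewrite nth_drop /= nthv; last by rewrite -ltn_subRL.
by rewrite -leqNgt leq_addr.
Qed.

Lemma mem_subset_of_index n (S : {set 'I_n}) j (u : 'I_n) :
  (u \in subset_of_index S j) =
  (u \in S) && odd (j %/ 2 ^ #|[set x in S | (x < u)%N]|).
Proof. by rewrite inE; case: (boolP (u \in S)) => //= uS; rewrite index_enum_rank. Qed.

(** With unit-cost arithmetic a whole set is one number, and visited sets are compared as
    numbers. *)
Definition set_code n (S : {set 'I_n}) : nat := (\sum_(u < n) (u \in S) * 2 ^ u)%N.

Lemma set_code_inj n : injective (@set_code n).
Proof.
move=> S T E; apply/setP => u.
pose b (A : {set 'I_n}) t := t \in [seq val x | x <- enum A].
have cE (A : {set 'I_n}) : set_code A = (\sum_(t < n) b A t * 2 ^ t)%N.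
  by apply: eq_bigr => x _; rewrite /b mem_val_enum.
have := (base2_digits (b S) n).2 u (ltn_ord u); rewrite -cE E cE.
by rewrite (base2_digits (b T) n).2 // /b !mem_val_enum.
Qed.

(** * Walks in the hypergraph and the sets that they visit *)

Section Walks.
Variables (n : nat) (E : {set {set 'I_n}}).

Definition adjacent (u p : 'I_n) : bool := [exists e in E, (u \in e) && (p \in e)].

Definition nbr_rank (u p : 'I_n) : nat := #|[set x : 'I_n | adjacent x p & (x < u)%N]|.

(** A digit names a neighbour by its rank, and a digit that is no rank means standing still. All
    ranks are below [Delta * k], which leaves the last digit in base [Delta * k + 1] for this
    purpose. *)
Definition walk_step (p : 'I_n) (d : nat) : 'I_n :=
  odflt p [pick u | adjacent u p && (nbr_rank u p == d)].

Definition digit (D w s : nat) : nat := ((w %/ D ^ s) %% D)%N.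

Fixpoint walk (D : nat) (v : 'I_n) (w s : nat) : 'I_n :=
  if s is s'.+1 then walk_step (walk D v w s') (digit D w s') else v.

(** The walk itself may pass through vertices above [v]; they are only left out of the set. *)
Definition visited (D : nat) (v : 'I_n) (w L : nat) : {set 'I_n} :=
  [set u : 'I_n | (u <= v)%N && [exists s : 'I_L.+1, walk D v w s == u]].

Lemma nbr_rank_inj (u x p : 'I_n) :
  adjacent u p -> adjacent x p -> nbr_rank u p = nbr_rank x p -> u = x.
Proof.
have mono (a b : 'I_n) : (a < b)%N -> adjacent a p -> (nbr_rank a p < nbr_rank b p)%N.
  move=> ab ap; apply: proper_card; apply/properP; split.
    by apply/subsetP => y; rewrite !inE => /andP[-> ya]; apply: ltn_trans ab.
  by exists a; rewrite !inE ?ap ?ab // ltnn andbF.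
move=> up xp E'; apply: val_inj; have [ux|xu|//] := ltngtP (val u) (val x).
  by have := mono _ _ ux up; rewrite E' ltnn.
by have := mono _ _ xu xp; rewrite E' ltnn.
Qed.

Lemma walk_step_rank (u p : 'I_n) : adjacent u p -> walk_step p (nbr_rank u p) = u.
Proof.
move=> up; rewrite /walk_step; case: pickP => [x /andP[xp /eqP E']|/(_ u)] /=.
  exact: (nbr_rank_inj xp up E').
by rewrite up eqxx.
Qed.

Lemma nbr_rank_lt (u p : 'I_n) Delta k :
  max_degree_le E Delta -> edge_size_le E k -> adjacent u p -> (nbr_rank u p < Delta * k)%N.
Proof.
move=> deg sz up.
apply: (@leq_trans #|[set x : 'I_n | adjacent x p]|).
  apply: proper_card; apply/properP; split.
    by apply/subsetP => y; rewrite !inE => /andP[].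
  by exists u; rewrite !inE ?up // ltnn andbF.
apply: (@leq_trans #|\bigcup_(e in [set e in E | p \in e]) e|).
  apply/subset_leq_card/subsetP => x; rewrite inE => /existsP[e /and3P[eE xe pe]].
  by apply/bigcupP; exists e; rewrite // inE eE.
apply: (@leq_trans (\sum_(e in [set e in E | p \in e]) #|e|)).
  by elim/big_rec2: _ => [|e A B _ AB]; rewrite ?cards0 // (leq_trans (leq_card_setU _ _)) // leq_add2l.
apply: (@leq_trans (\sum_(e in [set e in E | p \in e]) k)).
  by apply: leq_sum => e; rewrite inE => /andP[eE _]; apply: sz.
by rewrite sum_nat_const leq_mul2r deg orbT.
Qed.

Lemma walk_step_stay (p : 'I_n) Delta k :
  max_degree_le E Delta -> edge_size_le E k -> walk_step p (Delta * k) = p.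
Proof.
move=> deg sz; rewrite /walk_step; case: pickP => //= u /andP[up /eqP E'].
by have := nbr_rank_lt deg sz up; rewrite E' ltnn.
Qed.

(** Connectedness by cuts: it supplies the next vertex in [connected_walk], and its failure is a
    separation to which [split_even_odd] applies. *)
Definition connected_from (v : 'I_n) (S : {set 'I_n}) : bool :=
  [forall A : {set 'I_n}, (v \in A) && (A \proper S) ==>
     [exists u in A, [exists x in S :\: A, adjacent x u]]].

Lemma adjacentC u p : adjacent u p = adjacent p u.
Proof. by apply: eq_existsb => e; rewrite [(u \in e) && _]andbC. Qed.

(** The walk around a growing tree: a new vertex [x], adjacent to a visited [u], is inserted as a
    detour [x, u] after an occurrence of [u], at the cost of two steps. *)
Lemma connected_walk (v : 'I_n) (S : {set 'I_n}) : v \in S -> connected_from v S ->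
  exists l, [/\ path (fun p u => (u == p) || adjacent u p) v l,
               [set u in v :: l] = S & size l = (#|S|.-1).*2].
Proof.
move=> vS /forallP conn.
suff grow k : (k < #|S|)%N -> exists l, [/\ path (fun p u => (u == p) || adjacent u p) v l,
    [set u in v :: l] \subset S, #|[set u in v :: l]| = k.+1 & size l = k.*2].
  have S0 : (0 < #|S|)%N by apply/card_gt0P; exists v.
  have [|l [pl lS cl sl]] := grow #|S|.-1; first by rewrite prednK.
  by exists l; split=> //; apply/eqP; rewrite eqEcard lS cl prednK ?leqnn.
elim: k => [|k IH] kS.
  exists [::]; split=> //; last by rewrite -[RHS](cards1 v); apply: eq_card => u; rewrite !inE.
  by apply/subsetP => u; rewrite !inE => /eqP->.
have [l [pl lS cl sl]] := IH (ltnW kS).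
have := conn [set u in v :: l]; rewrite inE mem_head properEcard lS cl kS /=.
case/existsP => u /andP[]; rewrite inE => ul /existsP[x] /andP[]; rewrite inE => /andP[xl xS] xu.
have xl' : x \notin v :: l by rewrite inE in xl.
case/splitPl: ul pl sl lS cl xl xl' => l1 l2 lu pl sl lS cl xl xl'.
have setE : [set y in v :: l1 ++ x :: u :: l2] = x |: [set y in v :: l1 ++ l2].
  apply/setP => y; rewrite !inE !mem_cat !inE.
  have [->|_] := eqVneq y u; last first.
    by case: (y == v); case: (y \in l1); case: (y == x); case: (y \in l2).
  suff : u \in v :: l1 by rewrite inE => /orP[->|->]; rewrite ?orbT.
  by rewrite -lu mem_last.
exists (l1 ++ x :: u :: l2); split.
- move: pl; rewrite !cat_path lu /= => /andP[-> ->].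
  by rewrite xu adjacentC xu !orbT.
- by rewrite setE subUset lS sub1set xS.
- by rewrite setE cardsU1 xl cl.
by move: sl; rewrite !size_cat /= !addnS => ->.
Qed.

Lemma visited_connected (v : 'I_n) (S : {set 'I_n}) Delta k L :
  max_degree_le E Delta -> edge_size_le E k ->
  v \in S -> connected_from v S -> (forall u, u \in S -> (u <= v)%N) -> ((#|S|.-1).*2 <= L)%N ->
  exists2 w, (w < (Delta * k).+1 ^ L)%N & visited (Delta * k).+1 v w L = S.
Proof.
move=> deg sz vS conn Sv SL; set D := (Delta * k).+1.
have [l [pl lS sl]] := connected_walk vS conn.
(* The default of [nth] keeps the walk at its last vertex once [l] is exhausted. *)
pose p s := nth (last v l) (v :: l) s.
pose d s := if p s.+1 == p s then (Delta * k)%N else nbr_rank (p s.+1) (p s).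
have pd s : walk_step (p s) (d s) = p s.+1.
  rewrite /d; case: eqP => [->|/eqP ne]; first exact: walk_step_stay deg sz.
  have [sl'|sl'] := ltnP s (size l).
    have := pathP (last v l) pl s sl'; rewrite -/(p s) (_ : nth _ l s = p s.+1) //.
    by rewrite (negbTE ne) /= => /walk_step_rank.
  case/eqP: ne; rewrite /p /= nth_default //; case: (s) sl' => [|s'] sl' /=.
    by move: sl'; rewrite leqn0 size_eq0 => /eqP->.
  have [sl''|sl''] := ltnP s' (size l); last by rewrite nth_default.
  have -> : s' = (size l).-1 by lia.
  by rewrite nth_last; case: (l) sl''.
have dD s : (d s < D)%N.
  rewrite /d; case: eqP => [_|/eqP ne]; first exact: ltnSn.
  have [sl'|sl'] := ltnP s (size l).
    have := pathP (last v l) pl s sl'; rewrite -/(p s) (_ : nth _ l s = p s.+1) //.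
    by rewrite (negbTE ne) /= => /(nbr_rank_lt deg sz)/ltnW; rewrite -ltnS.
  have := pd s; rewrite /d (negbTE ne) => _; case/eqP: ne.
  rewrite /p /= nth_default //; case: (s) sl' => [|s'] sl' /=.
    by move: sl'; rewrite leqn0 size_eq0 => /eqP->.
  have [sl''|sl''] := ltnP s' (size l); last by rewrite nth_default.
  have -> : s' = (size l).-1 by lia.
  by rewrite nth_last; case: (l) sl''.
have [wD wd] := base_digits L dD.
exists (\sum_(t < L) d t * D ^ t)%N => //; set w := (\sum_(t < L) _)%N.
have wp s : (s <= L)%N -> walk D v w s = p s.
  by elim: s => [//|s IH] sL /=; rewrite IH 1?ltnW // /digit wd // pd.
apply/setP => u; rewrite inE -lS; apply/andP/idP => [[_ /existsP[s /eqP <-]]|].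
  rewrite wp -1?ltnS // inE /p.
  have [h|h] := ltnP s (size (v :: l)); first exact: mem_nth.
  by rewrite nth_default // mem_last.
rewrite inE => ul; have us : (index u (v :: l) < size (v :: l))%N by rewrite index_mem.
split; first by apply: Sv; rewrite -lS inE.
have uL : (index u (v :: l) < L.+1)%N.
  by apply: leq_trans us _; rewrite /= ltnS sl.
by apply/existsP; exists (Ordinal uL); rewrite /= wp // /p nth_index.
Qed.

Lemma visited_self D v w L : v \in visited D v w L.
Proof. by rewrite inE leqnn; apply/existsP; exists ord0. Qed.

(** * Factorization over separated sets *)

Variable phi : {set 'I_n} -> {set 'I_n} -> CC.

Lemma weight0 : normalized_activities E phi -> weight E phi set0 = 1.
Proof. by move=> nor; apply: big1 => e eE; rewrite set0I nor. Qed.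

(** An edge that meets [C] cannot meet [D], so one of its two factors is the normalized value 1. *)
Lemma weight_split (C D U : {set 'I_n}) : normalized_activities E phi -> [disjoint C & D] ->
  (forall u x, u \in C -> x \in D -> ~~ adjacent x u) -> U \subset C :|: D ->
  weight E phi U = weight E phi (U :&: C) * weight E phi (U :&: D).
Proof.
move=> nor dCD noadj UCD; rewrite -big_split; apply: eq_bigr => e eE /=.
have UE : U = (U :&: C) :|: (U :&: D) by rewrite -setIUr; apply/esym/setIidPl.
have [eC|] := eqVneq (e :&: C) set0.
  rewrite -setIA [C :&: e]setIC eC setI0 nor // mul1r {1}UE setIUl.
  by rewrite -setIA [C :&: e]setIC eC setI0 set0U.
case/set0Pn => c; rewrite inE => /andP[ce cC].
have eD : e :&: D = set0.
  apply/eqP; rewrite -subset0; apply/subsetP => x; rewrite inE => /andP[xe xD].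
  by case/negP: (noadj _ _ cC xD); apply/existsP; exists e; rewrite eE xe ce.
rewrite -[U :&: D :&: e]setIA [D :&: e]setIC eD setI0 nor // mulr1 {1}UE setIUl.
by rewrite -[U :&: D :&: e]setIA [D :&: e]setIC eD setI0 setU0.
Qed.

Lemma restr_poly_split (C D U : {set 'I_n}) : normalized_activities E phi -> [disjoint C & D] ->
  (forall u x, u \in C -> x \in D -> ~~ adjacent x u) -> U \subset C :|: D ->
  restr_poly (weight E phi) U =
  restr_poly (weight E phi) (U :&: C) * restr_poly (weight E phi) (U :&: D).
Proof.
move=> nor dCD noadj UCD.
have UE : (U :&: C) :|: (U :&: D) = U by rewrite -setIUr; apply/setIidPl.
have dU : [disjoint U :&: C & U :&: D].
  by apply: disjointWl (subsetIr _ _) _; apply: disjointWr (subsetIr _ _) _.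
rewrite [in RHS]/restr_poly big_distrlr /= -(big_subsetU _ (fun X Y : {set 'I_n} =>
  (weight E phi X *: 'X^#|X|) * (weight E phi Y *: 'X^#|Y|)) dU) /= UE.
apply: eq_bigr => W WU; rewrite !setIA (setIidPl WU).
rewrite (weight_split nor dCD noadj (subset_trans WU UCD)) -scalerAl -scalerAr scalerA -exprD.
congr (_ *: 'X^_); rewrite -cardsUI setIACA setIid.
rewrite -setIUr (setIidPl (subset_trans WU UCD)) (_ : W :&: (C :&: D) = set0) ?cards0 ?addn0 //.
by move: dCD; rewrite -setI_eq0 => /eqP->; rewrite setI0.
Qed.

(** A set missed by all walks either has more than [m] elements, where [even_odd_order] applies, or
    is disconnected, where the two products are equal: length [m.*2] suffices to reach the connected
    sets of at most [m] elements. *)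
Lemma visited_congruence (v : 'I_n) Delta k m :
  max_degree_le E Delta -> edge_size_le E k -> normalized_activities E phi ->
  let F := [set visited (Delta * k).+1 v w m.*2 | w : 'I_((Delta * k).+1 ^ m.*2)] in
  eqmX m.+1
    (restr_poly (weight E phi) [set u : 'I_n | (u <= v)%N] *
       \prod_(S in F) odd_prod (restr_poly (weight E phi)) S)
    (restr_poly (weight E phi) [set u : 'I_n | (u < v)%N] *
       \prod_(S in F) even_prod (restr_poly (weight E phi)) S).
Proof.
move=> deg sz nor F.
have TE : [set u : 'I_n | (u <= v)%N] = v |: [set u : 'I_n | (u < v)%N].
  by apply/setP => u; rewrite !inE leq_eqVlt.
rewrite TE; apply: cluster_congruence.
- exact: weight0.
- by rewrite inE ltnn.
- move=> S /imsetP[w _ ->]; rewrite visited_self -TE.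
  by apply/subsetP => u; rewrite !inE => /andP[].
move=> S vS ST SF; have [Sm|Sm] := ltnP m #|S|.
  exact/(eqmX_leq Sm)/even_odd_order.
have Sv u : u \in S -> (u <= v)%N by move=> /(subsetP ST); rewrite -TE inE.
have [conn|] := boolP (connected_from v S).
  have [|w wD wS] := visited_connected deg sz vS conn Sv (L := m.*2).
    by rewrite leq_double (leq_trans (leq_pred _)).
  by case/negP: SF; apply/imsetP; exists (Ordinal wD).
case/forallPn => A; rewrite negb_imply => /andP[/andP[vA AS] /existsPn noadj].
have [AS' [x xS xA]] := properP AS.
have SE : S = A :|: (S :\: A).
  by apply/setP => u; rewrite !inE; case: (boolP (u \in A)) => // /(subsetP AS').
have dis : [disjoint A & S :\: A].
  by rewrite -setI_eq0; apply/eqP/setP => u; rewrite !inE; case: (u \in A).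
have na u y : u \in A -> y \in S :\: A -> ~~ adjacent y u.
  move=> uA yS; apply/negP => yu; have := noadj u; rewrite uA /=.
  by move/existsPn/(_ y); rewrite yS yu.
move=> i im; rewrite SE; congr (polyseq _)`_i.
apply: (@split_even_odd _ _ _ _ _ v x) => //; first by rewrite inE xA xS.
by move=> U US; apply: restr_poly_split.
Qed.

End Walks.

(** * Error analysis *)

Definition below n (j : nat) : {set 'I_n} := [set u : 'I_n | (u < j)%N].

Lemma below0 n : below n 0 = set0.
Proof. by apply/setP => u; rewrite !inE. Qed.

Lemma below_full n : below n n = setT.
Proof. by apply/setP => u; rewrite !inE ltn_ord. Qed.

Lemma belowS n (v : 'I_n) : below n v.+1 = v |: below n v.
Proof. by apply/setP => u; rewrite !inE ltnS leq_eqVlt. Qed.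

Lemma partition_functionE n (E : {set {set 'I_n}}) phi lam :
  partition_function E phi lam = (restr_poly (weight E phi) setT).[lam].
Proof. by rewrite horner_restr_poly; apply: eq_bigl => W; rewrite subsetT. Qed.

(** [f] is the quotient of the cluster products; since [O] can be cancelled, it is also the
    truncated ratio [Z v.+1 / Z v]. *)
Lemma factor_estimate n (E : {set {set 'I_n}}) phi (v : 'I_n) (f O Ev : {poly CC}) m lam :
  let Z j := restr_poly (weight E phi) (below n j) in
  zero_free (weight E phi) -> normalized_activities E phi -> cmod lam < 1 ->
  O`_0 = 1 -> eqmX m.+1 (Z v.+1 * O) (Z v * Ev) -> eqmX m.+1 (O * f) Ev ->
  [/\ (Z v).[lam] != 0, 1 - cmod lam <= cmod ((Z v.+1).[lam] / (Z v).[lam]) &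
   cmod (\sum_(i < m.+1) f`_i * lam ^+ i - (Z v.+1).[lam] / (Z v).[lam])
    <= cmod lam ^+ m.+1 / (1 - cmod lam)].
Proof.
move=> Z zf nor lam1 O1 ZO Of.
have vT : v \notin below n v by rewrite inE ltnn.
pose B := restr_poly (fun W => weight E phi (v |: W)) (below n v).
have ZS : Z v.+1 = Z v + 'X * B by rewrite /Z belowS restr_polyU1.
have AB x : cmod x < 1 -> (Z v).[x] != 0 /\ cmod B.[x] <= cmod (Z v).[x].
  by move=> x1; apply: restr_poly_ratio.
have [Zl Bl] := AB lam lam1.
have l0 : 0 < 1 - cmod lam by rewrite subr_gt0.
split=> //.
  have -> : (Z v.+1).[lam] / (Z v).[lam] = 1 - (- (lam * (B.[lam] / (Z v).[lam]))).
    rewrite ZS hornerD hornerM hornerX; move: Zl; set z := (Z v).[lam]; set b := B.[lam].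
    by move=> z0; rewrite opprK mulrDl divff // mulrA.
  apply: le_trans (cmod_subl _ _); rewrite cmod1 cmodN cmodM lerD2l lerN2.
  by rewrite ler_piMr ?cmod_ge0 // cmodM cmodV ler_pdivrMr ?mul1r // cmod_gt0.
rewrite ZS; apply: ratio_truncation => //.
  exact/restr_poly_coef0/weight0.
rewrite -ZS; apply: (eqmX_cancel O1).
rewrite mulrCA; apply: eqmX_trans (_ : eqmX m.+1 (Z v * Ev) _).
  exact: eqmX_mull.
by rewrite [O * _]mulrC; apply: eqmX_sym.
Qed.

Lemma bernoulli_upper (d : RR) j : 0 <= d -> j%:R * d <= 2%:R^-1 ->
  (1 + d) ^+ j <= 1 + 2%:R * j%:R * d.
Proof.
move=> d0; elim: j => [|j IH] jd; first by rewrite mulr0 mul0r addr0.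
have jd' : j%:R * d <= 2%:R^-1 by apply: le_trans jd; rewrite ler_wpM2r // ler_nat.
rewrite exprS; apply: (@le_trans _ _ ((1 + d) * (1 + 2%:R * j%:R * d))).
  by rewrite ler_wpM2l ?IH // addr_ge0.
rewrite -natr1; have : j%:R * d * d <= 2%:R^-1 * d by rewrite ler_wpM2r.
lra.
Qed.

Lemma product_estimate n (Z est : nat -> CC) (d : RR) : Z 0%N = 1 -> 0 <= d ->
  (forall v, (v < n)%N -> Z v != 0 /\ cmod (est v - Z v.+1 / Z v) <= d * cmod (Z v.+1 / Z v)) ->
  cmod (\prod_(v < n) est v - Z n) <= ((1 + d) ^+ n - 1) * cmod (Z n).
Proof.
move=> Z0 d0; elim: n => [|n IH] H.
  by rewrite big_ord0 Z0 subrr cmod0 expr0 subrr mul0r.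
have {}IH := IH (fun v vn => H v (ltnW vn)).
have [Zn en] := H n (ltnSn n).
rewrite big_ord_recr /=; set p := \prod_(_ < n) _ in IH *; set q := Z n.+1 / Z n in en.
have qE : Z n.+1 = Z n * q by rewrite /q mulrC divfK.
clearbody q.
have -> : p * est n - Z n.+1 = (p - Z n) * (q + (est n - q)) + Z n * (est n - q).
  by rewrite qE; ring.
rewrite qE cmodM; apply: le_trans (cmodD _ _) _; rewrite !cmodM.
have h1 : cmod (q + (est n - q)) <= (1 + d) * cmod q.
  by rewrite mulrDl mul1r (le_trans (cmodD _ _)) // lerD2l.
have h2 : cmod (p - Z n) * cmod (q + (est n - q)) <=
   (((1 + d) ^+ n - 1) * cmod (Z n)) * ((1 + d) * cmod q).
  by apply: ler_pM; rewrite ?cmod_ge0.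
have h3 : cmod (Z n) * cmod (est n - q) <= cmod (Z n) * (d * cmod q).
  by rewrite ler_wpM2l ?cmod_ge0.
apply: le_trans (lerD h2 h3) _; rewrite exprS; move: ((1 + d) ^+ n) => D.
by rewrite le_eqVlt; apply/orP; left; apply/eqP; ring.
Qed.

(** In [(1 - cmod lam) ^+ 2 / 2%:R] one factor comes from the tail of the geometric series, the
    other from the lower bound on the ratio, and the 2 from [bernoulli_upper]. *)
Lemma relative_error n (E : {set {set 'I_n}}) phi lam (est : nat -> CC) (eps rho : RR) m :
  let Z j := (restr_poly (weight E phi) (below n j)).[lam] in
  zero_free (weight E phi) -> normalized_activities E phi -> cmod lam < 1 ->
  cmod lam <= rho -> 0 < eps < 1 ->
  rho ^+ m * n.+1%:R <= eps * ((1 - cmod lam) ^+ 2 / 2%:R) ->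
  (forall v, (v < n)%N -> [/\ Z v != 0, 1 - cmod lam <= cmod (Z v.+1 / Z v) &
     cmod (est v - Z v.+1 / Z v) <= cmod lam ^+ m.+1 / (1 - cmod lam)]) ->
  cmod (\prod_(v < n) est v - partition_function E phi lam)
    <= eps * cmod (partition_function E phi lam).
Proof.
move=> Z zf nor lam1 lrho /andP[e0 e1] mrho H.
have l0 : 0 < 1 - cmod lam by rewrite subr_gt0.
pose d := cmod lam ^+ m.+1 / (1 - cmod lam) ^+ 2.
have l20 : 0 < (1 - cmod lam) ^+ 2 by rewrite exprn_gt0.
have d0 : 0 <= d by rewrite divr_ge0 ?exprn_ge0 ?cmod_ge0 // ltW.
have nd : n%:R * d <= eps / 2%:R.
  rewrite /d mulrA ler_pdivrMr //; apply: (@le_trans _ _ (rho ^+ m * n.+1%:R)).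
    rewrite [leRHS]mulrC; apply: ler_pM; rewrite ?ler_nat ?exprn_ge0 ?cmod_ge0 //.
    apply: (@le_trans _ _ (cmod lam ^+ m)).
      by rewrite exprS ler_piMl ?exprn_ge0 ?cmod_ge0 // ltW.
    by apply: lerXn2r => //; rewrite nnegrE ?cmod_ge0 // (le_trans _ lrho) ?cmod_ge0.
  by apply: le_trans mrho _; rewrite mulrA mulrAC.
have ZE : partition_function E phi lam = Z n by rewrite partition_functionE /Z below_full.
have est_rel v : (v < n)%N -> Z v != 0 /\ cmod (est v - Z v.+1 / Z v) <= d * cmod (Z v.+1 / Z v).
  move=> vn; have [h1 h2 h3] := H v vn; split=> //; apply: le_trans h3 _.
  apply: (@le_trans _ _ (d * (1 - cmod lam))); last by rewrite ler_wpM2l.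
  rewrite /d le_eqVlt; apply/orP; left; apply/eqP; field; lra.
rewrite ZE; apply: le_trans (product_estimate _ d0 est_rel) _.
  rewrite /Z below0 horner_restr_poly (big_pred1 set0) => [|W]; last by rewrite /= subset0.
  by rewrite weight0 // cards0 mulr1.
apply: ler_wpM2r; first exact: cmod_ge0.
have := @bernoulli_upper d n d0; lra.
Qed.

(** Summation over complements: symmetry conjugates the weight, and [lam ^+ #|~: S|] is [lam ^+ n]
    times an inverse power. *)
Lemma partition_function_inv n (E : {set {set 'I_n}}) phi lam : lam != 0 ->
  symmetric_activities E phi ->
  partition_function E phi lam = lam ^+ n * conjc (partition_function E phi (conjc lam)^-1).
Proof.
move=> l0 sym; rewrite /partition_function (rmorph_sum (@conjc RR)) mulr_sumr.
rewrite (reindex_inj (inv_inj (@setCK _))) /=; apply: eq_bigr => S _.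
rewrite rmorphM rmorphXn /= rmorph_prod mulrCA; congr (_ * _).
  apply: eq_bigr => e eE; rewrite sym ?subsetIr //; congr (conjc (phi e _)).
  by apply/setP => u; rewrite !inE negb_and negbK; case: (u \in e); rewrite ?orbF ?andbF ?andbT.
have -> : conjc (conjc lam)^-1 = lam^-1 by rewrite conjc_inv conjcK.
have -> : lam ^+ n = lam ^+ #|S| * lam ^+ #|~: S| by rewrite -exprD cardsC card_ord.
by rewrite exprVn mulrAC divff ?mul1r // expf_neq0.
Qed.

(** * Structured programs *)

Definition mem := ((nat -> nat) * (nat -> RR))%type.

Inductive rcmd : Type :=
| RSkip
| RI of instr
| RSeq of rcmd & rcmd
| RIfN of nat & nat & rcmd & rcmd
| RWhN of nat & nat & rcmd
| RWhR of nat & nat & rcmd.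

(** Defined through [step] on a one-instruction program, so that the semantics of the machine is not
    stated a second time. *)
Definition ieff (i : instr) (m : mem) : option mem :=
  match i with
  | JmpNLt _ _ _ | JmpRLt _ _ _ | Jmp _ | Halt => None
  | _ => if step [:: i] (State 0 m.1 m.2) is Some s then Some (nmem s, rmem s) else None
  end.

(** The times are exact for the code of [asm]: one test for a conditional, one jump more in its
    second branch, and a test and a jump for each pass and for the exit of a loop. *)
Inductive rrun : rcmd -> mem -> nat -> mem -> Prop :=
| run_skip m : rrun RSkip m 0 m
| run_i i m m' : ieff i m = Some m' -> rrun (RI i) m 1 m'
| run_seq c1 c2 m1 m2 m3 t1 t2 : rrun c1 m1 t1 m2 -> rrun c2 m2 t2 m3 ->
    rrun (RSeq c1 c2) m1 (t1 + t2) m3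
| run_ifT a b c1 c2 m m' t : (m.1 a < m.1 b)%N -> rrun c1 m t m' -> rrun (RIfN a b c1 c2) m t.+1 m'
| run_ifF a b c1 c2 m m' t : (m.1 a < m.1 b)%N = false -> rrun c2 m t m' ->
    rrun (RIfN a b c1 c2) m t.+2 m'
| run_whNF a b c m : (m.1 a < m.1 b)%N = false -> rrun (RWhN a b c) m 2 m
| run_whNT a b c m m' m'' t t' : (m.1 a < m.1 b)%N -> rrun c m t m' -> rrun (RWhN a b c) m' t' m'' ->
    rrun (RWhN a b c) m (t + t').+2 m''
| run_whRF a b c m : (m.2 a < m.2 b) = false -> rrun (RWhR a b c) m 2 m
| run_whRT a b c m m' m'' t t' : m.2 a < m.2 b -> rrun c m t m' -> rrun (RWhR a b c) m' t' m'' ->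
    rrun (RWhR a b c) m (t + t').+2 m''.

Fixpoint rsize (c : rcmd) : nat :=
  match c with
  | RSkip => 0
  | RI _ => 1
  | RSeq c1 c2 => rsize c1 + rsize c2
  | RIfN _ _ c1 c2 => (rsize c2).+2 + rsize c1
  | RWhN _ _ c | RWhR _ _ c => (rsize c).+3
  end.

(** The machine jumps when a comparison holds, so the branch for the false case directly follows the
    test. *)
Fixpoint asm (c : rcmd) (p : nat) : seq instr :=
  match c with
  | RSkip => [::]
  | RI i => [:: i]
  | RSeq c1 c2 => asm c1 p ++ asm c2 (p + rsize c1)
  | RIfN a b c1 c2 =>
      JmpNLt a b (p + (rsize c2).+2) :: asm c2 p.+1 ++
      Jmp (p + ((rsize c2).+2 + rsize c1)) :: asm c1 (p + (rsize c2).+2)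
  | RWhN a b c => [:: JmpNLt a b p.+2, Jmp (p + (rsize c).+3) & asm c p.+2 ++ [:: Jmp p]]
  | RWhR a b c => [:: JmpRLt a b p.+2, Jmp (p + (rsize c).+3) & asm c p.+2 ++ [:: Jmp p]]
  end.

Lemma size_asm c p : size (asm c p) = rsize c.
Proof.
by elim: c p => //= [c1 IH1 c2 IH2|a b c1 IH1 c2 IH2|a b c IH|a b c IH] p;
  rewrite !size_cat /= ?IH1 ?IH2 ?IH ?addn1 ?addnS ?addSn.
Qed.

Definition code_at (P : program) (p : nat) (l : seq instr) :=
  exists pre post, P = pre ++ l ++ post /\ size pre = p.

Lemma code_at_cat P p l1 l2 : code_at P p (l1 ++ l2) ->
  code_at P p l1 /\ code_at P (p + size l1) l2.
Proof.
move=> [pre [post [-> <-]]]; split; first by exists pre, (l2 ++ post); rewrite !catA.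
by exists (pre ++ l1), post; rewrite !catA size_cat.
Qed.

Lemma code_at_cons P p i l : code_at P p (i :: l) -> nth Halt P p = i /\ code_at P p.+1 l.
Proof.
move=> [pre [post [-> <-]]]; split; first by rewrite nth_cat ltnn subnn.
by exists (rcons pre i), post; rewrite size_rcons cat_rcons.
Qed.

Lemma exec_add P t1 t2 s : exec P (t1 + t2) s = exec P t2 (exec P t1 s).
Proof.
elim: t1 s => //= t1 IH s; case E: (step P s) => [s1|]; first exact: IH.
by case: t2 {IH} => //= t2; rewrite E.
Qed.

Lemma step_jumpN (P : program) p N R a b l : nth Halt P p = JmpNLt a b l ->
  step P (State p N R) = Some (State (if (N a < N b)%N then l else p.+1) N R).
Proof. by move=> /= ->. Qed.

Lemma step_jumpR (P : program) p N R a b l : nth Halt P p = JmpRLt a b l ->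
  step P (State p N R) = Some (State (if R a < R b then l else p.+1) N R).
Proof. by move=> /= ->. Qed.

Lemma step_jump (P : program) p N R l : nth Halt P p = Jmp l ->
  step P (State p N R) = Some (State l N R).
Proof. by move=> /= ->. Qed.

Lemma step_ieff (P : program) p i m m' : nth Halt P p = i -> ieff i m = Some m' ->
  step P (State p m.1 m.2) = Some (State p.+1 m'.1 m'.2).
Proof.
case: m m' => N R [N' R'] /= ->; case: i => //=; intros;
  match goal with H : Some _ = Some _ |- _ => injection H as <- <- end; by [].
Qed.

Lemma execS (P : program) t s s1 : step P s = Some s1 -> exec P t.+1 s = exec P t s1.
Proof. by move=> /= ->. Qed.

Lemma asm_correct c m t m' : rrun c m t m' -> forall P p, code_at P p (asm c p) ->
  exec P t (State p m.1 m.2) = State (p + rsize c) m'.1 m'.2.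
Proof.
elim=> {c m t m'}.
- by move=> m P p _; rewrite addn0.
- move=> i m m' iE P p /code_at_cons[E _].
  by rewrite (execS _ (step_ieff E iE)) addn1.
- move=> c1 c2 m1 m2 m3 t1 t2 _ IH1 _ IH2 P p /code_at_cat[h1 h2].
  by move: h2; rewrite exec_add (IH1 _ _ h1) size_asm => /IH2->; rewrite /= addnA.
- move=> a b c1 c2 m m' t ab _ IH P p /code_at_cons[E /code_at_cat[_ /code_at_cons[_ h]]].
  have {}h : code_at P (p + (rsize c2).+2) (asm c1 (p + (rsize c2).+2)).
    by move: h; rewrite size_asm addnS !addSn -!addnS.
  by rewrite (execS _ (step_jumpN _ _ E)) ab IH //= addnA.
- move=> a b c1 c2 m m' t ab _ IH P p.
  move=> /code_at_cons[E /code_at_cat[h /code_at_cons[E' _]]].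
  rewrite (execS _ (step_jumpN _ _ E)) ab -addn1 exec_add IH //.
  by move: E'; rewrite size_asm => /step_jump E'; rewrite (execS _ (E' _ _)).
- move=> a b c m ab P p /code_at_cons[E /code_at_cons[E' _]].
  by rewrite (execS _ (step_jumpN _ _ E)) ab (execS _ (step_jump _ _ E')).
- move=> a b c m m' m'' t t' ab _ IH _ IHw P p h.
  have := h => /code_at_cons[E /code_at_cons[_ /code_at_cat[hc /code_at_cons[E' _]]]].
  rewrite (execS _ (step_jumpN _ _ E)) ab -addnS exec_add IH //.
  by move: E'; rewrite size_asm => /step_jump E'; rewrite (execS _ (E' _ _)) IHw.
- move=> a b c m ab P p /code_at_cons[E /code_at_cons[E' _]].
  by rewrite (execS _ (step_jumpR _ _ E)) ab (execS _ (step_jump _ _ E')).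
- move=> a b c m m' m'' t t' ab _ IH _ IHw P p h.
  have := h => /code_at_cons[E /code_at_cons[_ /code_at_cat[hc /code_at_cons[E' _]]]].
  rewrite (execS _ (step_jumpR _ _ E)) ab -addnS exec_add IH //.
  by move: E'; rewrite size_asm => /step_jump E'; rewrite (execS _ (E' _ _)) IHw.
Qed.

(** The program ends by running off its code, where [nth] returns the default [Halt]. *)
Lemma asm_halts c N R t m' : rrun c (N, R) t m' ->
  halts_within (asm c 0) (State 0 N R) t (State (rsize c) m'.1 m'.2).
Proof.
move=> r; have code : code_at (asm c 0) 0 (asm c 0) by exists [::], [::]; rewrite cats0.
split; first exact: (asm_correct r code).
by rewrite /halted /= nth_default // size_asm.
Qed.

(** * An imperative language with bounded sums and products *)

(** Cells below [nregs] hold variables and temporaries; [stride] is a power of 2 because an array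
    index is scaled by doubling. Both become opaque so that large unary numbers are not unfolded. *)
Definition nregs : nat := 256.
Definition stride : nat := 64.

Lemma nregs_gt : (20 < nregs)%N. Proof. by []. Qed.
Lemma strideE : stride = 64. Proof. by []. Qed.

Opaque nregs stride.

Record st := St {
  nv : nat -> nat; na : nat -> nat -> nat; cv : nat -> CC; ca : nat -> nat -> CC }.

Definition setn s x v := St (updN (nv s) x v) (na s) (cv s) (ca s).
Definition setna s a i v :=
  St (nv s) (fun a' i' => if (a' == a) && (i' == i) then v else na s a' i') (cv s) (ca s).
Definition setc s x v := St (nv s) (na s) (fun x' => if x' == x then v else cv s x') (ca s).
Definition setca s a i v :=
  St (nv s) (na s) (cv s) (fun a' i' => if (a' == a) && (i' == i) then v else ca s a' i').

(** Bounded sums, and products in [cexp], are expressions, so that the value of a fragment is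
    literally the big operator of its specification. *)
Inductive nexp : Type :=
| ncst of nat
| nvar of nat
| nadd of nexp & nexp
| nsub of nexp & nexp
| nite of nexp & nexp & nexp & nexp
| narr of nat & nexp
| nsum of nat & nat & nexp.

Fixpoint nev (e : nexp) (s : st) : nat :=
  match e with
  | ncst c => c
  | nvar x => nv s x
  | nadd e1 e2 => nev e1 s + nev e2 s
  | nsub e1 e2 => nev e1 s - nev e2 s
  | nite e1 e2 e3 e4 => if (nev e1 s < nev e2 s)%N then nev e3 s else nev e4 s
  | narr a e => na s a (nev e s)
  | nsum x y e => (\sum_(i < nv s y) nev e (setn s x i))%N
  end.

Inductive cexp : Type :=
| ccst of CC
| cvar of nat
| cnat of nexp
| cadd of cexp & cexp
| csub of cexp & cexp
| cmul of cexp & cexp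
| ccj of cexp
| cite of nexp & nexp & cexp & cexp
| carr of nat & nexp
| cbig of bool & nat & nat & cexp.

Fixpoint cev (e : cexp) (s : st) : CC :=
  match e with
  | ccst z => z
  | cvar x => cv s x
  | cnat e => (nev e s)%:R
  | cadd e1 e2 => cev e1 s + cev e2 s
  | csub e1 e2 => cev e1 s - cev e2 s
  | cmul e1 e2 => cev e1 s * cev e2 s
  | ccj e => conjc (cev e s)
  | cite e1 e2 e3 e4 => if (nev e1 s < nev e2 s)%N then cev e3 s else cev e4 s
  | carr a e => ca s a (nev e s)
  | cbig b x y e => if b then \prod_(i < nv s y) cev e (setn s x i)
                    else \sum_(i < nv s y) cev e (setn s x i)
  end.

Inductive cmd : Type :=
| cskip
| nset of nat & nexp
| nput of nat & nexp & nexp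
| cset of nat & cexp
| cput of nat & nexp & cexp
| cseq of cmd & cmd
| cif of nexp & nexp & cmd & cmd
| cfor of nat & nat & cmd.

Fixpoint for_st (f : st -> st) (x : nat) (k : nat) (s : st) : st :=
  if k is k'.+1 then setn (f (for_st f x k' s)) x k else setn s x 0.

Fixpoint ev (c : cmd) (s : st) : st :=
  match c with
  | cskip => s
  | nset x e => setn s x (nev e s)
  | nput a e1 e2 => setna s a (nev e1 s) (nev e2 s)
  | cset x e => setc s x (cev e s)
  | cput a e1 e2 => setca s a (nev e1 s) (cev e2 s)
  | cseq c1 c2 => ev c2 (ev c1 s)
  | cif e1 e2 c1 c2 => if (nev e1 s < nev e2 s)%N then ev c1 s else ev c2 s
  | cfor x y c => for_st (ev c) x (nv s y) s
  end.

(* The loop bounds are variables satisfying [B]; these are never assigned, so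
   that running times can be read off the initial state. *)
Fixpoint nwf (B : pred nat) (tau : nat) (e : nexp) : bool :=
  (2 * tau + 12 < nregs)%N && match e with
  | ncst _ => true
  | nvar x => (2 + 2 * x < nregs)%N
  | nadd e1 e2 | nsub e1 e2 => nwf B tau e1 && nwf B tau.+1 e2
  | nite e1 e2 e3 e4 => [&& nwf B tau e1, nwf B tau.+1 e2, nwf B tau e3 & nwf B tau e4]
  | narr a e => (a < stride)%N && nwf B tau e
  | nsum x y e => [&& ~~ B x, B y, 2 + 2 * x < nregs, 2 + 2 * y < nregs & nwf B tau.+2 e]%N
  end.

Fixpoint xwf (B : pred nat) (tau : nat) (e : cexp) : bool :=
  (4 * tau + 20 < nregs)%N && match e with
  | ccst _ => true
  | cvar x => (4 * x + 1 < nregs)%N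
  | cnat e => nwf B tau e
  | cadd e1 e2 | csub e1 e2 | cmul e1 e2 => xwf B tau e1 && xwf B tau.+1 e2
  | ccj e => xwf B tau e
  | cite e1 e2 e3 e4 => [&& nwf B tau e1, nwf B tau.+1 e2, xwf B tau e3 & xwf B tau e4]
  | carr a e => (2 * a + 1 < stride)%N && nwf B tau e
  | cbig b x y e => [&& ~~ B x, B y, 2 + 2 * x < nregs, 2 + 2 * y < nregs & xwf B tau.+1 e]%N
  end.

Fixpoint nmods (c : cmd) : seq nat :=
  match c with
  | nset x _ => [:: x]
  | cseq c1 c2 | cif _ _ c1 c2 => nmods c1 ++ nmods c2
  | cfor x _ c => x :: nmods c
  | _ => [::]
  end.

Fixpoint cwf (B : pred nat) (c : cmd) : bool :=
  match c with
  | cskip => true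
  | nset x e => [&& ~~ B x, 2 + 2 * x < nregs & nwf B 0 e]%N
  | nput a e1 e2 => [&& a < stride, nwf B 0 e1 & nwf B 1 e2]%N
  | cset x e => (4 * x + 1 < nregs)%N && xwf B 0 e
  | cput a e1 e2 => [&& 2 * a + 1 < stride, nwf B 0 e1 & xwf B 1 e2]%N
  | cseq c1 c2 => cwf B c1 && cwf B c2
  | cif e1 e2 c1 c2 => [&& nwf B 0 e1, nwf B 1 e2, cwf B c1 & cwf B c2]
  | cfor x y c => [&& ~~ B x, B y, x \notin nmods c, 2 + 2 * x < nregs, 2 + 2 * y < nregs & cwf B c]%N
  end.

(** Upper bounds, where [f] gives the values of the variables: only loop bounds are read, and both
    branches of a conditional are charged. *)
Fixpoint ncost (e : nexp) (f : nat -> nat) : nat :=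
  match e with
  | ncst _ | nvar _ => 2
  | nadd e1 e2 | nsub e1 e2 => ncost e1 f + ncost e2 f + 1
  | nite e1 e2 e3 e4 => ncost e1 f + ncost e2 f + ncost e3 f + ncost e4 f + 2
  | narr _ e => ncost e f + 10
  | nsum x y e => f y * (ncost e f + 5) + 8
  end.

Fixpoint xcost (e : cexp) (f : nat -> nat) : nat :=
  match e with
  | ccst _ | cvar _ => 4
  | cnat e => ncost e f + 2
  | cadd e1 e2 | csub e1 e2 | cmul e1 e2 => xcost e1 f + xcost e2 f + 8
  | ccj e => xcost e f + 2
  | cite e1 e2 e3 e4 => ncost e1 f + ncost e2 f + xcost e3 f + xcost e4 f + 2
  | carr _ e => ncost e f + 13
  | cbig _ x y e => f y * (xcost e f + 12) + 9
  end.

Fixpoint cost (c : cmd) (f : nat -> nat) : nat :=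
  match c with
  | cskip => 0
  | nset x e => ncost e f + 2
  | nput a e1 e2 => ncost e1 f + ncost e2 f + 10
  | cset x e => xcost e f + 4
  | cput a e1 e2 => ncost e1 f + xcost e2 f + 13
  | cseq c1 c2 => cost c1 f + cost c2 f
  | cif e1 e2 c1 c2 => ncost e1 f + ncost e2 f + cost c1 f + cost c2 f + 2
  | cfor x y c => f y * (cost c f + 4) + 3
  end.

(** * Compilation to machine instructions *)

Definition ris (l : seq instr) : rcmd := foldr (fun i c => RSeq (RI i) c) RSkip l.

Fixpoint iseq (l : seq instr) (m : mem) : option mem :=
  if l is i :: l' then (if ieff i m is Some m' then iseq l' m' else None) else Some m.

Lemma run_iseq l m m' : iseq l m = Some m' -> rrun (ris l) m (size l) m'.
Proof.
elim: l m => [|i l IH] m /=; first by case=> <-; apply: run_skip.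
by case E: (ieff i m) => [m1|//] /IH r; rewrite -add1n; apply: run_seq r; apply: run_i.
Qed.

(* Natural cell 0 holds the base address of the arrays, which are interleaved
   with period [stride], and cell 1 is scratch; below the base, variables and
   temporaries (indexed by the depth [tau] of the expression) alternate.  A
   complex number occupies two consecutive real cells. *)
Definition tn tau : nat := (3 + 2 * tau)%N.
Definition vn x : nat := (2 + 2 * x)%N.
Definition tre tau : nat := (4 * tau + 2)%N.
Definition tim tau : nat := (4 * tau + 3)%N.

(** Leaves the address of an array entry in cell 1; six additions multiply the index by [stride],
    which is [2 ^ 6]. *)
Definition addr_code tau a : seq instr :=
  [:: NAdd 1 (tn tau) (tn tau); NAdd 1 1 1; NAdd 1 1 1; NAdd 1 1 1; NAdd 1 1 1; NAdd 1 1 1;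
      NAdd 1 1 0; NConst (tn tau) a; NAdd 1 1 (tn tau)].

(** Copying is addition to 0. A bounded sum saves its index variable in a temporary and restores it,
    so that evaluation changes no variable. *)
Fixpoint ncomp (tau : nat) (e : nexp) : rcmd :=
  match e with
  | ncst c => ris [:: NConst (tn tau) c]
  | nvar x => ris [:: NConst (tn tau) 0; NAdd (tn tau) (tn tau) (vn x)]
  | nadd e1 e2 => RSeq (ncomp tau e1) (RSeq (ncomp tau.+1 e2)
                    (ris [:: NAdd (tn tau) (tn tau) (tn tau.+1)]))
  | nsub e1 e2 => RSeq (ncomp tau e1) (RSeq (ncomp tau.+1 e2)
                    (ris [:: NSub (tn tau) (tn tau) (tn tau.+1)]))
  | nite e1 e2 e3 e4 => RSeq (ncomp tau e1) (RSeq (ncomp tau.+1 e2)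
                    (RIfN (tn tau) (tn tau.+1) (ncomp tau e3) (ncomp tau e4)))
  | narr a e => RSeq (ncomp tau e) (ris (addr_code tau a ++ [:: NLoad (tn tau) 1]))
  | nsum x y e =>
      RSeq (ris [:: NConst (tn tau) 0; NConst (tn tau.+1) 0;
                    NAdd (tn tau.+1) (tn tau.+1) (vn x); NConst (vn x) 0])
     (RSeq (RWhN (vn x) (vn y) (RSeq (ncomp tau.+2 e)
              (ris [:: NAdd (tn tau) (tn tau) (tn tau.+2); NConst 1 1; NAdd (vn x) (vn x) 1])))
           (ris [:: NConst (vn x) 0; NAdd (vn x) (vn x) (tn tau.+1)]))
  end.

Definition mul_code tau : seq instr :=
  [:: RMul (tre tau.+2) (tre tau) (tre tau.+1); RMul (tim tau.+2) (tim tau) (tim tau.+1);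
      RSub (tre tau.+2) (tre tau.+2) (tim tau.+2); RMul (tim tau.+2) (tre tau) (tim tau.+1);
      RMul (tim tau) (tim tau) (tre tau.+1); RAdd (tim tau) (tim tau.+2) (tim tau);
      RConst (tre tau) 0; RAdd (tre tau) (tre tau) (tre tau.+2)].

Definition add_code tau : seq instr :=
  [:: RAdd (tre tau) (tre tau) (tre tau.+1); RAdd (tim tau) (tim tau) (tim tau.+1)].

Definition sub_code tau : seq instr :=
  [:: RSub (tre tau) (tre tau) (tre tau.+1); RSub (tim tau) (tim tau) (tim tau.+1)].

Fixpoint xcomp (tau : nat) (e : cexp) : rcmd :=
  match e with
  | ccst z => ris [:: RConst (tre tau) (complex.Re z); RConst (tim tau) (complex.Im z)]
  | cvar x => ris [:: RConst (tre tau) 0; RAdd (tre tau) (tre tau) (4 * x);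
                      RConst (tim tau) 0; RAdd (tim tau) (tim tau) (4 * x).+1]
  | cnat e => RSeq (ncomp tau e) (ris [:: OfNat (tre tau) (tn tau); RConst (tim tau) 0])
  | cadd e1 e2 => RSeq (xcomp tau e1) (RSeq (xcomp tau.+1 e2) (ris (add_code tau)))
  | csub e1 e2 => RSeq (xcomp tau e1) (RSeq (xcomp tau.+1 e2) (ris (sub_code tau)))
  | cmul e1 e2 => RSeq (xcomp tau e1) (RSeq (xcomp tau.+1 e2) (ris (mul_code tau)))
  | ccj e => RSeq (xcomp tau e)
      (ris [:: RConst (tre tau.+1) 0; RSub (tim tau) (tre tau.+1) (tim tau)])
  | cite e1 e2 e3 e4 => RSeq (ncomp tau e1) (RSeq (ncomp tau.+1 e2)
                    (RIfN (tn tau) (tn tau.+1) (xcomp tau e3) (xcomp tau e4)))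
  | carr a e => RSeq (ncomp tau e) (ris (addr_code tau (2 * a) ++
      [:: RLoad (tre tau) 1; NConst (tn tau) 1; NAdd 1 1 (tn tau); RLoad (tim tau) 1]))
  | cbig b x y e =>
      RSeq (ris [:: RConst (tre tau) (if b then 1 else 0); RConst (tim tau) 0;
                    NConst (tn tau) 0; NAdd (tn tau) (tn tau) (vn x); NConst (vn x) 0])
     (RSeq (RWhN (vn x) (vn y) (RSeq (xcomp tau.+1 e)
              (ris ((if b then mul_code tau else add_code tau) ++
                    [:: NConst 1 1; NAdd (vn x) (vn x) 1]))))
           (ris [:: NConst (vn x) 0; NAdd (vn x) (vn x) (tn tau)]))
  end.

Fixpoint comp (c : cmd) : rcmd :=
  match c with
  | cskip => RSkip
  | nset x e => RSeq (ncomp 0 e) (ris [:: NConst (vn x) 0; NAdd (vn x) (vn x) (tn 0)])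
  | nput a e1 e2 => RSeq (ncomp 0 e1) (RSeq (ncomp 1 e2)
      (ris (addr_code 0 a ++ [:: NStore 1 (tn 1)])))
  | cset x e => RSeq (xcomp 0 e)
      (ris [:: RConst (4 * x) 0; RAdd (4 * x) (4 * x) (tre 0);
               RConst (4 * x).+1 0; RAdd (4 * x).+1 (4 * x).+1 (tim 0)])
  | cput a e1 e2 => RSeq (ncomp 0 e1) (RSeq (xcomp 1 e2)
      (ris (addr_code 0 (2 * a) ++
        [:: RStore 1 (tre 1); NConst (tn 0) 1; NAdd 1 1 (tn 0); RStore 1 (tim 1)])))
  | cseq c1 c2 => RSeq (comp c1) (comp c2)
  | cif e1 e2 c1 c2 => RSeq (ncomp 0 e1) (RSeq (ncomp 1 e2)
      (RIfN (tn 0) (tn 1) (comp c1) (comp c2)))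
  | cfor x y c => RSeq (ris [:: NConst (vn x) 0])
      (RWhN (vn x) (vn y) (RSeq (comp c) (ris [:: NConst 1 1; NAdd (vn x) (vn x) 1])))
  end.

(** * Correctness of the compiler *)

Definition scrN tau x : bool := (x == 1) || [&& x < nregs, odd x & tn tau <= x]%N.
Definition scrR tau x : bool := [&& x < nregs, 2 <= x %% 4 & tre tau <= x]%N.

(** Temporaries of depth below [tau] survive, so a left operand is still there after the right one
    has been evaluated at depth [tau.+1]. *)
Definition keep tau (m m' : mem) :=
  (forall x, ~~ scrN tau x -> m'.1 x = m.1 x) /\ (forall x, ~~ scrR tau x -> m'.2 x = m.2 x).

Definition simN (m : nat -> nat) (s : st) :=
  [/\ (nregs <= m 0)%N,
      (forall x, (vn x < nregs)%N -> m (vn x) = nv s x) &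
      (forall a i, (a < stride)%N -> m (m 0 + (stride * i + a))%N = na s a i)].

Definition simR (b : nat) (m : nat -> RR) (s : st) :=
  (forall x, (4 * x + 1 < nregs)%N ->
     m (4 * x)%N = complex.Re (cv s x) /\ m (4 * x).+1 = complex.Im (cv s x)) /\
  (forall a i, (2 * a + 1 < stride)%N ->
     m (b + (stride * i + 2 * a))%N = complex.Re (ca s a i) /\
     m (b + (stride * i + 2 * a)).+1 = complex.Im (ca s a i)).

Definition sim (m : mem) (s : st) := simN m.1 s /\ simR (m.1 0%N) m.2 s.

Lemma scrN_mono tau tau' x : (tau <= tau')%N -> ~~ scrN tau x -> ~~ scrN tau' x.
Proof. rewrite /scrN /tn; lia. Qed.

Lemma scrR_mono tau tau' x : (tau <= tau')%N -> ~~ scrR tau x -> ~~ scrR tau' x.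
Proof. rewrite /scrR /tre; lia. Qed.

Lemma arr_scrN tau b j : (nregs <= b)%N -> ~~ scrN tau (b + j).
Proof. have := nregs_gt; rewrite /scrN; lia. Qed.

Lemma arr_scrR tau b j : (nregs <= b)%N -> ~~ scrR tau (b + j).
Proof. rewrite /scrR; lia. Qed.

Lemma keep_trans tau m1 m2 m3 : keep tau m1 m2 -> keep tau m2 m3 -> keep tau m1 m3.
Proof. by move=> [h1 h2] [h3 h4]; split=> x xs; rewrite ?h3 ?h4 ?h1 ?h2. Qed.

Lemma keep_mono tau tau' m m' : (tau <= tau')%N -> keep tau' m m' -> keep tau m m'.
Proof.
by move=> le [h1 h2]; split=> x xs; [apply/h1/(scrN_mono le)|apply/h2/(scrR_mono le)].
Qed.

Lemma sim_keep tau m m' s : keep tau m m' -> sim m s -> sim m' s.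
Proof.
move=> [kN kR] [[b hv ha] [hc hca]].
have k0 : m'.1 0%N = m.1 0%N by apply: kN; rewrite /scrN /tn; lia.
split; split; rewrite ?k0 //.
- by move=> x xs; rewrite kN ?hv // /scrN /vn /tn; lia.
- by move=> a i ai; rewrite kN ?ha // arr_scrN.
- move=> x xs; have [<- <-] := hc x xs.
  by split; apply: kR; rewrite /scrR /tre; lia.
- move=> a i ai; have [<- <-] := hca a i ai.
  by split; apply: kR; rewrite -?addnS arr_scrR.
Qed.

Lemma sim_setn m m' s x v :
  (vn x < nregs)%N -> (forall z, ~~ scrN 0 z -> z != vn x -> m'.1 z = m.1 z) ->
  (forall z, ~~ scrR 0 z -> m'.2 z = m.2 z) -> m'.1 (vn x) = v ->
  sim m s -> sim m' (setn s x v).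
Proof.
move=> xs kN kR xv [[b hv ha] [hc hca]].
have k0 : m'.1 0%N = m.1 0%N by apply: kN; rewrite /scrN /tn /vn; lia.
split; split; rewrite ?k0 //=.
- move=> z zs; rewrite /updN; case: eqP => [->//|/eqP zx].
  by rewrite kN ?hv // /scrN /tn; move: zx zs; rewrite /vn; lia.
- by move=> a i ai; rewrite kN ?ha ?arr_scrN //; move: xs; rewrite /vn; lia.
- move=> z zs; have [<- <-] := hc z zs.
  by split; apply: kR; rewrite /scrR /tre; lia.
- move=> a i ai; have [<- <-] := hca a i ai.
  by split; apply: kR; rewrite -?addnS arr_scrR.
Qed.

Lemma updN_eq f d v : updN f d v d = v. Proof. by rewrite /updN eqxx. Qed.
Lemma updN_neq f d v x : x != d -> updN f d v x = f x.
Proof. by rewrite /updN => /negbTE->. Qed.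
Lemma updR_eq f d v : updR f d v d = v. Proof. by rewrite /updR eqxx. Qed.
Lemma updR_neq f d v x : x != d -> updR f d v x = f x.
Proof. by rewrite /updR => /negbTE->. Qed.

Ltac upd_simpl := repeat (rewrite updN_eq || rewrite updR_eq ||
  (rewrite updN_neq; [|by rewrite /tn /vn; lia]) ||
  (rewrite updR_neq; [|by rewrite /tre /tim; lia])).

Lemma iseq_cat l1 l2 m m1 : iseq l1 m = Some m1 -> iseq (l1 ++ l2) m = iseq l2 m1.
Proof. by elim: l1 m => [|i l1 IH] m /=; [case=> ->|case: (ieff i m) => // m2 /IH]. Qed.

Lemma iseq_cons i l m m1 : ieff i m = Some m1 -> iseq (i :: l) m = iseq l m1.
Proof. by move=> /= ->. Qed.

Lemma run_ris l m m' t : iseq l m = Some m' -> t = size l -> rrun (ris l) m t m'.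
Proof. by move=> /run_iseq r ->. Qed.

Lemma iseq_double j r m : exists m', [/\ iseq (nseq j (NAdd r r r)) m = Some m',
  m'.1 r = (2 ^ j * m.1 r)%N, forall x, x != r -> m'.1 x = m.1 x & m'.2 = m.2].
Proof.
elim: j m => [|j IH] [N R]; first by exists (N, R); rewrite mul1n.
have [m' [i' d' k' R']] := IH (updN N r (N r + N r), R)%N.
exists m'; split=> //=; first by rewrite d' /= updN_eq expnS; lia.
by move=> x x1; rewrite k' //= updN_neq.
Qed.

Lemma iseq_addr tau a m : exists m', [/\ iseq (addr_code tau a) m = Some m',
  m'.1 1%N = (m.1 0 + (stride * m.1 (tn tau) + a))%N,
  forall x, x != 1%N -> x != tn tau -> m'.1 x = m.1 x & m'.2 = m.2].
Proof.
case: m => N R; set t := tn tau.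
have t0 : t != 0%N by rewrite /t /tn.
have t1 : t != 1%N by rewrite /t /tn.
have [m1 [i1 d1 k1 R1]] := iseq_double 5 1 (updN N 1 (N t + N t), R)%N.
have e0 : m1.1 0%N = N 0%N by rewrite k1.
have et : m1.1 t = N t by rewrite k1 //= updN_neq.
pose v := (m1.1 1 + m1.1 0)%N.
pose m2 : mem := (updN m1.1 1 v, m1.2).
pose m3 : mem := (updN m2.1 t a, m2.2).
pose m4 : mem := (updN m3.1 1 (m3.1 1 + m3.1 t), m3.2)%N.
have E : addr_code tau a =
  NAdd 1 t t :: nseq 5 (NAdd 1 1 1) ++ [:: NAdd 1 1 0; NConst t a; NAdd 1 1 t] by [].
exists m4; split.
- rewrite E (@iseq_cons _ _ _ (updN N 1 (N t + N t), R)%N) // (iseq_cat _ i1).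
  by rewrite (@iseq_cons _ _ _ m2) // (@iseq_cons _ _ _ m3) // (@iseq_cons _ _ _ m4).
- have -> : m4.1 1%N = (m2.1 1%N + a)%N.
    by rewrite /m4 /m3 [LHS]updN_eq [X in (_ + X)%N]updN_eq [X in (X + _)%N]updN_neq // eq_sym.
  rewrite [m2.1 1%N]updN_eq /v d1 e0 [X in (_ * X)%N]updN_eq /= strideE; lia.
- move=> x x1 xt; rewrite [LHS]updN_neq // [LHS]updN_neq // [LHS]updN_neq // k1 //.
  by rewrite [LHS]updN_neq.
by rewrite /m4 /m3 /m2 R1.
Qed.

(** Bound variables are never assigned, so the cost of a loop body is the same at every pass. *)
Lemma ncost_eq B e tau f g : nwf B tau e -> (forall y, B y -> f y = g y) -> ncost e f = ncost e g.
Proof.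
move=> + fg; elim: e tau => //= [e1 IH1 e2 IH2|e1 IH1 e2 IH2|e1 IH1 e2 IH2 e3 IH3 e4 IH4|a e IH|x y e IH] tau.
- by move=> /and3P[_ /IH1-> /IH2->].
- by move=> /and3P[_ /IH1-> /IH2->].
- by move=> /and5P[_ /IH1-> /IH2-> /IH3-> /IH4->].
- by move=> /and3P[_ _ /IH->].
by move=> /andP[_ /and5P[_ /fg-> _ _ /IH->]].
Qed.

Lemma xcost_eq B e tau f g : xwf B tau e -> (forall y, B y -> f y = g y) -> xcost e f = xcost e g.
Proof.
move=> + fg; elim: e tau => //= [e|e1 IH1 e2 IH2|e1 IH1 e2 IH2|e1 IH1 e2 IH2|e IH|e1 e2 e3 IH3 e4 IH4|a e|b x y e IH] tau.
- by move=> /andP[_ w]; rewrite (ncost_eq w fg).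
- by move=> /and3P[_ /IH1-> /IH2->].
- by move=> /and3P[_ /IH1-> /IH2->].
- by move=> /and3P[_ /IH1-> /IH2->].
- by move=> /andP[_ /IH->].
- by move=> /and5P[_ w1 w2 /IH3-> /IH4->]; rewrite (ncost_eq w1 fg) (ncost_eq w2 fg).
- by move=> /and3P[_ _ w]; rewrite (ncost_eq w fg).
by move=> /andP[_ /and5P[_ /fg-> _ _ /IH->]].
Qed.

Lemma cost_eq B c f g : cwf B c -> (forall y, B y -> f y = g y) -> cost c f = cost c g.
Proof.
move=> + fg; elim: c => //= [x e|a e1 e2|x e|a e1 e2|c1 IH1 c2 IH2|e1 e2 c1 IH1 c2 IH2|x y c IH].
- by move=> /and3P[_ _ w]; rewrite (ncost_eq w fg).
- by move=> /and3P[_ w1 w2]; rewrite (ncost_eq w1 fg) (ncost_eq w2 fg).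
- by move=> /andP[_ w]; rewrite (xcost_eq w fg).
- by move=> /and3P[_ w1 w2]; rewrite (ncost_eq w1 fg) (xcost_eq w2 fg).
- by move=> /andP[/IH1-> /IH2->].
- by move=> /and4P[w1 w2 /IH1-> /IH2->]; rewrite (ncost_eq w1 fg) (ncost_eq w2 fg).
by move=> /and5P[_ /fg-> _ _ /andP[_ /IH->]].
Qed.

Lemma keep_scr tau (m m' : mem) : (forall x, ~~ scrN tau x -> m'.1 x = m.1 x) -> m'.2 = m.2 ->
  keep tau m m'.
Proof. by move=> kN kR; split=> // x _; rewrite kR. Qed.

Lemma sim_vn m s x : sim m s -> (vn x < nregs)%N -> m.1 (vn x) = nv s x.
Proof. by case=> [[_ h _] _]; apply: h. Qed.

Lemma ncomp_ok B e tau m s : nwf B tau e -> sim m s -> exists m' t,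
  [/\ rrun (ncomp tau e) m t m', (t <= ncost e (nv s))%N, keep tau m m', m'.2 = m.2 &
      m'.1 (tn tau) = nev e s].
Proof.
have ng := nregs_gt.
elim: e tau m s => [c|x|e1 IH1 e2 IH2|e1 IH1 e2 IH2|e1 IH1 e2 IH2 e3 IH3 e4 IH4|a e IH|x y e IH] tau m s /=.
- move=> /andP[tl _] sm; case: m sm => N R sm.
  exists (updN N (tn tau) c, R), 1%N; split=> //=; last by upd_simpl.
    by apply: (@run_iseq [:: _]).
  by apply: keep_scr => // z zs /=; rewrite updN_neq // /tn; move: zs; rewrite /scrN /tn; lia.
- move=> /andP[tl xl] sm; have xv := sim_vn sm xl; case: m sm xv => N R sm /= xv.
  exists (updN (updN N (tn tau) 0) (tn tau) (0 + N (vn x)), R)%N, 2%N; split=> //=.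
  + apply: (@run_iseq [:: _; _]) => /=; congr (Some (updN _ _ _, _)); by upd_simpl.
  + by apply: keep_scr => // z zs /=; rewrite !updN_neq // /tn; move: zs; rewrite /scrN /tn; lia.
  by upd_simpl.
- move=> /and3P[tl w1 w2] sm.
  have [m1 [t1 [r1 c1 k1 R1 v1]]] := IH1 _ _ _ w1 sm.
  have [m2 [t2 [r2 c2 k2 R2 v2]]] := IH2 _ _ _ w2 (sim_keep k1 sm).
  have v1' : m2.1 (tn tau) = nev e1 s by rewrite (proj1 k2) // /scrN /tn; lia.
  pose m3 : mem := (updN m2.1 (tn tau) (m2.1 (tn tau) + m2.1 (tn tau.+1)), m2.2)%N.
  exists m3, (t1 + (t2 + 1))%N; split; [|lia| | |].
  + by apply: run_seq r1 (run_seq r2 _); apply: (@run_iseq [:: _]).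
  + apply: keep_trans (keep_trans k1 (keep_mono (leqnSn _) k2)) _.
    by apply: keep_scr => // z zs /=; rewrite updN_neq // /tn; move: zs; rewrite /scrN /tn; lia.
  + by rewrite /= R2.
  by rewrite /= updN_eq v1' v2.
- move=> /and3P[tl w1 w2] sm.
  have [m1 [t1 [r1 c1 k1 R1 v1]]] := IH1 _ _ _ w1 sm.
  have [m2 [t2 [r2 c2 k2 R2 v2]]] := IH2 _ _ _ w2 (sim_keep k1 sm).
  have v1' : m2.1 (tn tau) = nev e1 s by rewrite (proj1 k2) // /scrN /tn; lia.
  pose m3 : mem := (updN m2.1 (tn tau) (m2.1 (tn tau) - m2.1 (tn tau.+1)), m2.2)%N.
  exists m3, (t1 + (t2 + 1))%N; split; [|lia| | |].
  + by apply: run_seq r1 (run_seq r2 _); apply: (@run_iseq [:: _]).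
  + apply: keep_trans (keep_trans k1 (keep_mono (leqnSn _) k2)) _.
    by apply: keep_scr => // z zs /=; rewrite updN_neq // /tn; move: zs; rewrite /scrN /tn; lia.
  + by rewrite /= R2.
  by rewrite /= updN_eq v1' v2.
- move=> /and5P[tl w1 w2 w3 w4] sm.
  have [m1 [t1 [r1 c1 k1 R1 v1]]] := IH1 _ _ _ w1 sm.
  have [m2 [t2 [r2 c2 k2 R2 v2]]] := IH2 _ _ _ w2 (sim_keep k1 sm).
  have v1' : m2.1 (tn tau) = nev e1 s by rewrite (proj1 k2) // /scrN /tn; lia.
  have k12 := keep_trans k1 (keep_mono (leqnSn _) k2).
  have [m3 [t3 [r3 c3 k3 R3 v3]]] := IH3 _ _ _ w3 (sim_keep k12 sm).
  have [m4 [t4 [r4 c4 k4 R4 v4]]] := IH4 _ _ _ w4 (sim_keep k12 sm).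
  case: ltnP => cmp.
    exists m3, (t1 + (t2 + t3.+1))%N; split; [|lia|exact: keep_trans k3|by rewrite R3 R2|by []].
    by apply: run_seq r1 (run_seq r2 _); apply: run_ifT r3; rewrite v1' v2.
  exists m4, (t1 + (t2 + t4.+2))%N; split; [|lia|exact: keep_trans k4|by rewrite R4 R2|by []].
  by apply: run_seq r1 (run_seq r2 _); apply: run_ifF r4; rewrite v1' v2 ltnNge cmp.
- move=> /and3P[tl al w] sm.
  have [m1 [t1 [r1 c1 k1 R1 v1]]] := IH _ _ _ w sm.
  have [m2 [i2 a2 k2 R2]] := iseq_addr tau a m1.
  have sm1 := sim_keep k1 sm.
  have [[b _ ha] _] := sm1.
  pose m3 : mem := (updN m2.1 (tn tau) (m2.1 (m2.1 1)), m2.2)%N.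
  have r2 : rrun (ris (addr_code tau a ++ [:: NLoad (tn tau) 1])) m1 10 m3.
    by apply: (@run_ris (addr_code tau a ++ [:: NLoad (tn tau) 1])); [rewrite (iseq_cat _ i2); reflexivity|reflexivity].
  clear i2; exists m3, (t1 + 10)%N; split; [exact: run_seq r1 r2|lia| | |].
  + apply: keep_trans k1 _; apply: keep_scr => // z zs /=.
    rewrite updN_neq ?k2 //; move: zs; rewrite /scrN /tn; lia.
  + by rewrite /= R2.
  rewrite /= updN_eq a2 k2 ?ha ?v1 //; [|rewrite /tn]; lia.
move=> /andP[tl /and5P[Bx By xl yl w]] sm.
set t := tn tau; set ax := vn x.
have tE : t = (3 + 2 * tau)%N by []. have axE : ax = (2 + 2 * x)%N by [].
have tax : t != ax by lia. have tn1 : t != 1%N by lia.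
have xv := sim_vn sm xl; have yv := sim_vn sm yl.
have yx : y != x by apply: contraNneq Bx => <-.
pose m0 : mem := (updN (updN (updN (updN m.1 t 0) (tn tau.+1) 0) (tn tau.+1) (m.1 ax)) ax 0, m.2)%N.
have r0 : rrun (ris [:: NConst t 0; NConst (tn tau.+1) 0; NAdd (tn tau.+1) (tn tau.+1) ax; NConst ax 0]) m 4 m0.
  apply: (@run_iseq [:: _; _; _; _]) => /=; rewrite /m0; congr (Some (updN (updN _ _ _) _ _, _)).
  rewrite !updN_eq updN_neq ?updN_neq //; rewrite /t /ax /tn /vn; lia.
(* [i] passes are done and [j] remain; the accumulator is described relative to its present
   value. *)
have loop j i mi : (i + j = nv s y)%N -> mi.1 ax = i -> sim mi (setn s x i) -> exists m' t',
  [/\ rrun (RWhN ax (vn y) (RSeq (ncomp tau.+2 e)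
              (ris [:: NAdd t t (tn tau.+2); NConst 1 1; NAdd ax ax 1]))) mi t' m',
      (t' <= j * (ncost e (nv s) + 5) + 2)%N,
      (forall z, ~~ scrN tau.+2 z -> z != t -> z != ax -> m'.1 z = mi.1 z),
      m'.2 = mi.2 &
      m'.1 t = (mi.1 t + \sum_(l < j) nev e (setn s x (i + l)))%N].
  elim: j i mi => [|j IHj] i mi ij vi smi.
    exists mi, 2%N; split=> //; last by rewrite big_ord0 addn0.
    apply: run_whNF; rewrite vi (sim_vn smi yl) /= updN_neq //; lia.
  have [m1 [t1 [r1 c1 k1 R1 v1]]] := IH _ _ _ w smi.
  have Bxz z : B z -> nv (setn s x i) z = nv s z.
    by move=> Bz; rewrite /= updN_neq //; apply: contraNneq Bx => <-.
  rewrite (ncost_eq w Bxz) in c1.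
  have kt : m1.1 t = mi.1 t by rewrite (proj1 k1) // /scrN /tn; lia.
  have kax : m1.1 ax = i by rewrite (proj1 k1) ?vi // /scrN /tn; lia.
  pose m2 : mem := (updN (updN (updN m1.1 t (m1.1 t + m1.1 (tn tau.+2))) 1 1) ax (i + 1), m1.2)%N.
  have r2 : rrun (ris [:: NAdd t t (tn tau.+2); NConst 1 1; NAdd ax ax 1]) m1 3 m2.
    apply: (@run_iseq [:: _; _; _]) => /=; rewrite /m2; congr (Some (updN _ _ _, _)).
    rewrite updN_eq updN_neq ?updN_neq ?kax //; lia.
  have k2 z : ~~ scrN tau.+2 z -> z != t -> z != ax -> m2.1 z = mi.1 z.
    move=> zs zt zx; rewrite /= updN_neq // updN_neq ?updN_neq ?(proj1 k1) //.
    by move: zs; rewrite /scrN; lia.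
  have sm2 : sim m2 (setn s x i.+1).
    have -> : setn s x i.+1 = setn (setn s x i) x i.+1.
      rewrite /setn /=; congr St; apply: boolp.funext => z; rewrite /updN; by case: eqP.
    apply: sim_setn smi => //=; [|by move=> z _; rewrite R1|by rewrite updN_eq addn1].
    move=> z zs zx; apply: k2 => //; first exact: (scrN_mono (leq0n _)).
    by move: zs; rewrite /scrN; move: tl; rewrite /tn; lia.
  have [||m' [t' [r' c' k' R' v']]] := IHj i.+1 m2 _ _ sm2; [lia|by rewrite /= updN_eq addn1|].
  exists m', (t1 + 3 + t').+2; split.
  + apply: (run_whNT _ (run_seq r1 r2) r'); rewrite vi (sim_vn smi yl) /= updN_neq //; lia.
  + lia.
  + by move=> z zs zt zx; rewrite k' ?k2.
  + by rewrite R' /= R1.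
  rewrite v' /= big_ord_recl addn0 -v1.
  have -> : updN (updN (updN m1.1 t (m1.1 t + m1.1 (tn tau.+2))) 1 1) ax (i + 1) t =
     (m1.1 t + m1.1 (tn tau.+2))%N.
    by rewrite (updN_neq _ _ tax) (updN_neq _ _ tn1) updN_eq.
  rewrite kt addnA; congr (_ + _)%N; apply: eq_bigr => l _.
  by rewrite /bump /= addnS.
have sm0 : sim m0 (setn s x 0).
  apply: sim_setn sm => //=; last by rewrite updN_eq.
  move=> z zs zx; rewrite updN_neq // ?updN_neq //; move: zs tl; rewrite /scrN /tn; lia.
have [m1 [t1 [r1 c1 k1 R1 v1]]] := loop (nv s y) 0%N m0 (add0n _) (updN_eq _ _ _) sm0.
have tt1 : t != tn tau.+1 by rewrite /t /tn; lia.
have v0t : m0.1 t = 0%N by rewrite /= (updN_neq _ _ tax) !(updN_neq _ _ tt1) updN_eq.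
have v0x : m1.1 (tn tau.+1) = m.1 ax.
  rewrite k1; [|rewrite /scrN /tn; lia|rewrite /tn; lia|rewrite /tn; lia].
  by rewrite /= updN_neq ?updN_eq //; rewrite /tn; lia.
pose m2 : mem := (updN (updN m1.1 ax 0) ax (m.1 ax), m1.2)%N.
have r2 : rrun (ris [:: NConst ax 0; NAdd ax ax (tn tau.+1)]) m1 2 m2.
  apply: (@run_iseq [:: _; _]) => /=; rewrite /m2; congr (Some (updN _ _ _, _)).
  by rewrite updN_eq updN_neq ?v0x //; rewrite /tn; lia.
exists m2, (4 + (t1 + 2))%N; split.
- exact: run_seq r0 (run_seq r1 r2).
- lia.
- apply: keep_scr => [z zs|]; last by rewrite /= R1.
  rewrite /=; have [->|zx] := eqVneq z ax; first by rewrite updN_eq.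
  rewrite !(updN_neq _ _ zx) k1 //; [|by apply: (scrN_mono _ zs); lia|].
    by rewrite /= (updN_neq _ _ zx) !updN_neq //; move: zs tl; rewrite /scrN /tn; lia.
  by move: zs tl; rewrite /scrN /tn; lia.
- by rewrite /= R1.
rewrite /= !updN_neq; [|lia|lia].
by rewrite v1 v0t add0n; apply: eq_bigr => l _; rewrite add0n.
Qed.

Definition cval tau (m : mem) : CC := Complex (m.2 (tre tau)) (m.2 (tim tau)).

Definition op_correct (tau : nat) (l : seq instr) (op : CC -> CC -> CC) := forall m,
  exists m', [/\ iseq l m = Some m', m'.1 = m.1,
    forall z, ~~ scrR tau z -> m'.2 z = m.2 z &
    cval tau m' = op (cval tau m) (cval tau.+1 m)].

Lemma mul_code_ok tau : (4 * tau + 20 < nregs)%N ->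
  op_correct tau (mul_code tau) (fun z w => z * w).
Proof.
move=> tl [N R].
pose R1 := updR R (tre tau.+2) (R (tre tau) * R (tre tau.+1)).
pose R2 := updR R1 (tim tau.+2) (R1 (tim tau) * R1 (tim tau.+1)).
pose R3 := updR R2 (tre tau.+2) (R2 (tre tau.+2) - R2 (tim tau.+2)).
pose R4 := updR R3 (tim tau.+2) (R3 (tre tau) * R3 (tim tau.+1)).
pose R5 := updR R4 (tim tau) (R4 (tim tau) * R4 (tre tau.+1)).
pose R6 := updR R5 (tim tau) (R5 (tim tau.+2) + R5 (tim tau)).
pose R7 := updR R6 (tre tau) 0.
pose R8 := updR R7 (tre tau) (R7 (tre tau) + R7 (tre tau.+2)).
exists (N, R8); split; [reflexivity|reflexivity| |].
  move=> z zs; rewrite [LHS]/R8 /R7 /R6 /R5 /R4 /R3 /R2 /R1.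
  do 8 (rewrite [LHS]updR_neq; [|by move: zs; rewrite /scrR /tre /tim; lia]).
  by [].
rewrite /cval.
have -> : (N, R8).2 (tre tau) = R (tre tau) * R (tre tau.+1) - R (tim tau) * R (tim tau.+1).
  by rewrite /= /R8 /R7 /R6 /R5 /R4 /R3; upd_simpl; rewrite add0r /R2 /R1; upd_simpl.
have -> : (N, R8).2 (tim tau) = R (tre tau) * R (tim tau.+1) + R (tim tau) * R (tre tau.+1).
  by rewrite /= /R8 /R7 /R6 /R5 /R4 /R3 /R2 /R1; upd_simpl.
by [].
Qed.

Lemma add_code_ok tau : (4 * tau + 20 < nregs)%N ->
  op_correct tau (add_code tau) (fun z w => z + w).
Proof.
move=> tl [N R].
pose R1 := updR R (tre tau) (R (tre tau) + R (tre tau.+1)).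
pose R2 := updR R1 (tim tau) (R1 (tim tau) + R1 (tim tau.+1)).
exists (N, R2); split; [reflexivity|reflexivity| |].
  move=> z zs; rewrite [LHS]/R2 /R1.
  do 2 (rewrite [LHS]updR_neq; [|by move: zs; rewrite /scrR /tre /tim; lia]).
  by [].
rewrite /cval.
have -> : (N, R2).2 (tre tau) = R (tre tau) + R (tre tau.+1) by rewrite /= /R2 /R1; upd_simpl.
have -> : (N, R2).2 (tim tau) = R (tim tau) + R (tim tau.+1) by rewrite /= /R2 /R1; upd_simpl.
by [].
Qed.

Lemma sub_code_ok tau : (4 * tau + 20 < nregs)%N ->
  op_correct tau (sub_code tau) (fun z w => z - w).
Proof.
move=> tl [N R].
pose R1 := updR R (tre tau) (R (tre tau) - R (tre tau.+1)).
pose R2 := updR R1 (tim tau) (R1 (tim tau) - R1 (tim tau.+1)).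
exists (N, R2); split; [reflexivity|reflexivity| |].
  move=> z zs; rewrite [LHS]/R2 /R1.
  do 2 (rewrite [LHS]updR_neq; [|by move: zs; rewrite /scrR /tre /tim; lia]).
  by [].
rewrite /cval.
have -> : (N, R2).2 (tre tau) = R (tre tau) - R (tre tau.+1) by rewrite /= /R2 /R1; upd_simpl.
have -> : (N, R2).2 (tim tau) = R (tim tau) - R (tim tau.+1) by rewrite /= /R2 /R1; upd_simpl.
by [].
Qed.

(** Named so that binary operations and big operators can be treated in lemmas of their own before
    the induction. *)
Definition xcomp_spec B (e : cexp) := forall tau m s, xwf B tau e -> sim m s -> exists m' t,
  [/\ rrun (xcomp tau e) m t m', (t <= xcost e (nv s))%N, keep tau m m' & cval tau m' = cev e s].

Lemma cval_keep tau m m' : keep tau.+1 m m' -> cval tau m' = cval tau m.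
Proof. by case=> _ kR; rewrite /cval !kR // /scrR /tre /tim; lia. Qed.

Lemma scrR_keep tau (m m' : mem) : m'.1 = m.1 -> (forall z, ~~ scrR tau z -> m'.2 z = m.2 z) ->
  keep tau m m'.
Proof. by move=> k1 kR; split=> // x _; rewrite k1. Qed.

Lemma xcomp_op B e1 e2 l op tau m s :
  (size l <= 8)%N -> ((4 * tau + 20 < nregs)%N -> op_correct tau l op) ->
  xcomp_spec B e1 -> xcomp_spec B e2 ->
  [&& (4 * tau + 20 < nregs)%N, xwf B tau e1 & xwf B tau.+1 e2] -> sim m s -> exists m' t,
  [/\ rrun (RSeq (xcomp tau e1) (RSeq (xcomp tau.+1 e2) (ris l))) m t m',
      (t <= xcost e1 (nv s) + xcost e2 (nv s) + 8)%N, keep tau m m' &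
      cval tau m' = op (cev e1 s) (cev e2 s)].
Proof.
move=> l8 opl IH1 IH2 /and3P[tl w1 w2] sm.
have [m1 [t1 [r1 c1 k1 v1]]] := IH1 _ _ _ w1 sm.
have [m2 [t2 [r2 c2 k2 v2]]] := IH2 _ _ _ w2 (sim_keep k1 sm).
have [m3 [i3 n3 k3 v3]] := opl tl m2.
have r3 := run_iseq i3; clear i3.
exists m3, (t1 + (t2 + size l))%N; split; [exact: run_seq r1 (run_seq r2 r3)|lia| |].
  exact: keep_trans (keep_trans k1 (keep_mono (leqnSn _) k2)) (scrR_keep n3 k3).
by rewrite v3 v2 (cval_keep k2) v1.
Qed.

Lemma big_bool_recr (b : bool) k (F : nat -> CC) :
  (if b then \prod_(i < k.+1) F i else \sum_(i < k.+1) F i) =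
  (if b then fun z w => z * w else fun z w => z + w)
  (if b then \prod_(i < k) F i else \sum_(i < k) F i) (F k) :> CC.
Proof. by case: b; rewrite big_ord_recr. Qed.

Lemma setnn s x i j : setn (setn s x i) x j = setn s x j.
Proof. by rewrite /setn /=; congr St; apply: boolp.funext => z; rewrite /updN; case: eqP. Qed.

Lemma xcomp_big B b x y e : xcomp_spec B e -> xcomp_spec B (cbig b x y e).
Proof.
move=> IH tau m s; rewrite /xwf -/xwf => /andP[tl /and5P[Bx By xl yl w]] sm.
have ng := nregs_gt.
set t := tn tau; set ax := vn x.
have tE : t = (3 + 2 * tau)%N by []. have axE : ax = (2 + 2 * x)%N by [].
have tax : t != ax by lia. have tn1 : t != 1%N by lia.
have xv := sim_vn sm xl; have yv := sim_vn sm yl.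
have yx : y != x by apply: contraNneq Bx => <-.
have yax : vn y != ax by rewrite /ax /vn; lia.
pose op := (if b then fun z w : CC => z * w else fun z w => z + w).
pose opl := if b then mul_code tau else add_code tau.
have opc : op_correct tau opl op.
  by rewrite /opl /op; case: (b); [apply: mul_code_ok|apply: add_code_ok].
have opl8 : (size opl <= 8)%N by rewrite /opl; case: (b).
pose id0 : RR := if b then 1 else 0.
pose m0 : mem := (updN (updN (updN m.1 t 0) t (0 + m.1 ax)) ax 0,
                  updR (updR m.2 (tre tau) id0) (tim tau) 0%R)%N.
have r0 : rrun (ris [:: RConst (tre tau) id0; RConst (tim tau) 0;
                    NConst t 0; NAdd t t ax; NConst ax 0]) m 5 m0.
  apply: (@run_iseq [:: _; _; _; _; _]) => /=; rewrite /m0; congr (Some (updN (updN _ _ _) _ _, _)).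
  by rewrite updN_eq (updN_neq _ _ (_ : ax != t)) // eq_sym.
pose F l := cev e (setn s x l).
pose part k : CC := if b then \prod_(i < k) F i else \sum_(i < k) F i.
have loop j i mi : (i + j = nv s y)%N -> mi.1 ax = i -> sim mi (setn s x i) ->
    cval tau mi = part i -> exists m' t',
  [/\ rrun (RWhN ax (vn y) (RSeq (xcomp tau.+1 e) (ris (opl ++ [:: NConst 1 1; NAdd ax ax 1])))) mi t' m',
      (t' <= j * (xcost e (nv s) + 12) + 2)%N,
      (forall z, ~~ scrN tau.+1 z -> z != ax -> m'.1 z = mi.1 z),
      (forall z, ~~ scrR tau z -> m'.2 z = mi.2 z) &
      cval tau m' = part (nv s y)].
  elim: j i mi => [|j IHj] i mi ij vi smi pi.
    exists mi, 2%N; split=> //; last by rewrite pi -ij addn0.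
    apply: run_whNF; rewrite vi (sim_vn smi yl) /= updN_neq //; lia.
  have [m1 [t1 [r1 c1 k1 v1]]] := IH _ _ _ w smi.
  have Bxz z : B z -> nv (setn s x i) z = nv s z.
    by move=> Bz; rewrite /= updN_neq //; apply: contraNneq Bx => <-.
  rewrite (xcost_eq w Bxz) in c1.
  have kax : m1.1 ax = i by rewrite (proj1 k1) ?vi // /scrN /tn; lia.
  have [m2 [i2 n2 k2 v2]] := opc m1.
  pose m3 : mem := (updN (updN m2.1 1 1) ax (i + 1), m2.2)%N.
  have r3 : rrun (ris (opl ++ [:: NConst 1 1; NAdd ax ax 1])) m1 (size opl + 2) m3.
    apply: run_ris; last by rewrite size_cat.
    rewrite (iseq_cat _ i2) /=; clear i2; rewrite /m3; congr (Some (updN _ _ _, _)).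
    by rewrite updN_eq updN_neq ?n2 ?kax //; lia.
  clear i2.
  have k3 z : ~~ scrN tau.+1 z -> z != ax -> m3.1 z = mi.1 z.
    move=> zs zx; rewrite /= updN_neq // updN_neq ?n2 ?(proj1 k1) //.
    by move: zs; rewrite /scrN; lia.
  have kR3 z : ~~ scrR tau z -> m3.2 z = mi.2 z.
    by move=> zs; rewrite /= k2 // (proj2 k1) //; apply: (scrR_mono _ zs); lia.
  have sm3 : sim m3 (setn s x i.+1).
    rewrite -(setnn s x i i.+1); apply: sim_setn smi => //=.
    - by move=> z zs zx; apply: k3 => //; apply: (scrN_mono _ zs).
    - by move=> z zs; apply: kR3; apply: (scrR_mono _ zs).
    by rewrite updN_eq addn1.
  have p3 : cval tau m3 = part i.+1.
    have -> : cval tau m3 = cval tau m2 by [].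
    by rewrite v2 v1 (cval_keep k1) pi /part big_bool_recr.
  have [||m' [t' [r' c' k' R' v']]] := IHj i.+1 m3 _ _ sm3 p3; [lia|by rewrite /= updN_eq addn1|].
  exists m', (t1 + (size opl + 2) + t').+2; split=> //.
  - apply: (run_whNT _ (run_seq r1 r3) r'); rewrite vi (sim_vn smi yl) /= updN_neq //; lia.
  - lia.
  - by move=> z zs zx; rewrite k' ?k3.
  by move=> z zs; rewrite R' ?kR3.
have sm0 : sim m0 (setn s x 0).
  apply: sim_setn sm => //=; last by rewrite updN_eq.
    move=> z zs zx; rewrite updN_neq // ?updN_neq //; move: zs tl; rewrite /scrN /tn; lia.
  move=> z zs; rewrite !updR_neq //; move: zs tl; rewrite /scrR /tre /tim; lia.
have p0 : cval tau m0 = part 0%N.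
  rewrite /cval /= updR_eq updR_neq ?updR_eq; last by rewrite /tre /tim; lia.
  by rewrite /part /id0; case: (b); rewrite big_ord0.
have [m1 [t1 [r1 c1 k1 R1 v1]]] := loop (nv s y) 0%N m0 (add0n _) (updN_eq _ _ _) sm0 p0.
have v0x : m1.1 t = m.1 ax.
  rewrite k1 //; [|rewrite /scrN /tn; lia].
  by rewrite /= (updN_neq _ _ tax) updN_eq.
pose m2 : mem := (updN (updN m1.1 ax 0) ax (m.1 ax), m1.2)%N.
have r2 : rrun (ris [:: NConst ax 0; NAdd ax ax t]) m1 2 m2.
  apply: (@run_iseq [:: _; _]) => /=; rewrite /m2; congr (Some (updN _ _ _, _)).
  by rewrite updN_eq updN_neq ?v0x.
exists m2, (5 + (t1 + 2))%N; split.
- exact: run_seq r0 (run_seq r1 r2).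
- rewrite /=; lia.
- split=> z zs; rewrite /=; last first.
    by rewrite R1 //= !updR_neq //; move: zs tl; rewrite /scrR /tre /tim; lia.
  have [->|zx] := eqVneq z ax; first by rewrite updN_eq.
  rewrite !(updN_neq _ _ zx) k1 //; [|by apply: (scrN_mono _ zs); lia].
  by rewrite /= (updN_neq _ _ zx) !updN_neq //; move: zs tl; rewrite /scrN /tn; lia.
by rewrite -[LHS]/(cval tau m1) v1.
Qed.

Lemma xcomp_ok B e : xcomp_spec B e.
Proof.
have ng := nregs_gt.
elim: e => [z|x|e|e1 IH1 e2 IH2|e1 IH1 e2 IH2|e1 IH1 e2 IH2|e IH|e1 e2 e3 IH3 e4 IH4|a e|b x y e IH] tau m s;
  rewrite /xwf -/xwf.
- move=> /andP[tl _] sm; case: m sm => N R sm.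
  exists (N, updR (updR R (tre tau) (complex.Re z)) (tim tau) (complex.Im z)), 2%N; split=> //.
  + exact: (@run_iseq [:: _; _]).
  + apply: scrR_keep => // x xs /=; rewrite !updR_neq //; move: xs; rewrite /scrR /tre /tim; lia.
  rewrite /cval /=; upd_simpl; by case: (z).
- move=> /andP[tl xl] sm; have [h1 h2] := proj1 (proj2 sm) x xl; case: m sm h1 h2 => N R sm /= h1 h2.
  exists (N, updR (updR (updR (updR R (tre tau) 0) (tre tau) (complex.Re (cv s x))) (tim tau) 0) (tim tau) (complex.Im (cv s x))), 4%N.
  split=> //.
  + apply: (@run_iseq [:: _; _; _; _]) => /=; rewrite -h1 -h2; congr (Some (_, updR (updR (updR _ _ _) _ _) _ _)); upd_simpl; exact: add0r.
  + apply: scrR_keep => // z xs /=; rewrite !updR_neq //; move: xs; rewrite /scrR /tre /tim; lia.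
  rewrite /cval /=; upd_simpl; by case: (cv s x).
- move=> /andP[tl w] sm.
  have [m1 [t1 [r1 c1 k1 R1 v1]]] := ncomp_ok w sm.
  exists (m1.1, updR (updR m1.2 (tre tau) (m1.1 (tn tau))%:R) (tim tau) 0), (t1 + 2)%N; split=> //.
  + by apply: run_seq r1 _; apply: (@run_iseq [:: _; _]).
  + rewrite /=; lia.
  + apply: keep_trans k1 _; apply: scrR_keep => // z xs /=.
    rewrite !updR_neq //; move: xs; rewrite /scrR /tre /tim; lia.
  rewrite /cval /=; upd_simpl; rewrite v1.
  by rewrite -(rmorph_nat (real_complex RR)).
- move=> w sm; apply: (xcomp_op (op := fun z w => z + w) _ (@add_code_ok tau) IH1 IH2 w sm) => //.
- move=> w sm; apply: (xcomp_op (op := fun z w => z - w) _ (@sub_code_ok tau) IH1 IH2 w sm) => //.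
- move=> w sm; apply: (xcomp_op (op := fun z w => z * w) _ (@mul_code_ok tau) IH1 IH2 w sm) => //.
- move=> /andP[tl w] sm.
  have [m1 [t1 [r1 c1 k1 v1]]] := IH _ _ _ w sm.
  exists (m1.1, updR (updR m1.2 (tre tau.+1) 0) (tim tau) (0 - m1.2 (tim tau))), (t1 + 2)%N; split.
  + apply: run_seq r1 _; apply: (@run_iseq [:: _; _]) => /=; congr (Some (_, updR _ _ _)).
    by upd_simpl.
  + rewrite /=; lia.
  + apply: keep_trans k1 _; apply: scrR_keep => // z xs /=.
    rewrite !updR_neq //; move: xs; rewrite /scrR /tre /tim; lia.
  rewrite /cval /=; upd_simpl; rewrite -v1 /cval /=; by rewrite sub0r.
- move=> /and5P[tl w1 w2 w3 w4] sm /=.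
  have [m1 [t1 [r1 c1 k1 R1 v1]]] := ncomp_ok w1 sm.
  have [m2 [t2 [r2 c2 k2 R2 v2]]] := ncomp_ok w2 (sim_keep k1 sm).
  have v1' : m2.1 (tn tau) = nev e1 s by rewrite (proj1 k2) // /scrN /tn; lia.
  have k12 := keep_trans k1 (keep_mono (leqnSn _) k2).
  have [m3 [t3 [r3 c3 k3 v3]]] := IH3 _ _ _ w3 (sim_keep k12 sm).
  have [m4 [t4 [r4 c4 k4 v4]]] := IH4 _ _ _ w4 (sim_keep k12 sm).
  case: ltnP => cmp.
    exists m3, (t1 + (t2 + t3.+1))%N; split; [|lia|exact: keep_trans k3|by []].
    by apply: run_seq r1 (run_seq r2 _); apply: run_ifT r3; rewrite v1' v2.
  exists m4, (t1 + (t2 + t4.+2))%N; split; [|lia|exact: keep_trans k4|by []].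
  by apply: run_seq r1 (run_seq r2 _); apply: run_ifF r4; rewrite v1' v2 ltnNge cmp.
- move=> /and3P[tl al w] sm.
  have [m1 [t1 [r1 c1 k1 R1 v1]]] := ncomp_ok w sm.
  have [m2 [i2 a2 k2 R2]] := iseq_addr tau (2 * a) m1.
  have sm1 := sim_keep k1 sm.
  have [[b _ _] [_ hca]] := sm1.
  have [hre him] := hca a (nev e s) al.
  pose l := [:: RLoad (tre tau) 1; NConst (tn tau) 1; NAdd 1 1 (tn tau); RLoad (tim tau) 1].
  pose m3 : mem := (updN (updN m2.1 (tn tau) 1) 1 (m2.1 1 + 1),
     updR (updR m2.2 (tre tau) (m2.2 (m2.1 1))) (tim tau) (m2.2 (m2.1 1).+1))%N.
  have b2 : (nregs <= m2.1 1)%N by rewrite a2; lia.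
  have r2 : rrun (ris (addr_code tau (2 * a) ++ l)) m1 13 m3.
    apply: (@run_ris (addr_code tau (2 * a) ++ l)); last by [].
    rewrite (iseq_cat _ i2); clear i2; rewrite /l /= /m3 addn1.
    have tt : 1%N != tn tau by rewrite /tn; lia.
    rewrite (updN_neq _ _ tt) !updN_eq addn1.
    by congr (Some (_, updR _ _ _)); rewrite updR_neq //; move: b2 tl; rewrite /tre; lia.
  clear i2; exists m3, (t1 + 13)%N; split; [exact: run_seq r1 r2|rewrite /=; lia| |].
  + apply: keep_trans k1 _; split=> z zs; rewrite /=.
      by rewrite !updN_neq ?k2 //; move: zs tl; rewrite /scrN /tn; lia.
    by rewrite !updR_neq ?R2 //; move: zs tl; rewrite /scrR /tre /tim; lia.
  rewrite /cval /m3 /=; upd_simpl; rewrite R2 a2 v1 hre him.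
  by case: (ca s a _).
- by move=> w sm; apply: (xcomp_big IH).
Qed.

Lemma for_st_frame c x k s z : (forall s, z \notin nmods c -> nv (ev c s) z = nv s z) ->
  z \notin nmods c -> z != x -> nv (for_st (ev c) x k s) z = nv s z.
Proof.
move=> IH zc zx; elim: k => [|k IHk] /=; rewrite updN_neq //.
by rewrite IH.
Qed.

Lemma ev_nframe c s z : z \notin nmods c -> nv (ev c s) z = nv s z.
Proof.
elim: c s => //= [x e|c1 IH1 c2 IH2|e1 e2 c1 IH1 c2 IH2|x y c IH] s.
- by rewrite inE => zx; rewrite updN_neq.
- by rewrite mem_cat => /norP[z1 z2]; rewrite IH2 ?IH1.
- by rewrite mem_cat => /norP[z1 z2]; case: ifP => _; [apply: IH1|apply: IH2].
by rewrite inE => /norP[zx zc]; apply: for_st_frame.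
Qed.

Lemma for_st_var c x k s : nv (for_st (ev c) x k s) x = k.
Proof. by case: k => [|k] /=; rewrite updN_eq. Qed.

Lemma cwf_frame B c z : cwf B c -> B z -> z \notin nmods c.
Proof.
elim: c => //= [x e|c1 IH1 c2 IH2|e1 e2 c1 IH1 c2 IH2|x y c IH] w Bz.
- by rewrite inE; apply: contraTneq w => <-; rewrite Bz.
- by move: w => /andP[w1 w2]; rewrite mem_cat negb_or IH1 ?IH2.
- by move: w => /and4P[_ _ w1 w2]; rewrite mem_cat negb_or IH1 ?IH2.
move: w => /and5P[Bx _ _ _ /andP[_ w]]; rewrite inE negb_or IH // andbT.
by apply: contraNneq Bx => <-.
Qed.

(** Different array entries have different addresses because [a] and [i] are remainder and quotient
    modulo [stride]. *)
Lemma sim_setna tau m m' s a i v : (a < stride)%N ->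
  (forall z, ~~ scrN tau z -> z != (m.1 0 + (stride * i + a))%N -> m'.1 z = m.1 z) ->
  m'.1 (m.1 0 + (stride * i + a))%N = v -> m'.2 = m.2 ->
  sim m s -> sim m' (setna s a i v).
Proof.
have ng := nregs_gt.
move=> al kN av kR [[b hv ha] [hc hca]].
have ne (z : nat) : (z < nregs)%N -> z != (m.1 0 + (stride * i + a))%N.
  by move=> zn; rewrite neq_ltn (leq_trans zn) // (leq_trans b) // leq_addr.
have k0 : m'.1 0%N = m.1 0%N.
  by apply: kN; [rewrite /scrN /tn; lia|apply: ne; lia].
split; last by rewrite kR k0; split.
split; rewrite ?k0 //=.
- by move=> z zs; rewrite kN ?hv // ?ne // /scrN /vn /tn; lia.
move=> a' i' al'; case: andP => [[/eqP-> /eqP->]//|ne'].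
rewrite kN ?ha // ?arr_scrN // eqn_add2l; apply/eqP => E; apply: ne'.
have sl : (0 < stride)%N by apply: leq_ltn_trans al.
have := congr1 (modn^~ stride) E; have := congr1 (divn^~ stride) E => /=.
rewrite ![(stride * _)%N]mulnC !divnMDl // !divn_small // !addn0 => ->.
by rewrite !modnMDl !modn_small // => ->.
Qed.

Lemma sim_setca m m' s a i v : (2 * a + 1 < stride)%N ->
  (forall z, ~~ scrN 0 z -> m'.1 z = m.1 z) ->
  (forall z, ~~ scrR 0 z -> z != (m.1 0 + (stride * i + 2 * a))%N ->
     z != (m.1 0 + (stride * i + 2 * a)).+1 -> m'.2 z = m.2 z) ->
  m'.2 (m.1 0 + (stride * i + 2 * a))%N = complex.Re v ->
  m'.2 (m.1 0 + (stride * i + 2 * a)).+1 = complex.Im v ->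
  sim m s -> sim m' (setca s a i v).
Proof.
have ng := nregs_gt.
move=> al kN kR vre vim sm; have k : sim (m'.1, m.2) s.
  by apply: (@sim_keep 0 m) => //; split=> // z zs; apply: kN.
have [[b _ _] _] := sm; move: k => [kN' [hc hca]]; split=> //=.
have k0 : m'.1 0%N = m.1 0%N by apply: kN; rewrite /scrN /tn; lia.
rewrite k0 in hca *.
have ne (z : nat) : (z < nregs)%N -> z != (m.1 0 + (stride * i + 2 * a))%N /\ z != (m.1 0 + (stride * i + 2 * a)).+1.
  by move=> zn; split; move: b zn; move: (m.1 0%N) (stride * i + 2 * a)%N => {}b q; clear; lia.
split=> /=.
- move=> z zs; have [<- <-] := hc z zs.
  have [n1 n2] := ne (4 * z)%N ltac:(lia).
  have [n3 n4] := ne (4 * z).+1 ltac:(lia).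
  by split; apply: kR => //; rewrite /scrR /tre; lia.
move=> a' i' al'.
have sl : (0 < stride)%N by apply: leq_ltn_trans al.
have [h1 h2] := hca a' i' al'; case: andP => [[/eqP-> /eqP->]//|ne'].
have uniqE r r' : (r < stride)%N -> (r' < stride)%N ->
    (m.1 0 + (stride * i' + r'))%N == (m.1 0 + (stride * i + r))%N -> i' = i /\ r' = r.
  move=> rl rl'; rewrite eqn_add2l => /eqP E.
  have := congr1 (modn^~ stride) E; have := congr1 (divn^~ stride) E => /=.
  by rewrite ![(stride * _)%N]mulnC !divnMDl // !divn_small // !addn0 !modnMDl !modn_small.
have absurd : i' = i -> a' = a -> False by move=> ei ea; apply: ne'; rewrite ei ea !eqxx.
rewrite -h1 -h2 /= k0; split; apply: kR; rewrite -?addnS ?arr_scrR //; apply/negP => /uniqE[||ei er];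
  try lia; apply: absurd => //; lia.
Qed.

Lemma comp_ok B c m s : cwf B c -> sim m s -> exists m' t,
  [/\ rrun (comp c) m t m', (t <= cost c (nv s))%N & sim m' (ev c s)].
Proof.
have ng := nregs_gt.
elim: c m s => [|x e|a e1 e2|x e|a e1 e2|c1 IH1 c2 IH2|e1 e2 c1 IH1 c2 IH2|x y c IH] m s; rewrite /cwf -/cwf.
- by move=> _ sm; exists m, 0%N; split=> //; apply: run_skip.
- move=> /and3P[_ xl w] sm.
  have [m1 [t1 [r1 c1 k1 R1 v1]]] := ncomp_ok w sm.
  pose m2 : mem := (updN (updN m1.1 (vn x) 0) (vn x) (0 + m1.1 (tn 0)), m1.2)%N.
  have r2 : rrun (ris [:: NConst (vn x) 0; NAdd (vn x) (vn x) (tn 0)]) m1 2 m2.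
    apply: (@run_iseq [:: _; _]) => /=; rewrite /m2; congr (Some (updN _ _ _, _)).
    by rewrite updN_eq updN_neq // /tn /vn; lia.
  exists m2, (t1 + 2)%N; split; [exact: run_seq r1 r2|rewrite /=; lia|].
  apply: sim_setn (sim_keep k1 sm) => //=; last by rewrite updN_eq v1.
  by move=> z zs zx; rewrite !updN_neq.
- move=> /and3P[al w1 w2] sm.
  have [m1 [t1 [r1 c1 k1 R1 v1]]] := ncomp_ok w1 sm.
  have [m2 [t2 [r2 c2 k2 R2 v2]]] := ncomp_ok w2 (sim_keep k1 sm).
  have v1' : m2.1 (tn 0) = nev e1 s by rewrite (proj1 k2) // /scrN /tn; lia.
  have sm2 := sim_keep k2 (sim_keep k1 sm).
  have [m3 [i3 a3 k3 R3]] := iseq_addr 0 a m2.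
  pose m4 : mem := (updN m3.1 (m3.1 1) (m3.1 (tn 1)), m3.2)%N.
  have r3 : rrun (ris (addr_code 0 a ++ [:: NStore 1 (tn 1)])) m2 10 m4.
    by apply: (@run_ris (addr_code 0 a ++ [:: NStore 1 (tn 1)])); [rewrite (iseq_cat _ i3); reflexivity|].
  clear i3.
  have sm3 : sim m3 s.
    apply: (@sim_keep 0 m2) => //; apply: keep_scr => // z zs; rewrite k3 //; move: zs; rewrite /scrN /tn; lia.
  exists m4, (t1 + (t2 + 10))%N; split; [exact: run_seq r1 (run_seq r2 r3)|rewrite /=; lia|].
  have k30 : m3.1 0%N = m2.1 0%N by rewrite k3 // /tn; lia.
  have adr : m3.1 1%N = (m3.1 0 + (stride * nev e1 s + a))%N by rewrite a3 v1' k30.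
  apply: (@sim_setna 0 m3) => //=; rewrite -adr.
    by move=> z _ zx; rewrite updN_neq.
  by rewrite updN_eq k3 ?v2 // /tn; lia.
- move=> /andP[xl w] sm.
  have [m1 [t1 [r1 c1 k1 v1]]] := xcomp_ok w sm.
  pose R4 := updR (updR (updR (updR m1.2 (4 * x) 0) (4 * x) (0 + m1.2 (tre 0))) (4 * x).+1 0)
     (4 * x).+1 (0 + m1.2 (tim 0)).
  have r2 : rrun (ris [:: RConst (4 * x) 0; RAdd (4 * x) (4 * x) (tre 0);
               RConst (4 * x).+1 0; RAdd (4 * x).+1 (4 * x).+1 (tim 0)]) m1 4 (m1.1, R4).
    apply: (@run_iseq [:: _; _; _; _]) => /=; rewrite /R4.
    by congr (Some (_, updR (updR (updR _ _ _) _ _) _ _)); upd_simpl.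
  exists (m1.1, R4), (t1 + 4)%N; split; [exact: run_seq r1 r2|rewrite /=; lia|].
  have [sN [hc hca]] := sim_keep k1 sm; split=> //; split=> /=.
    move=> z zl; rewrite /R4; have [->|zx] := eqVneq z x.
      by rewrite -v1 /cval; upd_simpl; rewrite !add0r.
    have [<- <-] := hc z zl; by upd_simpl.
  move=> a i ai; have [<- <-] := hca a i ai; have [[b _ _] _] := sim_keep k1 sm.
  have nz z : (z < nregs)%N -> (m1.1 0 + (stride * i + 2 * a) != z)%N /\ ((m1.1 0 + (stride * i + 2 * a)).+1 != z)%N.
    by move: b; move: (m1.1 0%N) (stride * i + 2 * a)%N => M q; clear; lia.
  have [n1 n2] := nz (4 * x)%N ltac:(lia).
  have [n3 n4] := nz (4 * x).+1 ltac:(lia).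
  by rewrite /R4; split; rewrite !updR_neq.
- move=> /and3P[al w1 w2] sm.
  have [m1 [t1 [r1 c1 k1 R1 v1]]] := ncomp_ok w1 sm.
  have [m2 [t2 [r2 c2 k2 v2]]] := xcomp_ok w2 (sim_keep k1 sm).
  have v1' : m2.1 (tn 0) = nev e1 s by rewrite (proj1 k2) // /scrN /tn; lia.
  have sm2 := sim_keep k2 (sim_keep k1 sm).
  have [[b2 _ _] _] := sm2.
  have [m3 [i3 a3 k3 R3]] := iseq_addr 0 (2 * a) m2.
  have bb : (nregs <= m3.1 1)%N by rewrite a3; lia.
  pose m4 : mem := (updN (updN m3.1 (tn 0) 1) 1 (m3.1 1 + 1),
     updR (updR m3.2 (m3.1 1) (m3.2 (tre 1))) (m3.1 1).+1 (m3.2 (tim 1)))%N.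
  pose l := [:: RStore 1 (tre 1); NConst (tn 0) 1; NAdd 1 1 (tn 0); RStore 1 (tim 1)].
  have r3 : rrun (ris (addr_code 0 (2 * a) ++ l)) m2 13 m4.
    apply: (@run_ris (addr_code 0 (2 * a) ++ l)); last by [].
    rewrite (iseq_cat _ i3); clear i3; rewrite /l /= /m4 addn1.
    rewrite updN_eq.
    by congr (Some (_, updR _ _ _)); rewrite updR_neq //; move: bb; rewrite /tim; lia.
  clear i3; exists m4, (t1 + (t2 + 13))%N; split; [exact: run_seq r1 (run_seq r2 r3)|rewrite /=; lia|].
  have k30 : m3.1 0%N = m2.1 0%N by rewrite k3 // /tn; lia.
  rewrite v1' in a3.
  apply: (@sim_setca m2) => //=.
  + move=> z zs; rewrite !updN_neq ?k3 //; move: zs; rewrite /scrN /tn; lia.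
  + by move=> z zs z1 z2; rewrite !updR_neq ?a3 ?R3.
  + rewrite -a3 updR_neq ?updR_eq ?R3; last by rewrite neq_ltn ltnSn.
    by rewrite -v2.
  by rewrite -a3 updR_eq R3 -v2.
- move=> /andP[w1 w2] sm.
  have [m1 [t1 [r1 c1' s1]]] := IH1 _ _ w1 sm.
  have [m2 [t2 [r2 c2' s2]]] := IH2 _ _ w2 s1.
  exists m2, (t1 + t2)%N; split=> //; first exact: run_seq r1 r2.
  rewrite /= leq_add // (leq_trans c2') // (cost_eq (g := nv s) w2) // => z Bz.
  by rewrite ev_nframe // (cwf_frame w1).
- move=> /and4P[w1 w2 w3 w4] sm /=.
  have [m1 [t1 [r1 c1' k1 R1 v1]]] := ncomp_ok w1 sm.
  have [m2 [t2 [r2 c2' k2 R2 v2]]] := ncomp_ok w2 (sim_keep k1 sm).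
  have v1' : m2.1 (tn 0) = nev e1 s by rewrite (proj1 k2) // /scrN /tn; lia.
  have sm2 := sim_keep k2 (sim_keep k1 sm).
  have [m3 [t3 [r3 c3 s3]]] := IH1 _ _ w3 sm2.
  have [m4 [t4 [r4 c4 s4]]] := IH2 _ _ w4 sm2.
  case: ltnP => cmp.
    exists m3, (t1 + (t2 + t3.+1))%N; split; [|lia|by []].
    by apply: run_seq r1 (run_seq r2 _); apply: run_ifT r3; rewrite v1' v2.
  exists m4, (t1 + (t2 + t4.+2))%N; split; [|lia|by []].
  by apply: run_seq r1 (run_seq r2 _); apply: run_ifF r4; rewrite v1' v2 ltnNge cmp.
move=> /and5P[Bx By xc xl /andP[yl w]] sm.
set ax := vn x; have axE : ax = (2 + 2 * x)%N by [].
have yx : y != x by apply: contraNneq Bx => <-.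
have yc : y \notin nmods c by apply: (cwf_frame w By).
pose m0 : mem := (updN m.1 ax 0, m.2)%N.
have r0 : rrun (ris [:: NConst ax 0]) m 1 m0 by apply: (@run_iseq [:: _]).
have loop j i mi : (i + j = nv s y)%N -> sim mi (for_st (ev c) x i s) -> exists m' t',
   [/\ rrun (RWhN ax (vn y) (RSeq (comp c) (ris [:: NConst 1 1; NAdd ax ax 1]))) mi t' m',
       (t' <= j * (cost c (nv s) + 4) + 2)%N & sim m' (for_st (ev c) x (nv s y) s)].
  have vy k : nv (for_st (ev c) x k s) y = nv s y.
    by apply: for_st_frame => // s' _; apply: ev_nframe.
  elim: j i mi => [|j IHj] i mi ij smi.
    exists mi, 2%N; split=> //; last by rewrite -ij addn0.
    by apply: run_whNF; rewrite (sim_vn smi xl) (sim_vn smi yl) for_st_var vy -ij addn0 ltnn.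
  have [m1 [t1 [r1 c1 s1]]] := IH _ _ w smi.
  have cE : cost c (nv (for_st (ev c) x i s)) = cost c (nv s).
    apply: (cost_eq w) => z Bz; apply: for_st_frame.
    - by move=> s' _; apply: ev_nframe; apply: (cwf_frame w Bz).
    - exact: (cwf_frame w Bz).
    by apply: contraNneq Bx => <-.
  rewrite cE in c1.
  have ax1 : m1.1 ax = i by rewrite (sim_vn s1 xl) ev_nframe // for_st_var.
  pose m2 : mem := (updN (updN m1.1 1 1) ax (i + 1), m1.2)%N.
  have r2 : rrun (ris [:: NConst 1 1; NAdd ax ax 1]) m1 2 m2.
    apply: (@run_iseq [:: _; _]) => /=; rewrite /m2; congr (Some (updN _ _ _, _)).
    by rewrite updN_eq updN_neq ?ax1.
  have s2 : sim m2 (for_st (ev c) x i.+1 s).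
    apply: sim_setn s1 => //=; last by rewrite updN_eq addn1.
    by move=> z zs zx; rewrite !updN_neq //; move: zs; rewrite /scrN; lia.
  have [|m' [t' [r' c' s']]] := IHj i.+1 m2 _ s2; first lia.
  exists m', (t1 + 2 + t').+2; split=> //; last lia.
  apply: (run_whNT _ (run_seq r1 r2) r').
  rewrite (sim_vn smi xl) (sim_vn smi yl) for_st_var vy; lia.
have s0 : sim m0 (for_st (ev c) x 0 s).
  apply: sim_setn sm => //=; last by rewrite updN_eq.
  by move=> z _ zx; rewrite updN_neq.
have [m1 [t1 [r1 c1 s1]]] := loop (nv s y) 0%N m0 (add0n _) s0.
exists m1, (1 + t1)%N; split; [exact: run_seq r0 r1|rewrite /=; lia|exact: s1].
Qed.

(** For the loops without a bound variable: the number [J] of passes is supplied by the caller, and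
    the test compares real parts. *)
Lemma while_ok B c m s (x y J : nat) : cwf B c ->
  (4 * x + 1 < nregs)%N -> (4 * y + 1 < nregs)%N -> sim m s ->
  (forall j, (j < J)%N ->
     complex.Re (cv (iter j (ev c) s) x) < complex.Re (cv (iter j (ev c) s) y)) ->
  (complex.Re (cv (iter J (ev c) s) x) < complex.Re (cv (iter J (ev c) s) y)) = false ->
  exists m' t, [/\ rrun (RWhR (4 * x) (4 * y) (comp c)) m t m',
    (t <= J * (cost c (nv s) + 2) + 2)%N & sim m' (iter J (ev c) s)].
Proof.
move=> w xl yl; elim: J m s => [|J IH] m s sm lt ge.
  exists m, 2%N; split=> //; apply: run_whRF.
  have [_ [hc _]] := sm.
  by rewrite (proj1 (hc x xl)) (proj1 (hc y yl)).
have [m1 [t1 [r1 c1 s1]]] := comp_ok w sm.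
have [_ [hc _]] := sm.
have lt0 : m.2 (4 * x)%N < m.2 (4 * y)%N.
  by rewrite (proj1 (hc x xl)) (proj1 (hc y yl)); apply: (lt 0%N).
have [j jJ|/=|m' [t' [r' c' s']]] := IH m1 (ev c s) s1.
- by rewrite -!iterSr; apply: lt.
- by rewrite -!iterSr.
exists m', (t1 + t').+2; split; last by rewrite iterSr.
  exact: run_whRT lt0 r1 r'.
have cE : cost c (nv (ev c s)) = cost c (nv s).
  by apply: (cost_eq w) => z Bz; apply: ev_nframe; apply: (cwf_frame w Bz).
rewrite cE in c'; lia.
Qed.

(** * Relocating the input *)

(** Straight-line code with constant offsets, as cell 1 is the only natural register free at this
    point. *)
Definition save_code (l : seq nat) : seq instr :=
  flatten [seq [:: NConst 1 (stride * i); NAdd 1 1 0; NStore 1 i; RStore 1 i] | i <- l].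

Lemma size_save_code l : size (save_code l) = (4 * size l)%N.
Proof. by elim: l => //= i l IH; rewrite /save_code /= -/(save_code l) IH mulnS. Qed.

Definition copied (b : nat) (l : seq nat) (m m' : mem) :=
  [/\ forall i, i \in l -> m'.1 (b + stride * i)%N = m.1 i /\ m'.2 (b + stride * i)%N = m.2 i,
      forall y, y != 1%N -> (forall i, i \in l -> y != (b + stride * i)%N) -> m'.1 y = m.1 y &
      forall y, (forall i, i \in l -> y != (b + stride * i)%N) -> m'.2 y = m.2 y].

Lemma stride_inj b i j : (b + stride * i == b + stride * j)%N = (i == j).
Proof. by rewrite eqn_add2l strideE eqn_pmul2l. Qed.

Lemma save_ok l (m : mem) : (nregs <= m.1 0%N)%N -> all (fun i => 2 <= i < nregs)%N l ->
  uniq l -> exists2 m', iseq (save_code l) m = Some m' & copied (m.1 0%N) l m m'.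
Proof.
have ng := nregs_gt.
elim: l m => [|i l IH] m b; first by move=> _ _; exists m.
move=> /= /andP[ib lb] /andP[il ul].
set A := (m.1 0%N + stride * i)%N.
have Ab : (nregs <= A)%N by rewrite (leq_trans b) // leq_addr.
pose Na := updN m.1 1%N (stride * i).
pose Nb := updN Na 1%N (Na 1%N + Na 0%N)%N.
pose Nc := updN Nb (Nb 1%N) (Nb i).
pose m1 : mem := (Nc, updR m.2 (Nc 1%N) (m.2 i)).
have Nb1 : Nb 1%N = A by rewrite /Nb /Na updN_eq updN_eq updN_neq // addnC.
have Nbi y : y != 1%N -> Nb y = m.1 y by move=> y1; rewrite /Nb /Na !updN_neq.
have A1 : 1%N != A by lia.
have Nc1 : Nc 1%N = A by rewrite /Nc Nb1 updN_neq.
have m1N y : y != 1%N -> y != A -> m1.1 y = m.1 y.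
  by move=> y1 yA; rewrite /= /Nc Nb1 updN_neq // Nbi.
have m1A : m1.1 A = m.1 i by rewrite /= /Nc Nb1 updN_eq Nbi //; lia.
have m1R y : y != A -> m1.2 y = m.2 y by move=> yA; rewrite /= Nc1 updR_neq.
have m1RA : m1.2 A = m.2 i by rewrite /= Nc1 updR_eq.
have m10 : m1.1 0%N = m.1 0%N by apply: m1N; lia.
have [|m' i' c'] := IH m1 _ lb ul; first by rewrite m10.
have E : iseq (save_code (i :: l)) m = Some m' by rewrite -i'.
clear i'; clearbody m1.
exists m' => //; rewrite m10 in c'; have [c1 c2 c3] := c'.
have lw j : j \in l -> (2 <= j < nregs)%N by move=> jl; exact: (allP lb).
split=> [j|y y1 yl|y yl].
- rewrite inE => /orP[/eqP->|jl].
    have nA j' : j' \in l -> A != (m.1 0%N + stride * j')%N.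
      by move=> jl; rewrite stride_inj; apply: contraNneq il => ->.
    by rewrite -/A c2 ?c3 ?m1A ?m1RA // eq_sym.
  have [-> ->] := c1 j jl; have := lw j jl => jb.
  by rewrite m1N ?m1R //; lia.
- rewrite c2 //; last by move=> j jl; apply: yl; rewrite inE jl orbT.
  by rewrite m1N //; apply: yl; rewrite mem_head.
rewrite c3 //; last by move=> j jl; apply: yl; rewrite inE jl orbT.
by rewrite m1R //; apply: yl; rewrite mem_head.
Qed.

(** Cells 2 and 3 are the source and target pointers; they are free because [save_code] has already
    copied the low cells. *)
Definition copy_body : rcmd := ris [:: NLoad 4 2; NStore 3 4; RLoad 2 2; RStore 3 2;
  NConst 1 1; NAdd 2 2 1; NConst 1 stride; NAdd 3 3 1].

Lemma copy_body_ok (m : mem) : (nregs <= m.1 2%N)%N -> (nregs <= m.1 3%N)%N ->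
  exists m', [/\ rrun copy_body m 8 m', m'.1 2%N = (m.1 2%N).+1, m'.1 3%N = (m.1 3%N + stride)%N &
   [/\ m'.1 (m.1 3%N) = m.1 (m.1 2%N), m'.2 (m.1 3%N) = m.2 (m.1 2%N),
    forall y, y \notin [:: 1; 2; 3; 4]%N -> y != m.1 3%N -> m'.1 y = m.1 y &
    forall y, y != 2%N -> y != m.1 3%N -> m'.2 y = m.2 y]].
Proof.
have ng := nregs_gt.
case: m => N R /= b2 b3.
pose N1 := updN N 4%N (N (N 2%N)).
pose N2 := updN N1 (N 3%N) (N (N 2%N)).
pose N3 := updN (updN N2 1%N 1) 2 (N 2%N).+1.
pose N4 := updN (updN N3 1%N stride) 3 (N 3%N + stride).
pose R1 := updR R 2 (R (N 2%N)).
pose R2 := updR R1 (N 3%N) (R (N 2%N)).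
have n3 x : (x < 20)%N -> N 3%N != x by lia.
have n3' x : (x < 20)%N -> x != N 3%N by lia.
exists (N4, R2); split.
- apply: (@run_ris [:: NLoad 4 2; NStore 3 4; RLoad 2 2; RStore 3 2;
    NConst 1 1; NAdd 2 2 1; NConst 1 stride; NAdd 3 3 1]) => //.
  have -> : N4 = updN (updN N3 1%N stride) 3 (updN N3 1%N stride 3 + updN N3 1%N stride 1).
    rewrite /N4 updN_eq; congr (updN _ _ (_ + _)); rewrite /N3 /N2 /N1.
    by rewrite !updN_neq ?n3'.
  have -> : N3 = updN (updN N2 1%N 1) 2 (updN N2 1%N 1 2 + updN N2 1%N 1 1).
    rewrite /N3 updN_eq addn1; congr (updN _ _ _.+1); rewrite /N2 /N1.
    by rewrite !updN_neq ?n3'.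
  have -> : R2 = updR (updR R 2 (R (N2 2%N))) (N2 3%N) (updR R 2 (R (N2 2%N)) 2%N).
    have e2 : N2 2%N = N 2%N by rewrite /N2 /N1 !updN_neq ?n3'.
    have e3 : N2 3%N = N 3%N by rewrite /N2 /N1 !updN_neq ?n3'.
    by rewrite /R2 /R1 e2 e3 updR_eq.
  have -> : N2 = updN N1 (N1 3%N) (N1 4%N).
    by rewrite /N2 /N1 updN_eq updN_neq.
  reflexivity.
- by rewrite /= /N4 updN_neq // updN_neq // updN_eq.
- by rewrite /= /N4 updN_eq.
split=> /=.
- by rewrite /N4 /N3 /N2; do 4 rewrite updN_neq ?n3 //; rewrite updN_eq.
- by rewrite /R2 updR_eq.
- move=> y; rewrite !inE !negb_or => /and4P[y1 y2 y3 y4] y5.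
  by rewrite /N4 /N3 /N2 /N1 !updN_neq.
by move=> y y2 y3; rewrite /R2 /R1 !updR_neq.
Qed.

(** All targets lie at or above the base and all sources below it, so nothing is overwritten before
    it is read. *)
Lemma copy_loop_ok j (m : mem) : (nregs <= m.1 2%N)%N -> m.1 0%N = (m.1 2%N + j)%N ->
  m.1 3%N = (m.1 0%N + stride * m.1 2%N)%N ->
  exists m' t, [/\ rrun (RWhN 2 0 copy_body) m t m', (t <= 10 * j + 2)%N, m'.1 0%N = m.1 0%N &
   [/\ forall i, (m.1 2%N <= i < m.1 0%N)%N ->
        m'.1 (m.1 0%N + stride * i)%N = m.1 i /\ m'.2 (m.1 0%N + stride * i)%N = m.2 i,
    forall y, y \notin [:: 1; 2; 3; 4]%N ->
      (forall i, (m.1 2%N <= i)%N -> y != (m.1 0%N + stride * i)%N) -> m'.1 y = m.1 y &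
    forall y, y != 2%N ->
      (forall i, (m.1 2%N <= i)%N -> y != (m.1 0%N + stride * i)%N) -> m'.2 y = m.2 y]].
Proof.
have ng := nregs_gt.
elim: j m => [|j IH] m b2 b0 b3.
  exists m, 2%N; split=> //; first by apply: run_whNF; rewrite b0 addn0 ltnn.
  by split=> // i; rewrite b0; lia.
have b3' : (nregs <= m.1 3%N)%N by rewrite b3 b0 -addnA (leq_trans b2) // leq_addr.
have [m1 [r1 m12 m13 [m1N m1R k1 kR1]]] := copy_body_ok b2 b3'.
have m10 : m1.1 0%N = m.1 0%N by rewrite k1 //; lia.
have [||| m' [t' [r' c' m'0 [h1 h2 h3]]]] := IH m1.
- by rewrite m12; lia.
- by rewrite m10 m12 b0; lia.
- by rewrite m13 m10 m12 b3 mulnS addnA addnAC.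
rewrite m10 m12 in h1 h2 h3.
exists m', (8 + t').+2; split; [|lia|by rewrite m'0|].
  by apply: (run_whNT _ r1 r'); rewrite b0; lia.
have ne i : ((m.1 2%N).+1 <= i)%N -> m.1 3%N != (m.1 0%N + stride * i)%N.
  by move=> il; rewrite b3 stride_inj neq_ltn il.
split.
- move=> i /andP[i1 i2]; case: (eqVneq i (m.1 2%N)) => [->|ni].
    have n3 : m.1 3%N \notin [:: 1; 2; 3; 4]%N by rewrite !inE; lia.
    have n2 : m.1 3%N != 2%N by lia.
    by rewrite -b3 (h2 _ n3 ne) (h3 _ n2 ne) m1N m1R.
  have lt : ((m.1 2%N).+1 <= i < m.1 0%N)%N by lia.
  have [-> ->] := h1 i lt.
  have i3 : i != m.1 3%N by rewrite b3; move: (stride * _)%N => q; lia.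
  by rewrite kR1 ?k1 // ?inE; lia.
- move=> y y1 yi; rewrite h2 // => [|i il]; last by apply: yi; lia.
  by rewrite k1 // b3 yi.
move=> y y1 yi; rewrite h3 // => [|i il]; last by apply: yi; lia.
by rewrite kR1 // b3 yi.
Qed.

(** [n] is parked in real cell 0, whose content, the real part of [lam], the program knows. Cell 0
    can then receive the base [2 ^ J * (#|E| + 1)], chosen to lie beyond the input, and [#|E|] is
    stored there as entry 0 of array 0. *)
Definition base_code (J : nat) : seq instr :=
  [:: OfNat 0 0; RConst 1 0; NConst 0 1; NAdd 0 0 1] ++ nseq J (NAdd 0 0 0) ++ [:: NStore 0 1].

Definition prelude (J : nat) : rcmd :=
  RSeq (ris (base_code J)) (RSeq (ris (save_code (iota 2 (nregs - 2))))
  (RSeq (ris [:: NConst 2 nregs; NConst 3 (stride * nregs); NAdd 3 3 0]) (RWhN 2 0 copy_body))).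

(** Every memory with a sufficiently high base represents a state, so cells need no
    initialization. *)
Definition view (m : mem) : st :=
  St (fun x => m.1 (vn x)) (fun a i => m.1 (m.1 0%N + (stride * i + a))%N)
     (fun x => Complex (m.2 (4 * x)%N) (m.2 (4 * x).+1))
     (fun a i => Complex (m.2 (m.1 0%N + (stride * i + 2 * a))%N)
                         (m.2 (m.1 0%N + (stride * i + 2 * a)).+1)).

Lemma sim_view m : (nregs <= m.1 0%N)%N -> sim m (view m).
Proof. by []. Qed.

Lemma prelude_ok J (ni : seq nat) (ri : seq RR) : (nregs <= 2 ^ J)%N ->
  (size ni <= 2 ^ J * (nth 0 ni 1).+1)%N -> (size ri <= 2 ^ J * (nth 0 ni 1).+1)%N ->
  exists m' t s, [/\ rrun (prelude J) (nth 0%N ni, nth 0 ri) t m',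
    (t <= J + 4 * nregs + 10 * 2 ^ J * (nth 0 ni 1).+1 + 10)%N, sim m' s &
    [/\ na s 0 0 = nth 0%N ni 1,
      forall i, (2 <= i < size ni)%N -> na s 0 i = nth 0%N ni i,
      forall i, (2 <= i < size ri)%N -> ca s 0 i = (nth 0 ri i)%:C%C &
      cv s 0 = (nth 0%N ni 0)%:R]].
Proof.
have ng := nregs_gt.
move=> J1 J2 J3; set e := nth 0%N ni 1 in J2 J3 *; set B := (2 ^ J * e.+1)%N in J2 J3 *.
have Bn : (nregs <= B)%N by rewrite (leq_trans J1) // /B leq_pmulr.
have B10 : (10 * 2 ^ J * e.+1 = 10 * B)%N by rewrite /B mulnA.
pose N0 := updN (updN (nth 0%N ni) 0 1) 0 e.+1.
pose R0 := updR (updR (nth 0 ri) 0 (nth 0%N ni 0)%:R) 1 0.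
have [m1 [i1 d1 k1 R1]] := iseq_double J 0 (N0, R0).
have m10 : m1.1 0%N = B by rewrite d1 /N0 /= updN_eq.
have m11 : m1.1 1%N = e by rewrite k1 //= /N0 !updN_neq.
pose m2 : mem := (updN m1.1 B e, m1.2).
have r2 : rrun (ris (base_code J)) (nth 0%N ni, nth 0 ri) (J + 5) m2.
  apply: run_ris; last by rewrite /base_code !size_cat size_nseq /=; lia.
  have E : iseq [:: OfNat 0 0; RConst 1 0; NConst 0 1; NAdd 0 0 1] (nth 0%N ni, nth 0 ri) = Some (N0, R0).
    by rewrite /= updN_eq updN_neq // add1n.
  by rewrite /base_code (iseq_cat _ E) (iseq_cat _ i1) /= m10 m11.
clear i1.
have m20 : m2.1 0%N = B by rewrite /= updN_neq //; lia.
have lowN x : (1 < x < B)%N -> m2.1 x = nth 0%N ni x.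
  by move=> xl; rewrite /= updN_neq ?k1 /N0 /= ?updN_neq //; lia.
have lowR x : (1 < x)%N -> m2.2 x = nth 0 ri x.
  by move=> xl; rewrite /= R1 /R0 /= !updR_neq //; lia.
have [|||m3 i3 [s1 s2 s3]] := @save_ok (iota 2 (nregs - 2)) m2.
- by rewrite m20.
- by apply/allP => i; rewrite mem_iota; lia.
- exact: iota_uniq.
rewrite m20 in s1 s2 s3.
have r3 := run_iseq i3; clear i3.
have sz3 : size (save_code (iota 2 (nregs - 2))) = (4 * (nregs - 2))%N.
  by rewrite size_save_code size_iota.
have low3 x : (x < B)%N -> forall i, i \in iota 2 (nregs - 2) -> x != (B + stride * i)%N.
  by move=> xB i _; rewrite neq_ltn (leq_trans xB) // leq_addr.
have m30 : m3.1 0%N = B by rewrite s2 ?m20 //; apply: low3; lia.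
pose m4 : mem := (updN (updN (updN m3.1 2%N nregs) 3 (stride * nregs)) 3 (stride * nregs + B), m3.2)%N.
have r4 : rrun (ris [:: NConst 2 nregs; NConst 3 (stride * nregs); NAdd 3 3 0]) m3 3 m4.
  apply: (@run_iseq [:: _; _; _]) => /=; rewrite /m4; congr (Some (updN _ _ _, _)).
  by rewrite updN_eq !updN_neq // m30.
have m40 : m4.1 0%N = B by rewrite /= !updN_neq.
have m42 : m4.1 2%N = nregs by rewrite /= updN_neq // updN_neq // updN_eq.
have m43 : m4.1 3%N = (m4.1 0%N + stride * m4.1 2%N)%N.
  by rewrite m40 m42 /= updN_eq addnC.
have [||m5 [t5 [r5 c5 m50 [h1 h2 h3]]]] := @copy_loop_ok (B - nregs) m4 _ _ m43.
- by rewrite m42.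
- by rewrite m40 m42; lia.
rewrite m40 m42 in h1 h2 h3.
have m5B : m5.1 0%N = B by rewrite m50.
have far x : (x < B)%N -> forall i, (nregs <= i)%N -> x != (B + stride * i)%N.
  by move=> xB i _; rewrite neq_ltn (leq_trans xB) // leq_addr.
have cell i : (2 <= i < B)%N -> m5.1 (B + stride * i)%N = nth 0%N ni i /\
                                m5.2 (B + stride * i)%N = nth 0 ri i.
  move=> /andP[i1 i2]; have [il|il] := ltnP i nregs.
    have ii : i \in iota 2 (nregs - 2) by rewrite mem_iota; lia.
    have fi j : (nregs <= j)%N -> (B + stride * i)%N != (B + stride * j)%N.
      by move=> jl; rewrite stride_inj; lia.
    have Bi : (20 < B + stride * i)%N by move: (stride * i)%N => q; lia.
    rewrite h2 //; last by rewrite !inE; move: Bi; move: (B + stride * i)%N => q; lia.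
    rewrite h3 //; last by move: Bi; move: (B + stride * i)%N => q; lia.
    rewrite /= !updN_neq; try by (move: Bi; move: (B + stride * i)%N => q; lia).
    by have [-> ->] := s1 i ii; rewrite lowN ?lowR //; lia.
  have [-> ->] := h1 i ltac:(lia).
  rewrite /= !updN_neq; try lia.
  rewrite s2; [|lia|exact: low3].
  by rewrite s3; [rewrite lowN ?lowR //; lia|exact: low3].
exists m5, (J + 5 + (4 * (nregs - 2) + (3 + t5)))%N, (view m5); split.
- by apply: run_seq r2 _; rewrite -sz3; apply: run_seq r3 (run_seq r4 r5).
- by rewrite B10; clear -ng Bn c5; clearbody B; lia.
- by apply: sim_view; rewrite m5B.
split.
- rewrite /= m5B muln0 addn0 addn0 h2; last first.
  + by move=> i il; rewrite -{1}[B]addn0 -(muln0 stride) stride_inj; lia.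
  + by rewrite !inE; lia.
  rewrite /= !updN_neq; try lia.
  rewrite s2; [|lia|]; last first.
    by move=> i; rewrite mem_iota => il; rewrite -{1}[B]addn0 -(muln0 stride) stride_inj; lia.
  by rewrite /= updN_eq.
- move=> i il; rewrite /= m5B addn0; apply: (proj1 (cell i _)); lia.
- move=> i il; rewrite /= m5B muln0 addn0; have [_ ->] := cell i ltac:(lia).
  rewrite /real_complex_def; congr Complex.
  (* The cell of the imaginary part is no copy target and lies beyond the input, hence it still
     holds 0. *)
  have nn j : (B + stride * i).+1 != (B + stride * j)%N.
    by rewrite -addnS eqn_add2l strideE; lia.
  rewrite h3; [|by clear -ng Bn; move: (stride * i)%N => q; clearbody B; lia|by move=> j _; apply: nn].
  rewrite /= s3; last by move=> j _; apply: nn.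
  rewrite lowR; last by clear -ng Bn; move: (stride * i)%N => q; clearbody B; lia.
  by rewrite nth_default // (leq_trans J3) // -addnS leq_addr.
have R5 x : (x < 2)%N -> m5.2 x = R0 x.
  move=> xl; rewrite h3; [|lia|apply: far; lia].
  by rewrite /= s3; [rewrite /= R1|apply: low3; lia].
rewrite /= !R5 // /R0 updR_eq updR_neq // updR_eq.
by rewrite -(rmorph_nat (real_complex RR)).
Qed.

(** * The program *)

Fixpoint amods (c : cmd) : seq nat :=
  match c with
  | nput a _ _ => [:: a]
  | cseq c1 c2 | cif _ _ c1 c2 => amods c1 ++ amods c2
  | cfor _ _ c => amods c
  | _ => [::]
  end.

Fixpoint cmods (c : cmd) : seq nat :=
  match c with
  | cset x _ => [:: x]
  | cseq c1 c2 | cif _ _ c1 c2 => cmods c1 ++ cmods c2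
  | cfor _ _ c => cmods c
  | _ => [::]
  end.

Fixpoint camods (c : cmd) : seq nat :=
  match c with
  | cput a _ _ => [:: a]
  | cseq c1 c2 | cif _ _ c1 c2 => camods c1 ++ camods c2
  | cfor _ _ c => camods c
  | _ => [::]
  end.

Lemma ev_aframe c s z : z \notin amods c -> na (ev c s) z =1 na s z.
Proof.
elim: c s => //= [a e1 e2|c1 IH1 c2 IH2|e1 e2 c1 IH1 c2 IH2|x y c IH] s.
- by rewrite inE => /negbTE zx i; rewrite zx.
- by rewrite mem_cat => /norP[z1 z2] i; rewrite IH2 ?IH1.
- by rewrite mem_cat => /norP[z1 z2]; case: ifP => _; [apply: IH1|apply: IH2].
by move=> zc i; elim: (nv s y) => //= j IHj; rewrite IH.
Qed.

Lemma ev_cframe c s z : z \notin cmods c -> cv (ev c s) z = cv s z.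
Proof.
elim: c s => //= [x e|c1 IH1 c2 IH2|e1 e2 c1 IH1 c2 IH2|x y c IH] s.
- by rewrite inE => /negbTE zx; rewrite zx.
- by rewrite mem_cat => /norP[z1 z2]; rewrite IH2 ?IH1.
- by rewrite mem_cat => /norP[z1 z2]; case: ifP => _; [apply: IH1|apply: IH2].
by move=> zc; elim: (nv s y) => //= j IHj; rewrite IH.
Qed.

Lemma ev_caframe c s z : z \notin camods c -> ca (ev c s) z =1 ca s z.
Proof.
elim: c s => //= [a e1 e2|c1 IH1 c2 IH2|e1 e2 c1 IH1 c2 IH2|x y c IH] s.
- by rewrite inE => /negbTE zx i; rewrite zx.
- by rewrite mem_cat => /norP[z1 z2] i; rewrite IH2 ?IH1.
- by rewrite mem_cat => /norP[z1 z2]; case: ifP => _; [apply: IH1|apply: IH2].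
by move=> zc i; elim: (nv s y) => //= j IHj; rewrite IH.
Qed.

Record frame (mn ma mc mca : seq nat) (s s' : st) : Prop := Frame {
  fn : forall z, z \notin mn -> nv s' z = nv s z;
  fa : forall z i, z \notin ma -> na s' z i = na s z i;
  fc : forall z, z \notin mc -> cv s' z = cv s z;
  fca : forall z i, z \notin mca -> ca s' z i = ca s z i }.

Lemma ev_frame c s : frame (nmods c) (amods c) (cmods c) (camods c) s (ev c s).
Proof.
split=> [z|z i|z|z i] h; [exact: ev_nframe|exact: ev_aframe|exact: ev_cframe|exact: ev_caframe].
Qed.

Lemma for_frame c x k s :
  frame (x :: nmods c) (amods c) (cmods c) (camods c) s (for_st (ev c) x k s).
Proof.
split=> [z|z i|z|z i].
- rewrite inE => /norP[zx zc]; apply: for_st_frame => // s' _; exact: ev_nframe.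
- by move=> zc; elim: k => //= j IHj; rewrite ev_aframe.
- by move=> zc; elim: k => //= j IHj; rewrite ev_cframe.
by move=> zc; elim: k => //= j IHj; rewrite ev_caframe.
Qed.

(* The invariant [P] of a loop is proved together with the frame condition. *)
Lemma for_ind (P : nat -> st -> Prop) c x k s :
  P 0%N (setn s x 0) ->
  (forall i s', (i < k)%N -> nv s' x = i ->
     frame (x :: nmods c) (amods c) (cmods c) (camods c) s s' ->
     P i s' -> P i.+1 (setn (ev c s') x i.+1)) ->
  P k (for_st (ev c) x k s).
Proof.
move=> P0 PS; suff: forall i, (i <= k)%N -> P i (for_st (ev c) x i s) by apply.
elim=> [//|i IH] ik /=; apply: PS => //; [exact: for_st_var|exact: for_frame|].
exact/IH/ltnW.
Qed.

Definition neq e1 e2 e3 e4 := nite e1 e2 e4 (nite e2 e1 e4 e3).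

Lemma nev_neq e1 e2 e3 e4 s :
  nev (neq e1 e2 e3 e4) s = if nev e1 s == nev e2 s then nev e3 s else nev e4 s.
Proof. by rewrite /=; case: ltngtP. Qed.

Fixpoint nmulc (b : nat) (e : nexp) : nexp := if b is b'.+1 then nadd (nmulc b' e) e else ncst 0.

Lemma nev_nmulc b e s : nev (nmulc b e) s = (b * nev e s)%N.
Proof. by elim: b => //= b ->; rewrite mulSn addnC. Qed.

Definition cif0 e c1 c2 := cif (ncst 0) e c1 c2.
Definition nif0 e e1 e2 := nite (ncst 0) e e1 e2.

Definition cseqs := foldr cseq cskip.

(* The bound variables 0-9 hold [n], [|E|], [k], [m + 1], [2 m], [2 m + 1],
   [W = D ^ (2 m)], [Q = 2 ^ (2 m + 1)], [W + Q] and [n + k].  Natural arrays: the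
   input, powers of 2, offsets of the edges in the input, offsets of their
   activities, the current walk, its visited set, the codes of the sets seen so
   far, base-[D] or base-2 digits, a subset [U] of the visited set, a subset of [U].
   Complex arrays: 0 is the real input, 1 and 2 the truncated even and odd
   products over the sets seen so far, 3 the polynomial of [U], 4 scratch, 5 the
   quotient of 1 by 2.  Complex variable 4 accumulates the answer. *)
Notation vN := 0%N. Notation vE := 1%N. Notation vK := 2%N. Notation vM := 3%N.
Notation vL := 4%N. Notation vL1 := 5%N. Notation vW := 6%N. Notation vQ := 7%N.
Notation vX := 8%N. Notation vP := 9%N.

Notation aIN := 0%N. Notation aP2 := 1%N. Notation aOFF := 3%N. Notation aPO := 4%N.
Notation aPW := 5%N. Notation aMK := 6%N. Notation aSEEN := 7%N. Notation aDIG := 8%N.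
Notation aUB := 9%N. Notation aWB := 10%N.

Definition isbound : pred nat := fun y => (y < 10)%N.

(* There is no division: the quotient of [x] by [b] is the number of [i] with [b (i + 1) <= x]. *)
Definition ndivc b x := nsum 40 vX (nite (nmulc b (nadd (nvar 40) (ncst 1))) (nadd (nvar x) (ncst 1)) (ncst 1) (ncst 0)).

Definition c_digits (b len : nat) : cmd :=
  cfor 32 len (cseqs [:: nset 21 (ndivc b 20);
    nput aDIG (nvar 32) (nsub (nvar 20) (nmulc b (nvar 21))); nset 20 (nvar 21)]).

Definition e_size i := narr aIN (narr aOFF (nvar i)).
Definition e_vert i t := narr aIN (nadd (nadd (narr aOFF (nvar i)) (ncst 1)) (nvar t)).
Definition e_in u i := nsum 50 vK (nite (nvar 50) (e_size i) (neq (e_vert i 50) (nvar u) (ncst 1) (ncst 0)) (ncst 0)).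
Definition e_adj u p := nsum 51 vE (nif0 (e_in u 51) (nif0 (e_in p 51) (ncst 1) (ncst 0)) (ncst 0)).
Definition e_rank u p := nsum 52 vN (nite (nvar 52) (nvar u) (nif0 (e_adj 52 p) (ncst 1) (ncst 0)) (ncst 0)).
(** One more than the next vertex, or 0 if no neighbour has the rank in variable 21; at most one
    summand is nonzero. *)
Definition e_next := nsum 53 vN (nif0 (e_adj 53 22) (neq (e_rank 53 22) (nvar 21) (nadd (nvar 53) (ncst 1)) (ncst 0)) (ncst 0)).

Definition c_walk : cmd :=
  cseq (nput aPW (ncst 0) (nvar 16))
  (cfor 18 vL (cseqs [:: nset 22 (narr aPW (nvar 18)); nset 21 (narr aDIG (nvar 18));
     nset 34 e_next;
     nput aPW (nadd (nvar 18) (ncst 1)) (nif0 (nvar 34) (nsub (nvar 34) (ncst 1)) (nvar 22))])).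

Definition e_card a := nsum 40 vN (narr a (nvar 40)).

(** Variables 23, 24 and 26 receive the cardinality, the code, and whether the code is among the
    first entries of [aSEEN], as many as variable 25 says. That search is a guarded sum up to [vW],
    since variable 25 is assigned and cannot bound a loop. *)
Definition c_mark : cmd :=
  cseqs [:: cfor 33 vN (nput aMK (nvar 33) (nite (nvar 16) (nvar 33) (ncst 0)
     (nif0 (nsum 40 vL1 (neq (narr aPW (nvar 40)) (nvar 33) (ncst 1) (ncst 0))) (ncst 1) (ncst 0))));
   nset 23 (e_card aMK);
   nset 24 (nsum 40 vN (nif0 (narr aMK (nvar 40)) (narr aP2 (nvar 40)) (ncst 0)));
   nset 26 (nsum 40 vW (nite (nvar 40) (nvar 25) (neq (narr aSEEN (nvar 40)) (nvar 24) (ncst 1) (ncst 0)) (ncst 0)))].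

(** The digit that belongs to a vertex is found by its rank among the elements of [src], as in
    [mem_subset_of_index]. *)
Definition c_subset (src dst : nat) : cmd :=
  cseq (c_digits 2 vL1)
  (cfor 33 vN (nput dst (nvar 33) (nif0 (narr src (nvar 33))
     (narr aDIG (nsum 40 vN (nite (nvar 40) (nvar 33) (narr src (nvar 40)) (ncst 0)))) (ncst 0)))).

Definition e_index i := nsum 54 vK (nite (nvar 54) (e_size i)
   (nif0 (narr aWB (e_vert i 54)) (narr aP2 (nvar 54)) (ncst 0)) (ncst 0)).

Definition e_phi i := nadd (narr aPO (nvar i)) (e_index i).

(** The activities start at entry 3, after [lam] and [eps]. Each entry is a real number in a complex
    cell, hence the recombination with ['i]. *)
Definition x_weight : cexp :=
  cbig true 55 vE (cadd (carr 0 (nadd (ncst 3) (nmulc 2 (e_phi 55))))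
    (cmul (ccst 'i%C) (carr 0 (nadd (ncst 4) (nmulc 2 (e_phi 55)))))).

(** Visited sets have at most [2 m + 1] elements, so the bound [vQ] covers all subsets of [U], and
    the guard cuts it down to [2 ^ #|U|]. *)
Definition c_poly : cmd :=
  cseq (cfor 19 vM (cput 3 (nvar 19) (ccst 0)))
  (cfor 28 vQ (cif (nvar 28) (narr aP2 (nvar 29))
     (cseqs [:: nset 20 (nvar 28); c_subset aUB aWB; nset 30 (e_card aWB);
        cif (nvar 30) (nvar vM) (cput 3 (nvar 30) (cadd (carr 3 (nvar 30)) x_weight)) cskip])
     cskip)).

(** The product is formed in array 4, since its coefficients need the old entries of [A]. *)
Definition c_mul (A : nat) : cmd :=
  cseq (cfor 19 vM (cput 4 (nvar 19) (cbig false 44 vM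
          (cite (nvar 44) (nadd (nvar 19) (ncst 1))
            (cmul (carr A (nvar 44)) (carr 3 (nsub (nvar 19) (nvar 44)))) (ccst 0)))))
       (cfor 19 vM (cput A (nvar 19) (carr 4 (nvar 19)))).

Definition c_cluster : cmd :=
  cfor 27 vQ (cif (nvar 27) (narr aP2 (nvar 23))
    (cseqs [:: nset 20 (nvar 27); c_subset aMK aUB; nset 29 (e_card aUB); c_poly;
       nset 20 (nsub (nvar 23) (nvar 29));
       nset 31 (nsub (nvar 20) (nmulc 2 (ndivc 2 20)));
       cif0 (nvar 31) (c_mul 2) (c_mul 1)])
    cskip).

Definition c_word (D : nat) : cmd :=
  cseqs [:: nset 20 (nvar 17); c_digits D vL; c_walk; c_mark;
    cif0 (nvar 26) cskip
      (cseqs [:: nput aSEEN (nvar 25) (nvar 24); nset 25 (nadd (nvar 25) (ncst 1)); c_cluster])].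

(** For [|lam| > 1] the arguments are the reflected point and, as [mu], one vertex's share of the
    power in front of the reflected partition function. The quotient in array 5 comes from forward
    substitution. *)
Definition c_vertex (D : nat) (lam mu : CC) : cmd :=
  cseqs [:: cfor 19 vM (cseq (cput 1 (nvar 19) (cite (nvar 19) (ncst 1) (ccst 1) (ccst 0)))
                             (cput 2 (nvar 19) (cite (nvar 19) (ncst 1) (ccst 1) (ccst 0))));
    nset 25 (ncst 0);
    cfor 17 vW (c_word D);
    cfor 19 vM (cput 5 (nvar 19) (csub (carr 1 (nvar 19)) (cbig false 44 vM
       (cite (nvar 44) (nvar 19) (cmul (carr 2 (nsub (nvar 19) (nvar 44))) (carr 5 (nvar 44))) (ccst 0)))));
    cset 4 (cmul (cvar 4) (cmul (ccst mu) (cbig false 44 vM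
       (cmul (carr 5 (nvar 44)) (cbig true 45 vM (cite (nvar 45) (nvar 44) (ccst lam) (ccst 1)))))))].

Definition c_parse : cmd :=
  cseqs [:: nput aP2 (ncst 0) (ncst 1);
    cfor 19 vP (nput aP2 (nadd (nvar 19) (ncst 1)) (nadd (narr aP2 (nvar 19)) (narr aP2 (nvar 19))));
    nput aOFF (ncst 0) (ncst 2); nput aPO (ncst 0) (ncst 0);
    cfor 19 vE (cseq
      (nput aOFF (nadd (nvar 19) (ncst 1)) (nadd (nadd (narr aOFF (nvar 19)) (e_size 19)) (ncst 1)))
      (nput aPO (nadd (nvar 19) (ncst 1)) (nadd (narr aPO (nvar 19)) (narr aP2 (e_size 19)))))].

Definition c_main (D : nat) (lam mu : CC) (flag : bool) : cmd :=
  cseqs [:: c_parse; cset 4 (ccst 1); cfor 16 vN (c_vertex D lam mu);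
    cset 0 (if flag then ccj (cvar 4) else cvar 4)].

Lemma nwf_nmulc B tau b e : (2 * tau + 12 < nregs)%N -> nwf B tau e -> nwf B tau.+1 e ->
  nwf B tau (nmulc b e).
Proof. by move=> tl w w'; elim: b => [|b IH] /=; rewrite tl ?IH. Qed.

Lemma c_digits_wf b : cwf isbound (c_digits b vL).
Proof.
have w1 : nwf isbound 2 (nmulc b (nadd (nvar 40) (ncst 1))) by apply: nwf_nmulc; vm_compute.
have w2 : nwf isbound 2 (nmulc b (nvar 21)) by apply: nwf_nmulc; vm_compute.
rewrite /c_digits /ndivc; move: (nmulc b _) (nmulc b _) w1 w2 => a1 a2 w1 w2.
by rewrite /cseqs /= w1 w2; vm_compute.
Qed.

Lemma c_word_wf D : cwf isbound (c_word D).
Proof.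
apply/andP; split; first by vm_compute.
apply/andP; split; [exact: c_digits_wf|by vm_compute].
Qed.

Lemma c_main_wf D lam mu flag : cwf isbound (c_main D lam mu flag).
Proof.
apply/andP; split; first by vm_compute.
apply/andP; split; first by vm_compute.
apply/andP; split; last by case: flag; vm_compute.
apply/and5P; split; try by vm_compute.
apply/andP; split; first by vm_compute.
apply/andP; split; first by vm_compute.
apply/andP; split; first by vm_compute.
apply/andP; split; last by vm_compute.
by apply/and5P; split; try (by vm_compute); apply/andP; split; [vm_compute|exact: c_word_wf].
Qed.

(** * Correctness of the program *)

Lemma sum_lt q X : (\sum_(i < X) (i < q) = minn q X)%N.
Proof.
elim: X => [|X IH]; first by rewrite big_ord0 minn0.
by rewrite big_ord_recr /= IH; lia.
Qed.

Lemma sum_indicator (I : finType) (P : pred I) : (\sum_(i : I) P i = #|[set i | P i]|)%N.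
Proof.
rewrite -sum1_card big_mkcond [RHS]big_mkcond; apply: eq_bigr => i _.
by rewrite inE; case: (P i).
Qed.

Lemma sum_indicator_gt0 (I : finType) (P : pred I) : (0 < \sum_(i : I) P i)%N = [exists i, P i].
Proof.
rewrite sum_indicator; apply/card_gt0P/existsP => [[j]|[j Pj]]; last by exists j; rewrite inE.
by rewrite inE => Pj; exists j.
Qed.

Lemma sum_nth_count k (l : seq nat) x : (size l <= k)%N ->
  (\sum_(t < k) ((t < size l) && (nth 0 l t == x)) = count_mem x l)%N.
Proof.
elim: l k => [|y l IH] k /= lk; first by rewrite big1.
by case: k lk => // k lk; rewrite big_ord_recl /= -(IH k).
Qed.

Lemma if_and_nat (a b : bool) : (if a then (if b then 1 else 0) else 0)%N = (a && b) :> nat.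
Proof. by case: a; case: b. Qed.

Lemma if_nat (a : bool) : (if a then 1 else 0)%N = a :> nat.
Proof. by case: a. Qed.

Lemma nev_ndivc b x s : (0 < b)%N -> x != 40%N -> (nv s x %/ b <= nv s vX)%N ->
  nev (ndivc b x) s = (nv s x %/ b)%N.
Proof.
move=> b0 x40 bX; rewrite /ndivc /=.
rewrite (eq_bigr (fun i : 'I_(nv s vX) => nat_of_bool (i < nv s x %/ b)))%N.
  by rewrite sum_lt; apply/minn_idPl.
move=> i _; rewrite nev_nmulc /= if_nat updN_eq updN_neq // !addn1 ltnS.
by rewrite leq_divRL // mulnC.
Qed.

Lemma c_digits_ok b len s : (1 < b)%N -> (len < 16)%N -> (nv s 20 <= nv s vX)%N ->
  forall t, (t < nv s len)%N -> na (ev (c_digits b len) s) aDIG t = (nv s 20 %/ b ^ t %% b)%N.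
Proof.
move=> b1 l16 xX; have b0 : (0 < b)%N by apply: ltnW.
set x0 := nv s 20%N in xX *.
rewrite /c_digits; set c := cseqs _; rewrite [ev _ _]/(for_st (ev c) 32 (nv s len) s).
suff : nv (for_st (ev c) 32 (nv s len) s) 20 = (x0 %/ b ^ nv s len)%N /\
  forall t, (t < nv s len)%N -> na (for_st (ev c) 32 (nv s len) s) aDIG t = (x0 %/ b ^ t %% b)%N.
  by case.
apply: (@for_ind (fun i s' => nv s' 20 = (x0 %/ b ^ i)%N /\
   forall t, (t < i)%N -> na s' aDIG t = (x0 %/ b ^ t %% b)%N)).
  by split=> //=; rewrite expn0 divn1.
move=> i s' il s'i F [s'x s'd].
have q : nev (ndivc b 20) s' = (x0 %/ b ^ i.+1)%N.
  rewrite nev_ndivc // s'x -?divnMA -?expnSr //.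
  by rewrite (fn F) // (leq_trans (leq_div _ _)).
have -> : ev c s' = setn (setna (setn s' 21 (x0 %/ b ^ i.+1)) aDIG i
    (nv s' 20 - b * (x0 %/ b ^ i.+1))) 20 (x0 %/ b ^ i.+1).
  rewrite /c /cseqs; cbn [ev foldr]; rewrite q; congr (setn (setna _ _ _ _) _ _).
    by rewrite /= updN_neq.
  by cbn [nev]; rewrite nev_nmulc; cbn [nev]; rewrite /= updN_eq updN_neq.
split=> [|t]; first by [].
rewrite ltnS leq_eqVlt /= => /orP[/eqP->|ti]; last by rewrite (ltn_eqF ti) ?andbF s'd.
rewrite ?eqxx /= s'x expnSr divnMA.
by rewrite {1}(divn_eq (x0 %/ b ^ i) b) mulnC addKn.
Qed.

Lemma nev_nsum x y e s : nev (nsum x y e) s = (\sum_(i < nv s y) nev e (setn s x i))%N.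
Proof. by []. Qed.

Lemma nev_if0 e e1 e2 s :
  nev (nif0 e e1 e2) s = if (0 < nev e s)%N then nev e1 s else nev e2 s.
Proof. by []. Qed.

(** * Input tables, walks and visited sets *)

Section Program.
Variables (n k m Delta : nat) (E : {set {set 'I_n}}) (phi : {set 'I_n} -> {set 'I_n} -> CC).
Hypothesis sizeE : edge_size_le E k.

Definition edge i : {set 'I_n} := nth set0 (enum E) i.
Definition verts i : seq nat := [seq val u | u <- enum (edge i)].

Lemma edge_in i : (i < #|E|)%N -> edge i \in E.
Proof. by move=> iE; rewrite -mem_enum mem_nth // -cardE. Qed.

Lemma edge_index e : e \in E -> exists2 i, (i < #|E|)%N & edge i = e.
Proof.
move=> eE; exists (index e (enum E)); first by rewrite cardE index_mem mem_enum.
by rewrite /edge nth_index ?mem_enum.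
Qed.

Lemma size_verts i : size (verts i) = #|edge i|.
Proof. by rewrite size_map -cardE. Qed.

Lemma size_verts_le i : (i < #|E|)%N -> (size (verts i) <= k)%N.
Proof. by move=> iE; rewrite size_verts sizeE // edge_in. Qed.

Let D := (Delta * k).+1.

(** What the program only reads once the input has been parsed; [inputs_frame] carries it along, as
    later commands assign neither variables below 16 nor these tables. *)
Record inputs (s : st) : Prop := Inputs {
  in_n : nv s vN = n; in_E : nv s vE = #|E|; in_K : nv s vK = k; in_M : nv s vM = m.+1;
  in_L : nv s vL = m.*2; in_L1 : nv s vL1 = m.*2.+1; in_W : nv s vW = (D ^ m.*2)%N;
  in_Q : nv s vQ = (2 ^ m.*2.+1)%N; in_X : nv s vX = (D ^ m.*2 + 2 ^ m.*2.+1)%N;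
  in_P : nv s vP = (n + k)%N;
  in_P2 : forall i, (i <= n + k)%N -> na s aP2 i = (2 ^ i)%N;
  in_size : forall i, (i < #|E|)%N -> na s aIN (na s aOFF i) = size (verts i);
  in_vert : forall i t, (i < #|E|)%N -> (t < size (verts i))%N ->
    na s aIN (na s aOFF i + 1 + t)%N = nth 0%N (verts i) t;
  in_phi : forall i j, (i < #|E|)%N -> (j < 2 ^ #|edge i|)%N ->
    ca s 0 (3 + 2 * (na s aPO i + j))%N =
      (complex.Re (phi (edge i) (subset_of_index (edge i) j)))%:C%C /\
    ca s 0 (4 + 2 * (na s aPO i + j))%N =
      (complex.Im (phi (edge i) (subset_of_index (edge i) j)))%:C%C }.

Lemma inputs_frame mn ma mc mca s s' : frame mn ma mc mca s s' ->
  [&& all (fun z => 16 <= z)%N mn, all (fun a => a \notin [:: aIN; aP2; aOFF; aPO]) ma &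
      0%N \notin mca] -> inputs s -> inputs s'.
Proof.
move=> F /and3P[/allP hn /allP ha hca] [i0 i1 i2 i3 i4 i5 i6 i7 i8 i9 j1 j2 j3 j4].
have vn' z : (z < 16)%N -> nv s' z = nv s z.
  by move=> z16; rewrite (fn F) //; apply/negP => /hn; rewrite leqNgt z16.
have an a i : a \in [:: aIN; aP2; aOFF; aPO] -> na s' a i = na s a i.
  by move=> ain; rewrite (fa F) //; apply/negP => /ha; rewrite ain.
have cn i : ca s' 0 i = ca s 0 i by rewrite (fca F).
split; rewrite ?vn' // => i.
- by move=> ii; rewrite an // j1.
- by move=> ii; rewrite !an // j2.
- by move=> t ii tt; rewrite !an // j3.
by move=> j ii jj; rewrite !an // !cn; apply: j4.
Qed.

Lemma inputs_setn s x v : (16 <= x)%N -> inputs s -> inputs (setn s x v).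
Proof.
move=> x16; apply: (@inputs_frame [:: x] [::] [::] [::]); last by rewrite /= x16.
by split=> // z; rewrite inE => zx /=; rewrite updN_neq.
Qed.

Definition rep (s : st) (a : nat) (S : {set 'I_n}) := forall u : 'I_n, na s a u = (u \in S) :> nat.

Lemma nev_in s u i (x : 'I_n) : inputs s -> u != 50%N -> i != 50%N -> (nv s i < #|E|)%N ->
  nv s u = x -> nev (e_in u i) s = (x \in edge (nv s i)).
Proof.
move=> I u50 i50 iE ux; rewrite /e_in /= (in_K I).
rewrite (eq_bigr (fun t : 'I_k => nat_of_bool ((t < size (verts (nv s i))) && (nth 0 (verts (nv s i)) t == x))))%N.
  rewrite sum_nth_count ?size_verts_le // /verts count_uniq_mem ?mem_val_enum //.
  by rewrite map_inj_uniq ?enum_uniq //; apply: val_inj.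
move=> t _; rewrite updN_eq !updN_neq // (in_size I iE) ux.
case: ltnP => //= ti; rewrite (in_vert I iE ti).
by case: ltngtP.
Qed.

Lemma nev_adj s u p (x y : 'I_n) : inputs s -> u \notin [:: 50; 51]%N -> p \notin [:: 50; 51]%N ->
  nv s u = x -> nv s p = y -> (0 < nev (e_adj u p) s)%N = adjacent E x y.
Proof.
rewrite !inE => I /norP[u1 u2] /norP[p1 p2] ux py.
have E1 (i : nat) : (i < #|E|)%N -> nev (e_in u 51) (setn s 51 i) = (x \in edge i).
  move=> iE; rewrite (nev_in (x := x) (inputs_setn _ _ I)) //=; rewrite ?updN_eq ?updN_neq //.
have E2 (i : nat) : (i < #|E|)%N -> nev (e_in p 51) (setn s 51 i) = (y \in edge i).
  move=> iE; rewrite (nev_in (x := y) (inputs_setn _ _ I)) //=; rewrite ?updN_eq ?updN_neq //.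
have -> : nev (e_adj u p) s = (\sum_(i < #|E|) ((x \in edge i) && (y \in edge i)))%N.
  rewrite /e_adj /nif0; cbn [nev]; rewrite (in_E I); apply: eq_bigr => i _.
  by rewrite E1 // E2 // !lt0b if_and_nat.
apply/idP/existsP => [|[e /and3P[eE xe ye]]].
  rewrite lt0n sum_nat_eq0 negb_forall => /existsP[ i ]; rewrite eqb0 negbK => /andP[xi yi].
  by exists (edge i); rewrite edge_in // xi.
have [i iE ie] := edge_index eE.
by rewrite (bigD1 (Ordinal iE)) //= ie xe ye.
Qed.

Lemma nev_rank s u p (x y : 'I_n) : inputs s -> u \notin [:: 50; 51; 52]%N -> p \notin [:: 50; 51; 52]%N ->
  nv s u = x -> nv s p = y -> nev (e_rank u p) s = nbr_rank E x y.
Proof.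
rewrite !inE !negb_or => I /and3P[u1 u2 u3] /and3P[p1 p2 p3] ux py.
have -> : nev (e_rank u p) s = (\sum_(z < n) (adjacent E z y && (z < x)))%N.
  rewrite /e_rank /nif0; cbn [nev]; rewrite (in_n I); apply: eq_bigr => z _.
  rewrite (nev_adj (x := z) (y := y) (inputs_setn _ _ I)) //=; rewrite ?updN_eq ?updN_neq //;
    try by rewrite !inE negb_or p1.
  by rewrite ?ux if_and_nat andbC.
by rewrite sum_indicator.
Qed.

Lemma nev_next s (y : 'I_n) : inputs s -> nv s 22 = y ->
  (if (0 < nev e_next s)%N then nev e_next s - 1 else val y)%N = val (walk_step E y (nv s 21)).
Proof.
move=> I sy; set d := nv s 21%N.
have -> : nev e_next s = (\sum_(u < n) (adjacent E u y && (nbr_rank E u y == d)) * u.+1)%N.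
  rewrite /e_next nev_nsum (in_n I); apply: eq_bigr => u _; rewrite nev_if0 nev_neq.
  have Ea : (0 < nev (e_adj 53 22) (setn s 53 u))%N = adjacent E u y.
    by apply: (nev_adj (inputs_setn _ _ I)) => //=; rewrite ?updN_eq ?updN_neq.
  have Er : nev (e_rank 53 22) (setn s 53 u) = nbr_rank E u y.
    by apply: (nev_rank (inputs_setn _ _ I)) => //=; rewrite ?updN_eq ?updN_neq.
  rewrite Ea Er.
  by rewrite -/d /= ?updN_eq ?addn1; case: (adjacent E u y) => //=; case: ltngtP; rewrite ?mul1n.
rewrite /walk_step; case: pickP => [u /andP[uy /eqP ur]|none] /=.
  rewrite (bigD1 u) //= uy ur eqxx mul1n big1 ?addn0 ?subn1 // => z zu.
  have [/andP[zy /eqP zr]|] := boolP (adjacent E z y && (nbr_rank E z y == d)); last by rewrite mul0n.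
  by rewrite (nbr_rank_inj zy uy _) ?eqxx ?zr ?ur // in zu.
by rewrite big1 // => z _; rewrite none.
Qed.

Lemma c_walk_ok s (v : 'I_n) w : inputs s -> nv s 16 = v ->
  (forall t, (t < m.*2)%N -> na s aDIG t = digit D w t) ->
  forall t, (t <= m.*2)%N -> na (ev c_walk s) aPW t = walk E D v w t :> nat.
Proof.
move=> I sv sd.
set s0 := setna s aPW 0 v.
have I0 : inputs s0.
  by apply: (@inputs_frame [::] [:: aPW] [::] [::] s) => //; split=> // z i; rewrite inE => /negbTE zx /=; rewrite zx.
rewrite /c_walk; set c := cseqs _; set cw := cseq _ _.
have -> : ev cw s = for_st (ev c) 18 m.*2 s0.
  by rewrite /s0 -(in_L I) -sv.
apply: (@for_ind (fun i s' => forall t, (t <= i)%N -> na s' aPW t = walk E D v w t :> nat)).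
  by move=> t; rewrite leqn0 => /eqP->.
move=> i s' il s'i F IH t.
have I' : inputs s' by apply: inputs_frame F _ I0.
have pi : na s' aPW i = walk E D v w i :> nat by apply: IH.
pose s1 := setn (setn s' 22 (na s' aPW (nv s' 18))) 21 (na s' aDIG (nv s' 18)).
have I1 : inputs s1 by do 2 apply: inputs_setn => //.
have pi1 : nv s1 22 = walk E D v w i :> nat by rewrite /= s'i.
have nx := nev_next (y := walk E D v w i) I1 pi1.
have d1 : nv s1 21 = digit D w i by rewrite /= updN_eq s'i (fa F) //= sd.
have -> : ev c s' = setna (setn s1 34 (nev e_next s1)) aPW (nv s' 18 + 1)%N
   (if (0 < nev e_next s1)%N then nev e_next s1 - 1 else na s' aPW (nv s' 18))%N by [].
rewrite s'i pi nx d1 addn1.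
rewrite leq_eqVlt => /orP[/eqP->|ti] /=; first by rewrite eqxx.
by rewrite (ltn_eqF ti) IH.
Qed.

Lemma rep_card s a S : inputs s -> rep s a S -> nev (e_card a) s = #|S|.
Proof.
move=> I r; rewrite /= (in_n I).
have -> : #|S| = #|[set u | u \in S]| by apply: eq_card => u; rewrite inE.
by rewrite -sum_indicator; apply: eq_bigr => u _; rewrite updN_eq r.
Qed.

Lemma c_mark_ok s (v : 'I_n) w : inputs s -> nv s 16 = v ->
  (nv s 25 <= D ^ m.*2)%N ->
  (forall t, (t <= m.*2)%N -> na s aPW t = walk E D v w t :> nat) ->
  let S := visited E D v w m.*2 in let s' := ev c_mark s in
  [/\ rep s' aMK S, nv s' 23 = #|S|, nv s' 24 = set_code S &
      (0 < nv s' 26)%N = [exists i : 'I_(nv s 25), na s aSEEN i == set_code S]].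
Proof.
move=> I sv cW sw S s'.
move: (erefl s'); rewrite {2}/s' /c_mark /cseqs; cbn [foldr]; set c := nput aMK _ _ => s'E.
set s1 := for_st (ev c) 33 n s.
have r1 : rep s1 aMK S.
  suff H : forall u : 'I_n, (u < n)%N -> na s1 aMK u = (u \in S) by move=> u; apply: H.
  apply: (@for_ind (fun i s' => forall u : 'I_n, (u < i)%N -> na s' aMK u = (u \in S))) => //.
  move=> i s2 il s2i F IH u; have I2 : inputs s2 by apply: inputs_frame F _ I.
  rewrite ltnS leq_eqVlt => /orP[/eqP ui|ui]; last by rewrite /= s2i (ltn_eqF ui) ?andbF IH.
  rewrite /= s2i ui ?eqxx (fn F) // sv (in_L1 I2).
  rewrite (eq_bigr (fun t : 'I_m.*2.+1 => nat_of_bool (walk E D v w t == u))) => [|t _].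
    rewrite sum_indicator_gt0 inE -ui; case: ltnP => //= _; by case: existsP.
  rewrite updN_eq updN_neq // s2i -ui (fa F) //= sw; last by rewrite -ltnS.
  by rewrite -val_eqE /=; case: ltngtP.
have F1 : frame (33%N :: nmods c) (amods c) (cmods c) (camods c) s s1 by apply: for_frame.
have I1 : inputs s1 by apply: inputs_frame F1 _ I.
pose s2 := setn s1 23 #|S|.
pose s3 := setn s2 24 (set_code S).
have I3 : inputs s3 by do 2 apply: inputs_setn => //.
have e1 : nev (e_card aMK) s1 = #|S| by apply: rep_card.
have e2 : nev (nsum 40 vN (nif0 (narr aMK (nvar 40)) (narr aP2 (nvar 40)) (ncst 0))) s2 = set_code S.
  rewrite nev_nsum (in_n (inputs_setn _ _ I1 : inputs s2)) //; apply: eq_bigr => u _.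
  rewrite /= updN_eq r1.
  case: (u \in S) => //=; rewrite mul1n (in_P2 I1) //.
  by apply: leq_trans (ltnW (ltn_ord u)) (leq_addr _ _).
pose s4 := setn s3 26 (nev (nsum 40 vW (nite (nvar 40) (nvar 25)
  (neq (narr aSEEN (nvar 40)) (nvar 24) (ncst 1) (ncst 0)) (ncst 0))) s3).
have -> : s' = s4.
  rewrite s'E /s4 /s3 -e2 /s2 -e1 /s1 -(in_n I).
  by [].
split=> //.
rewrite [nv s4 26]/= /updN /= (in_W I1).
rewrite (eq_bigr (fun i : 'I_(D ^ m.*2) => nat_of_bool ((i < nv s 25)%N && (na s aSEEN i == set_code S)))) => [|i _].
  rewrite sum_indicator_gt0; apply/existsP/existsP => [[i /andP[ic ie]]|[i ie]].
    by exists (Ordinal ic).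
  by exists (widen_ord cW i); rewrite /= ltn_ord.
rewrite /updN /= (fn F1) // (fa F1) //.
by case: ltnP => //= _; case: ltngtP.
Qed.

End Program.

(** * Subsets and truncated polynomials *)

Section Clusters.
Variables (n k m Delta : nat) (E : {set {set 'I_n}}) (phi : {set 'I_n} -> {set 'I_n} -> CC).
Hypothesis sizeE : edge_size_le E k.
Local Notation inputs := (@inputs n k m Delta E phi).
Local Notation D := (Delta * k).+1.
Local Notation Z := (restr_poly (weight E phi)).

Lemma rep_frame mn ma mc mca s s' a (S : {set 'I_n}) : frame mn ma mc mca s s' ->
  a \notin ma -> rep s a S -> rep s' a S.
Proof. by move=> F aa r u; rewrite (fa F). Qed.

Lemma small_index_le s (S : {set 'I_n}) j : inputs s -> (#|S| <= m.*2.+1)%N -> (j < 2 ^ #|S|)%N -> (j <= nv s vX)%N.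
Proof.
move=> I Sm jS; rewrite (in_X I); apply: leq_trans (leq_addl _ _).
by apply: leq_trans (ltnW jS) _; rewrite leq_exp2l.
Qed.

Lemma c_subset_ok s src dst (S : {set 'I_n}) j : inputs s ->
  src \notin [:: aDIG; dst] -> dst \notin [:: aIN; aP2; aOFF; aPO; aDIG] ->
  rep s src S -> (#|S| <= m.*2.+1)%N -> nv s 20 = j -> (j < 2 ^ #|S|)%N ->
  rep (ev (c_subset src dst) s) dst (subset_of_index S j).
Proof.
rewrite !inE => I /norP[src8 srcd] dsts r Sm sj jS; rewrite /c_subset.
have dst8 : dst != aDIG by case/norP: dsts => _ /norP[_ /norP[_ /norP[]]].
set s1 := ev (c_digits 2 vL1) s.
have F1 : frame (nmods (c_digits 2 vL1)) (amods (c_digits 2 vL1)) [::] [::] s s1 by apply: ev_frame.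
have I1 : inputs s1 by apply: inputs_frame F1 _ I.
have dig t : (t < m.*2.+1)%N -> na s1 aDIG t = (j %/ 2 ^ t %% 2)%N.
  by move=> tm; rewrite -sj; apply: c_digits_ok => //; rewrite ?sj ?(in_L1 I) // (small_index_le I Sm).
have r1 : rep s1 src S.
  by apply: (rep_frame F1) r; rewrite /= !inE.
set c := nput dst _ _.
have -> : ev (cseq (c_digits 2 vL1) (cfor 33 vN c)) s = for_st (ev c) 33 n s1.
  by rewrite -(in_n I1).
suff H : forall u : 'I_n, (u < n)%N -> na (for_st (ev c) 33 n s1) dst u = (u \in subset_of_index S j).
  by move=> u; apply: H.
apply: (@for_ind (fun i s' => forall u : 'I_n, (u < i)%N ->
   na s' dst u = (u \in subset_of_index S j))) => //.
move=> i s' il s'i F IH u; rewrite ltnS leq_eqVlt => /orP[/eqP ui|ui]; last first.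
  by rewrite /= s'i (ltn_eqF ui) ?andbF IH.
have I' : inputs s'.
  by apply: inputs_frame F _ I1; move: dsts; rewrite /= !inE !andbT !negb_or => /and5P[-> -> -> ->].
have r' : rep s' src S by apply: (rep_frame F) r1; rewrite /= inE.
rewrite mem_subset_of_index /= s'i ui !eqxx /= -ui r'.
case: (boolP (u \in S)) => uS //=.
have -> : (\sum_(i0 < nv s' 0) (if updN (nv s') 40 i0 40 < updN (nv s') 40 i0 33 then na s' src (updN (nv s') 40 i0 40) else 0) = #|[set x in S | (x < u)%N]|)%N.
  rewrite (in_n I') -(sum_indicator (fun x => (x \in S) && (x < u)%N)).
  apply: eq_bigr => x _; rewrite updN_eq updN_neq // s'i -ui r' andbC.
  by case: ltnP => _ //=; case: (x \in S).
rewrite (fa F) ?inE 1?eq_sym //= dig ?modn2 //; apply: leq_trans Sm.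
rewrite -[#|S|]cardsE; apply: proper_card; apply/properP; split.
  by apply/subsetP => x; rewrite !inE => /andP[].
by exists u; rewrite !inE ?uS // ltnn andbF.
Qed.

Lemma nev_index s (W : {set 'I_n}) i : inputs s -> rep s aWB W -> i != 54%N -> (nv s i < #|E|)%N ->
  nev (e_index i) s = subset_index (edge E (nv s i)) W.
Proof.
move=> I r i54 iE; set e := edge E _.
have ek : (#|e| <= k)%N by rewrite sizeE ?edge_in.
rewrite /e_index nev_nsum (in_K I) /subset_index.
rewrite (big_ord_widen k (fun t => ((nth 0 [seq val u | u <- enum e] t \in [seq val u | u <- enum W]) * 2 ^ t)%N) ek).
rewrite [RHS]big_mkcond; apply: eq_bigr => t _ /=.
rewrite updN_eq !updN_neq // (in_size I iE) size_verts -/e; case: ltnP => // te.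
have tv : (t < size (verts E (nv s i)))%N by rewrite size_verts.
rewrite (in_vert I iE tv); have /mapP[x _ xE] := mem_nth 0%N tv.
rewrite -[[seq val u | u <- enum e]]/(verts E (nv s i)) xE r mem_val_enum (in_P2 I).
  by case: (x \in W); rewrite /= ?mul1n.
by rewrite (leq_trans (ltnW (leq_trans te ek))) // leq_addl.
Qed.

Lemma complexE (z : CC) : (complex.Re z)%:C%C + 'i%C * (complex.Im z)%:C%C = z.
Proof. by case: z => a b; apply/eqP; rewrite eq_complex /= ; apply/andP; split; apply/eqP; ring. Qed.

Lemma cev_weight s (W : {set 'I_n}) : inputs s -> rep s aWB W -> cev x_weight s = weight E phi W.
Proof.
move=> I r; rewrite /x_weight /weight.
have -> : \prod_(e in E) phi e (W :&: e) = \prod_(i < #|E|) phi (edge E i) (W :&: edge E i).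
  by rewrite -big_enum /= (big_nth set0) big_mkord -cardE.
set e1 := carr _ _; set e2 := carr _ _.
have -> : cev (cbig true 55 vE (cadd e1 (cmul (ccst 'i%C) e2))) s =
  \prod_(i < nv s vE) (cev e1 (setn s 55 i) + 'i%C * cev e2 (setn s 55 i)) by [].
rewrite (in_E I); apply: eq_bigr => i _.
have I1 : inputs (setn s 55 i) by apply: inputs_setn.
have ix : nev (e_index 55) (setn s 55 i) = subset_index (edge E i) W.
  by rewrite (nev_index (W := W)) //= updN_eq.
have [h1 h2] := in_phi I1 (ltn_ord i) (subset_index_lt (edge E i) W).
rewrite subset_indexK in h1 h2.
have pE : nev (e_phi 55) (setn s 55 i) = (na (setn s 55 i) aPO i + subset_index (edge E i) W)%N.
  by rewrite -ix /e_phi; move: (e_index 55) => ?; rewrite /= updN_eq.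
rewrite /e1 /e2; cbn [cev nev].
by rewrite !nev_nmulc pE h1 h2 complexE.
Qed.

Lemma c_poly_ok s (U : {set 'I_n}) : inputs s -> rep s aUB U -> nv s 29 = #|U| ->
  (#|U| <= m.*2.+1)%N -> forall d, (d <= m)%N -> ca (ev c_poly s) 3 d = (Z U)`_d.
Proof.
move=> I rU sU Um d dm.
rewrite /c_poly; set c0 := cfor 19 vM _; set c := cif _ _ _ _; set s1 := ev c0 s.
have F1 : frame (nmods c0) (amods c0) (cmods c0) (camods c0) s s1 by apply: ev_frame.
have I1 : inputs s1 by apply: inputs_frame F1 _ I.
have z1 t : (t <= m)%N -> ca s1 3 t = 0.
  rewrite -ltnS /s1 /c0; cbn [ev]; rewrite (in_M I); set c1 := fun s => _.
  move: t; apply: (@for_ind (fun i s' => forall t, (t < i)%N -> ca s' 3 t = 0)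
    (cput 3 (nvar 19) (ccst 0)) 19 m.+1) => //.
  move=> i s' il s'i F IH t; rewrite ltnS leq_eqVlt => /orP[/eqP->|ti] /=; first by rewrite s'i eqxx.
  by rewrite s'i (ltn_eqF ti) IH.
have P1 : na s1 aP2 #|U| = (2 ^ #|U|)%N.
  rewrite (in_P2 I1) // (leq_trans (max_card _)) // card_ord leq_addr //.
have QU : (2 ^ #|U| <= 2 ^ m.*2.+1)%N by rewrite leq_exp2l.
have -> : ev (cseq c0 (cfor 28 vQ c)) s = for_st (ev c) 28 (2 ^ m.*2.+1) s1.
  by rewrite -(in_Q I1).
pose w i := if (i < 2 ^ #|U|)%N then weight E phi (subset_of_index U i) *: 'X^#|subset_of_index U i| else 0.
have -> : (Z U)`_d = (\sum_(i < 2 ^ m.*2.+1) w i)`_d.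
  rewrite /restr_poly big_subset_of_index; congr (polyseq _)`_d.
  by rewrite (big_ord_widen _ (fun i => weight E phi (subset_of_index U i) *: 'X^#|subset_of_index U i|) QU) big_mkcond.
move: d dm.
apply: (@for_ind (fun i s' => forall d, (d <= m)%N -> ca s' 3 d = (\sum_(j < i) w j)`_d)).
  by move=> d dm; rewrite big_ord0 coef0; apply: z1.
move=> i s' il s'i F IH d dm; rewrite big_ord_recr coefD -(IH d dm) /w.
change (ca (ev c s') 3 d = ca s' 3 d + (if (i < 2 ^ #|U|)%N
  then weight E phi (subset_of_index U i) *: 'X^#|subset_of_index U i| else 0)`_d).
have I' : inputs s' by apply: inputs_frame F _ I1.
have P' : na s' aP2 (nv s' 29) = (2 ^ #|U|)%N.
  by rewrite (fa F) // (fn F) // (fn F1) // sU.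
have cond : ev c s' = if (i < 2 ^ #|U|)%N then ev (cseqs [:: nset 20 (nvar 28); c_subset aUB aWB; nset 30 (e_card aWB);
        cif (nvar 30) (nvar vM) (cput 3 (nvar 30) (cadd (carr 3 (nvar 30)) x_weight)) cskip]) s' else s'.
  by rewrite -P' -{1}s'i.
rewrite cond; case: ltnP => iU; last by rewrite coef0 addr0.
set W := subset_of_index U i; set s2 := setn s' 20 i; set s3 := ev (c_subset aUB aWB) s2.
have F3 : frame (nmods (c_subset aUB aWB)) (amods (c_subset aUB aWB)) [::] [::] s2 s3 by apply: ev_frame.
have I2 : inputs s2 by apply: inputs_setn.
have I3 : inputs s3 by apply: inputs_frame F3 _ I2.
have r2 : rep s2 aUB U by apply: (rep_frame F) => //; apply: (rep_frame F1).
have r3 : rep s3 aWB W by apply: c_subset_ok.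
set s4 := setn s3 30 #|W|.
have I4 : inputs s4 by apply: inputs_setn.
have -> : ev (cseqs [:: nset 20 (nvar 28); c_subset aUB aWB; nset 30 (e_card aWB);
        cif (nvar 30) (nvar vM) (cput 3 (nvar 30) (cadd (carr 3 (nvar 30)) x_weight)) cskip]) s' =
   if (nv s4 30 < nv s4 vM)%N then setca s4 3 #|W| (ca s4 3 #|W| + weight E phi W) else s4.
  rewrite -(cev_weight I4) // /s4 -(rep_card I3 r3) /s3 /s2 -s'i.
  by move: x_weight (c_subset _ _) => ? ?.
have c4 t : ca s4 3 t = ca s' 3 t by rewrite /s4 /= (fca F3).
rewrite (in_M I4) [nv s4 30]/= updN_eq coefZ coefXn ltnS; case: leqP => Wm.
  rewrite /= c4; have [->|dW] := eqVneq d #|W|; first by rewrite mulr1.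
  by rewrite mulr0 addr0 -c4.
by rewrite (_ : (d == #|W|) = false) ?mulr0 ?addr0 //; apply/negbTE; rewrite neq_ltn (leq_ltn_trans dm).
Qed.

Lemma c_mul_ok s A (p q : {poly CC}) : inputs s -> A \notin [:: 0; 3; 4]%N ->
  (forall d, (d <= m)%N -> ca s A d = p`_d) -> (forall d, (d <= m)%N -> ca s 3 d = q`_d) ->
  forall d, (d <= m)%N -> ca (ev (c_mul A) s) A d = (p * q)`_d.
Proof.
rewrite !inE => I /norP[A0 /norP[A3 A4]] sp sq.
rewrite /c_mul; set c1 := cput 4 _ _; set c2 := cput A _ _; set s1 := for_st (ev c1) 19 m.+1 s.
have F1 : frame (19%N :: nmods c1) (amods c1) (cmods c1) (camods c1) s s1 by apply: for_frame.
have I1 : inputs s1 by apply: inputs_frame F1 _ I.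
have h1 d : (d < m.+1)%N -> ca s1 4 d = (p * q)`_d.
  move: d; apply: (@for_ind (fun i s' => forall d, (d < i)%N -> ca s' 4 d = (p * q)`_d)) => //.
  move=> i s' il s'i F IH d; rewrite ltnS leq_eqVlt => /orP[/eqP->|ti]; last first.
    by rewrite /= s'i (ltn_eqF ti) IH.
  have I' : inputs s' by apply: inputs_frame F _ I.
  rewrite /= s'i eqxx /= (in_M I') coefM.
  rewrite (big_ord_widen m.+1 (fun j => p`_j * q`_(i - j)) il) [RHS]big_mkcond; apply: eq_bigr => j _.
  rewrite updN_eq updN_neq // s'i addn1; case: ltnP => // ji.
  have jm : (j <= m)%N by rewrite -ltnS.
  by rewrite !(fca F) ?inE ?A4 // sp // sq // (leq_trans (leq_subr _ _)).
have -> : ev (cseq (cfor 19 vM c1) (cfor 19 vM c2)) s = for_st (ev c2) 19 m.+1 s1.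
  have -> : ev (cseq (cfor 19 vM c1) (cfor 19 vM c2)) s = for_st (ev c2) 19 (nv (ev (cfor 19 vM c1) s) vM) (for_st (ev c1) 19 (nv s vM) s) by [].
  by rewrite (in_M I) ev_nframe // (in_M I).
suff : forall d, (d < m.+1)%N -> ca (for_st (ev c2) 19 m.+1 s1) A d = (p * q)`_d by [].
apply: (@for_ind (fun i s' => forall d, (d < i)%N -> ca s' A d = (p * q)`_d)) => //.
move=> i s' il s'i F IH d; rewrite ltnS leq_eqVlt => /orP[/eqP->|ti]; last first.
  by rewrite /= s'i (ltn_eqF ti) andbF IH.
by rewrite /= s'i !eqxx /= (fca F) ?inE 1?eq_sym // h1.
Qed.

End Clusters.

(** * Cluster products and the factor of a vertex *)

Section Vertices.
Variables (n k m Delta : nat) (E : {set {set 'I_n}}) (phi : {set 'I_n} -> {set 'I_n} -> CC).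
Hypothesis sizeE : edge_size_le E k.
Local Notation inputs := (@inputs n k m Delta E phi).
Local Notation D := (Delta * k).+1.
Local Notation Z := (restr_poly (weight E phi)).

Lemma prod_subset_of_index (S : {set 'I_n}) (P : pred {set 'I_n}) (f : {set 'I_n} -> {poly CC}) q :
  (2 ^ #|S| <= q)%N ->
  \prod_(U : {set 'I_n} | (U \subset S) && P U) f U =
  \prod_(j < q) if (j < 2 ^ #|S|)%N && P (subset_of_index S j) then f (subset_of_index S j) else 1.
Proof.
move=> qS; rewrite big_mkcondr big_subset_of_index.
rewrite (big_ord_widen q (fun j => if P (subset_of_index S j) then f (subset_of_index S j) else 1) qS).
rewrite big_mkcond; apply: eq_bigr => j _.
by case: ltnP.
Qed.

Lemma c_cluster_step s (S : {set 'I_n}) (p q : {poly CC}) j : inputs s ->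
  rep s aMK S -> nv s 23 = #|S| -> (#|S| <= m.*2.+1)%N -> nv s 27 = j -> (j < 2 ^ #|S|)%N ->
  (forall d, (d <= m)%N -> ca s 1 d = p`_d) -> (forall d, (d <= m)%N -> ca s 2 d = q`_d) ->
  let U := subset_of_index S j in
  let s' := ev (cseqs [:: nset 20 (nvar 27); c_subset aMK aUB; nset 29 (e_card aUB); c_poly;
       nset 20 (nsub (nvar 23) (nvar 29));
       nset 31 (nsub (nvar 20) (nmulc 2 (ndivc 2 20)));
       cif0 (nvar 31) (c_mul 2) (c_mul 1)]) s in
  (forall d, (d <= m)%N -> ca s' 1 d = (p * if ~~ odd #|S :\: U| then Z U else 1)`_d) /\
  (forall d, (d <= m)%N -> ca s' 2 d = (q * if odd #|S :\: U| then Z U else 1)`_d).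
Proof.
move=> I r sS Sm sj jS sp sq U.
set s2 := setn s 20 j; have I2 : inputs s2 by apply: inputs_setn.
set s3 := ev (c_subset aMK aUB) s2.
have F3 : frame (nmods (c_subset aMK aUB)) (amods (c_subset aMK aUB)) [::] [::] s2 s3 by apply: ev_frame.
have I3 : inputs s3 by apply: inputs_frame F3 _ I2.
have r2 : rep s2 aMK S by [].
have r3 : rep s3 aUB U by apply: (c_subset_ok I2).
set s4 := setn s3 29 #|U|; have I4 : inputs s4 by apply: inputs_setn.
set s5 := ev c_poly s4.
have US : U \subset S by apply: subset_of_index_sub.
have Um : (#|U| <= m.*2.+1)%N by apply: leq_trans Sm; apply: subset_leq_card.
have P5 := c_poly_ok sizeE I4 (r3 : rep s4 aUB U) (erefl : nv s4 29 = #|U|) Um.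
have F5 : frame (nmods c_poly) (amods c_poly) (cmods c_poly) (camods c_poly) s4 s5 by apply: ev_frame.
have I5 : inputs s5 by apply: inputs_frame F5 _ I4.
rewrite -/s5 in P5.
set x := #|S :\: U|.
have xE : (nv s5 23 - nv s5 29 = x)%N.
  have -> : nv s5 29 = #|U| by rewrite (fn F5).
  rewrite (fn F5) //; change (nv s3 23 - #|U| = x)%N; rewrite (fn F3) //.
  by change (nv s 23 - #|U| = x)%N; rewrite sS /x cardsD (setIidPr US).
set s6 := setn s5 20 x; have I6 : inputs s6 by apply: inputs_setn.
have x31 : nev (nsub (nvar 20) (nmulc 2 (ndivc 2 20))) s6 = odd x.
  cbn [nev]; rewrite nev_nmulc nev_ndivc //.
    by rewrite [nv s6 20]/= updN_eq {1}(divn_eq x 2) modn2 mulnC addKn.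
  rewrite (in_X I6) [nv s6 20]/= updN_eq; apply: leq_trans (leq_addl _ _).
  apply: leq_trans (leq_div _ _) _.
  have : (x <= m.*2.+1)%N by apply: leq_trans Sm; apply: subset_leq_card; apply: subsetDl.
  by move/leq_trans; apply; apply: ltnW; apply: ltn_expl.
set s7 := setn s6 31 (odd x); have I7 : inputs s7 by apply: inputs_setn.
set c := cseqs _.
have -> : ev c s = if (0 < odd x)%N then ev (c_mul 2) s7 else ev (c_mul 1) s7.
  rewrite -[RHS]/(ev (cif0 (nvar 31) (c_mul 2) (c_mul 1)) s7) /s7 -x31 /s6 -xE /s5 /s4.
  by rewrite -(rep_card I3 r3) /s3 /s2 -sj /c; move: c_poly (c_subset _ _) (c_mul _) (c_mul _) => ? ? ? ?.
have c7 a t : a \in [:: 1; 2]%N -> ca s7 a t = ca s a t.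
  move=> aa; have h5 : ca s5 a t = ca s4 a t.
    by apply: (fca F5); move: aa; rewrite !inE; case/orP => /eqP->.
  have h3 : ca s3 a t = ca s2 a t by apply: (fca F3).
  exact: etrans h5 h3.
have q3 d : (d <= m)%N -> ca s7 3 d = (Z U)`_d by move=> dm; rewrite -P5.
have Fm a : frame (nmods (c_mul a)) (amods (c_mul a)) (cmods (c_mul a)) (camods (c_mul a)) s7 (ev (c_mul a) s7).
  exact: ev_frame.
rewrite lt0b /=; case: (odd x); split=> d dm /=.
- by rewrite (fca (Fm 2%N)) // c7 // mulr1 sp.
- by apply: (c_mul_ok I7) => // t tm; rewrite c7 // sq.
- by apply: (c_mul_ok I7) => // t tm; rewrite c7 // sp.
by rewrite (fca (Fm 1%N)) // c7 // mulr1 sq.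
Qed.

Lemma c_cluster_ok s (S : {set 'I_n}) (p q : {poly CC}) : inputs s ->
  rep s aMK S -> nv s 23 = #|S| -> (#|S| <= m.*2.+1)%N ->
  (forall d, (d <= m)%N -> ca s 1 d = p`_d) -> (forall d, (d <= m)%N -> ca s 2 d = q`_d) ->
  (forall d, (d <= m)%N -> ca (ev c_cluster s) 1 d = (p * even_prod Z S)`_d) /\
  (forall d, (d <= m)%N -> ca (ev c_cluster s) 2 d = (q * odd_prod Z S)`_d).
Proof.
move=> I r sS Sm sp sq; rewrite /c_cluster; set b := cseqs _; set c := cif _ _ _ _.
have QS : (2 ^ #|S| <= 2 ^ m.*2.+1)%N by rewrite leq_exp2l.
rewrite /even_prod /odd_prod !(prod_subset_of_index _ _ QS).
have -> : ev (cfor 27 vQ c) s = for_st (ev c) 27 (2 ^ m.*2.+1) s by rewrite -(in_Q I).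
pose a j := if (j < 2 ^ #|S|)%N && ~~ odd #|S :\: subset_of_index S j| then Z (subset_of_index S j) else 1.
pose b' j := if (j < 2 ^ #|S|)%N && odd #|S :\: subset_of_index S j| then Z (subset_of_index S j) else 1.
have aS i : \prod_(j < i.+1) a j = \prod_(j < i) a j * a i by exact: big_ord_recr.
have bS i : \prod_(j < i.+1) b' j = \prod_(j < i) b' j * b' i by exact: big_ord_recr.
apply: (@for_ind (fun i s' =>
  (forall d, (d <= m)%N -> ca s' 1 d = (p * \prod_(j < i) a j)`_d) /\
  (forall d, (d <= m)%N -> ca s' 2 d = (q * \prod_(j < i) b' j)`_d))).
  by split=> d dm; rewrite big_ord0 mulr1 ?sp ?sq.
move=> i s' il s'i F [IH1 IH2].
have I' : inputs s' by apply: inputs_frame F _ I.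
have S' : nv s' 23 = #|S| by rewrite (fn F).
have P' : na s' aP2 (nv s' 23) = (2 ^ #|S|)%N.
  by rewrite S' (in_P2 I') // (leq_trans (max_card _)) // card_ord leq_addr.
have -> : ev c s' = if (i < 2 ^ #|S|)%N then ev b s' else s' by rewrite -P' -{1}s'i.
rewrite aS bS {2}/a {2}/b'; case: ltnP => iS; last by rewrite !mulr1; split.
have r' : rep s' aMK S by apply: (rep_frame F).
have [h1 h2] := c_cluster_step I' r' S' Sm s'i iS IH1 IH2.
by rewrite !mulrA; split=> d dm; [apply: h1|apply: h2].
Qed.

(** A set of sets, so that a set reached by several walks counts once; at [w = D ^ m.*2] it is the
    family of [visited_congruence]. *)
Definition seen_sets (v : 'I_n) w : {set {set 'I_n}} := [set visited E D v (i : 'I_w) m.*2 | i : 'I_w].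

Lemma seen_sets0 v : seen_sets v 0 = set0.
Proof. by apply/setP => S; rewrite inE; apply/imsetP => -[[]]. Qed.

Lemma seen_setsS v w : seen_sets v w.+1 = visited E D v w m.*2 |: seen_sets v w.
Proof.
apply/setP => S; rewrite !inE; apply/imsetP/orP => [[i _ ->]|[/eqP->|/imsetP[i _ ->]]].
- have := ltn_ord i; rewrite ltnS leq_eqVlt => /orP[/eqP->|iw]; first by left.
  by right; apply/imsetP; exists (Ordinal iw).
- by exists ord_max.
by exists (widen_ord (leqnSn w) i).
Qed.

Lemma card_visited v w : (#|visited E D v w m.*2| <= m.*2.+1)%N.
Proof.
apply: leq_trans (_ : #|[set walk E D v w (i : 'I_m.*2.+1) | i : 'I_m.*2.+1]| <= _)%N.
  apply/subset_leq_card/subsetP => u; rewrite inE => /andP[_ /existsP[i /eqP <-]].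
  exact: imset_f.
by apply: leq_trans (leq_imset_card _ _) _; rewrite card_ord.
Qed.

(** The bound of variable 25 by [w] keeps the table within the [vW] entries that [c_mark]
    searches. *)
Definition word_inv (v : 'I_n) (w : nat) (s : st) :=
  [/\ (nv s 25 <= w)%N,
      forall S, [exists i : 'I_(nv s 25), na s aSEEN i == set_code S] = (S \in seen_sets v w),
      forall d, (d <= m)%N -> ca s 1 d = (\prod_(S in seen_sets v w) even_prod Z S)`_d &
      forall d, (d <= m)%N -> ca s 2 d = (\prod_(S in seen_sets v w) odd_prod Z S)`_d].

Lemma c_word_ok s (v : 'I_n) w : (0 < Delta)%N -> (0 < k)%N -> inputs s -> nv s 16 = v -> nv s 17 = w ->
  (w < D ^ m.*2)%N -> word_inv v w s -> word_inv v w.+1 (ev (c_word D) s).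
Proof.
move=> D0 k0 I sv sw wW [cw seen se so].
set S := visited E D v w m.*2.
set s2 := ev (c_digits D vL) (setn s 20 w).
have F2 : frame (20%N :: nmods (c_digits D vL)) (amods (c_digits D vL)) [::] [::] s s2.
  have [f1 f2 f3 f4] := ev_frame (c_digits D vL) (setn s 20 w).
  split=> // z; rewrite inE negb_or => /andP[z20 zd].
  by rewrite f1 //= updN_neq.
have I2 : inputs s2 by apply: inputs_frame F2 _ I.
have dig t : (t < m.*2)%N -> na s2 aDIG t = digit D w t.
  move=> tm; rewrite /s2 c_digits_ok //=; rewrite ?updN_eq ?updN_neq ?(in_L I) ?(in_X I) //.
    by rewrite ltnS muln_gt0 D0.
  exact: leq_trans (ltnW wW) (leq_addr _ _).
have v2 : nv s2 16 = v by rewrite (fn F2).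
set s3 := ev c_walk s2.
have F3 : frame (nmods c_walk) (amods c_walk) [::] [::] s2 s3 by apply: ev_frame.
have I3 : inputs s3 by apply: inputs_frame F3 _ I2.
have pw := c_walk_ok sizeE I2 v2 dig.
have v3 : nv s3 16 = v by rewrite (fn F3).
have c3 : nv s3 25 = nv s 25 by rewrite (fn F3) // (fn F2).
set s4 := ev c_mark s3.
have F4 : frame (nmods c_mark) (amods c_mark) [::] [::] s3 s4 by apply: ev_frame.
have I4 : inputs s4 by apply: inputs_frame F4 _ I3.
have [] := c_mark_ok I3 v3 _ pw; first by rewrite c3 (leq_trans cw) // ltnW.
rewrite -/s4 -/S => r4 S4 code4 found4.
have a4 z i : z \in [:: aSEEN] -> na s4 z i = na s z i.
  by rewrite inE => /eqP->; rewrite (fa F4) // (fa F3) // (fa F2).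
have c4 : nv s4 25 = nv s 25 by rewrite (fn F4) // c3.
have e4 z i : ca s4 z i = ca s z i by rewrite (fca F4) // (fca F3) // (fca F2).
have found : (0 < nv s4 26)%N = (S \in seen_sets v w).
  rewrite found4 c3 -seen; apply: eq_existsb => i.
  by rewrite (fa F3) // (fa F2).
set s5 := setn (setna s4 aSEEN (nv s 25) (set_code S)) 25 (nv s 25).+1.
have -> : ev (c_word D) s = if (0 < nv s4 26)%N then s4 else ev c_cluster s5.
  have -> : ev (c_word D) s = if (0 < nv s4 26)%N then s4 else
      ev c_cluster (setn (setna s4 aSEEN (nv s4 25) (nv s4 24)) 25 (nv s4 25 + 1)%N).
    by rewrite /c_word /s4 /s3 /s2 -sw; move: (c_digits D vL) c_walk c_mark c_cluster => ? ? ? ?.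
  by rewrite c4 code4 addn1.
rewrite found; case: (boolP (S \in _)) => Sw.
  have sS : seen_sets v w.+1 = seen_sets v w.
    by rewrite seen_setsS; apply/setUidPr; rewrite sub1set.
  split; rewrite ?sS.
  - by rewrite c4 ltnW // ltnS.
  - by move=> T; rewrite -seen c4; apply: eq_existsb => i; rewrite a4.
  - by move=> d dm; rewrite e4 se.
  by move=> d dm; rewrite e4 so.
have I5 : inputs s5.
  apply: inputs_setn => //.
  apply: (@inputs_frame _ _ _ _ _ _ [::] [:: aSEEN] [::] [::] s4) => //; split=> // z i.
  by rewrite inE => /negbTE zx /=; rewrite zx.
have r5 : rep s5 aMK S by move=> u; rewrite -r4.
have [h1 h2] := c_cluster_ok I5 r5 (S4 : nv s5 23 = #|S|) (card_visited v w) (fun d dm => etrans (e4 1%N d) (se d dm)) (fun d dm => etrans (e4 2%N d) (so d dm)).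
have F6 : frame (nmods c_cluster) (amods c_cluster) (cmods c_cluster) (camods c_cluster) s5 (ev c_cluster s5).
  exact: ev_frame.
have c6 : nv (ev c_cluster s5) 25 = (nv s 25).+1 by rewrite (fn F6).
have a6 i : na (ev c_cluster s5) aSEEN i = if i == nv s 25 then set_code S else na s aSEEN i.
  by rewrite (fa F6) //= a4.
split.
- by rewrite c6 ltnS.
- move=> T; rewrite seen_setsS in_setU1 -seen c6; apply/existsP/orP => [[ i ]|[/eqP->|/existsP[ i ]]].
  + rewrite a6; case: (val i =P nv s 25) => [_ /eqP sc|/eqP ni iT].
      by left; rewrite -(@set_code_inj _ _ _ sc).
    right; apply/existsP.
    have il : (i < nv s 25)%N by rewrite ltn_neqAle ni -ltnS ltn_ord.
    by exists (Ordinal il).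
  + by exists ord_max; rewrite a6 /= eqxx.
  by move=> iT; exists (widen_ord (leqnSn _) i); rewrite a6 /= (ltn_eqF (ltn_ord i)).
- by move=> d dm; rewrite h1 // seen_setsS big_setU1 //= mulrC.
by move=> d dm; rewrite h2 // seen_setsS big_setU1 //= mulrC.
Qed.

(** The linear system for the coefficients of the quotient is triangular with diagonal 1. *)
Lemma eqmX_quotient M (p q f : {poly CC}) : p`_0 = 1 ->
  (forall i, (i < M)%N -> f`_i = q`_i - \sum_(j < i) p`_(i - j) * f`_j) -> eqmX M (p * f) q.
Proof.
move=> p0 fE i iM; rewrite coefMr big_ord_recr /= subnn p0 mul1r (fE i iM).
by rewrite addrC subrK.
Qed.

Lemma prod_if_lt (a : CC) i M : (i <= M)%N -> \prod_(j < M) (if (j < i)%N then a else 1) = a ^+ i.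
Proof.
by move=> iM; rewrite -big_mkcond -(big_ord_widen M (fun=> a) iM) prodr_const card_ord.
Qed.

Lemma c_vertex_ok s (v : 'I_n) lam mu : (0 < Delta)%N -> (0 < k)%N -> normalized_activities E phi ->
  inputs s -> nv s 16 = v ->
  exists2 f : {poly CC},
    eqmX m.+1 (\prod_(S in seen_sets v (D ^ m.*2)) odd_prod Z S * f)
              (\prod_(S in seen_sets v (D ^ m.*2)) even_prod Z S) &
    cv (ev (c_vertex D lam mu) s) 4 = cv s 4 * (mu * \sum_(i < m.+1) f`_i * lam ^+ i).
Proof.
move=> D0 k0 nor I sv; set Od := \prod_(S in _) odd_prod Z S; set Ev := \prod_(S in _) even_prod Z S.
rewrite /c_vertex; set c1 := cseq (cput 1 _ _) _; set c3 := cput 5 _ _; set e4 := cbig false 44 vM (cmul _ _).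
set s1 := for_st (ev c1) 19 m.+1 s.
have F1 : frame (19%N :: nmods c1) (amods c1) (cmods c1) (camods c1) s s1 by apply: for_frame.
have I1 : inputs s1 by apply: inputs_frame F1 _ I.
have h1 : forall d, (d < m.+1)%N -> ca s1 1 d = (d == 0)%:R /\ ca s1 2 d = (d == 0)%:R.
  apply: (@for_ind (fun i s' => forall d, (d < i)%N -> ca s' 1 d = (d == 0)%:R /\ ca s' 2 d = (d == 0)%:R)) => //.
  move=> i s' il s'i F IH d; rewrite ltnS leq_eqVlt => /orP[/eqP->|ti] /=; rewrite s'i.
    by rewrite !eqxx; case: (i).
  by rewrite (ltn_eqF ti); apply: IH.
pose s2 := setn s1 25 0.
have I2 : inputs s2 by apply: inputs_setn.
have F2 : frame (25%N :: 19%N :: nmods c1) (amods c1) (cmods c1) (camods c1) s s2.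
  have [f1 f2 f3 f4] := F1; split=> // z; rewrite inE negb_or => /andP[z25 zc].
  by rewrite -f1 // /s2 /= updN_neq.
set s3 := for_st (ev (c_word D)) 17 (D ^ m.*2) s2.
have F3 : frame (17%N :: nmods (c_word D)) (amods (c_word D)) (cmods (c_word D)) (camods (c_word D)) s2 s3 by apply: for_frame.
have I3 : inputs s3 by apply: inputs_frame F3 _ I2.
have [_ _ se so] : word_inv v (D ^ m.*2) s3.
  apply: (@for_ind (fun i s' => word_inv v i s')).
    split=> //.
    - by move=> S; rewrite seen_sets0 inE; apply/existsP => -[[]].
    - by move=> d dm; rewrite seen_sets0 big_set0 coef1; apply: (h1 d _).1.
    by move=> d dm; rewrite seen_sets0 big_set0 coef1; apply: (h1 d _).2.
  move=> i s' il s'i F inv.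
  have I' : inputs s' by apply: inputs_frame F _ I2.
  have v' : nv s' 16 = v by rewrite (fn F) // (fn F2).
  exact: c_word_ok I' v' s'i il inv.
have O0 : Od`_0 = 1.
  by apply: coef0_prod1 => S _; apply: coef0_prod1 => U _; apply/restr_poly_coef0/weight0.
set s4 := for_st (ev c3) 19 m.+1 s3.
have F4 : frame (19%N :: nmods c3) (amods c3) (cmods c3) (camods c3) s3 s4 by apply: for_frame.
have I4 : inputs s4 by apply: inputs_frame F4 _ I3.
have h4 : forall d, (d < m.+1)%N -> ca s4 5 d = Ev`_d - \sum_(j < d) Od`_(d - j) * ca s4 5 j.
  apply: (@for_ind (fun i s' => forall d, (d < i)%N -> ca s' 5 d = Ev`_d - \sum_(j < d) Od`_(d - j) * ca s' 5 j)) => //.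
  move=> i s' il s'i F IH d; rewrite ltnS leq_eqVlt => /orP[/eqP->|ti]; last first.
    rewrite /= s'i (ltn_eqF ti) IH //; congr (_ - _); apply: eq_bigr => j _.
    by rewrite (ltn_eqF (ltn_trans (ltn_ord j) ti)).
  have I' : inputs s' by apply: inputs_frame F _ I3.
  rewrite /= s'i eqxx /= (fca F) // se // (in_M I'); congr (_ - _).
  rewrite [RHS](big_ord_widen m.+1 (fun j => Od`_(i - j) * (if j == i then _ else ca s' 5 j)) (ltnW il)).
  rewrite [RHS]big_mkcond; apply: eq_bigr => j _.
  rewrite updN_eq updN_neq // s'i; case: ltnP => // ji.
  by rewrite (ltn_eqF ji) (fca F) // so // (leq_trans (leq_subr _ _)).
pose f := \poly_(i < m.+1) ca s4 5 i.
have fE i : (i < m.+1)%N -> f`_i = ca s4 5 i by move=> im; rewrite coef_poly im.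
exists f.
  apply: eqmX_quotient => // i im; rewrite fE // h4 //; congr (_ - _).
  by apply: eq_bigr => j _; rewrite fE // (ltn_trans (ltn_ord j)).
have -> : ev (cseqs [:: cfor 19 vM c1; nset 25 (ncst 0); cfor 17 vW (c_word D); cfor 19 vM c3;
     cset 4 (cmul (cvar 4) (cmul (ccst mu) e4))]) s = setc s4 4 (cv s4 4 * (mu * cev e4 s4)).
  have -> : ev (cseqs [:: cfor 19 vM c1; nset 25 (ncst 0); cfor 17 vW (c_word D); cfor 19 vM c3;
     cset 4 (cmul (cvar 4) (cmul (ccst mu) e4))]) s =
     ev (cset 4 (cmul (cvar 4) (cmul (ccst mu) e4))) (ev (cfor 19 vM c3) (ev (cfor 17 vW (c_word D))
       (ev (nset 25 (ncst 0)) (ev (cfor 19 vM c1) s)))) by [].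
  have -> : ev (cfor 19 vM c1) s = s1 by rewrite /s1 -(in_M I).
  have -> : ev (nset 25 (ncst 0)) s1 = s2 by [].
  have -> : ev (cfor 17 vW (c_word D)) s2 = s3 by rewrite /s3 -(in_W I2).
  have -> : ev (cfor 19 vM c3) s3 = s4 by rewrite /s4 -(in_M I3).
  by [].
have -> : cev e4 s4 = \sum_(i < m.+1) f`_i * lam ^+ i.
  have -> : cev e4 s4 = \sum_(i < nv s4 vM) ca s4 5 i *
    \prod_(j < nv s4 vM) (if (j < i)%N then lam else 1) by [].
  rewrite (in_M I4); apply: eq_bigr => i _.
  by rewrite fE // prod_if_lt // ltnW.
move: (mu * _) => x; change (cv s4 4 * x = cv s 4 * x).
by rewrite (fc F4) // (fc F3) // (fc F2).
Qed.

End Vertices.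

Lemma nth_flatten_block (T : Type) (x0 : T) (ss : seq (seq T)) i t :
  (i < size ss)%N -> (t < size (nth [::] ss i))%N ->
  nth x0 (flatten ss) (\sum_(j < i) size (nth [::] ss j) + t) = nth x0 (nth [::] ss i) t /\
  (\sum_(j < i) size (nth [::] ss j) + t < size (flatten ss))%N.
Proof.
elim: ss i t => //= b ss IH [|i] t /= it tb.
  by rewrite big_ord0 add0n nth_cat tb size_cat (leq_trans tb) ?leq_addr.
have [h1 h2] := IH i t it tb.
rewrite big_ord_recl /= -addnA nth_cat size_cat ltn_add2l ltnNge leq_addr /= addKn.
by split.
Qed.

(** * Parsing and the loop over the vertices *)

Section Main.
Variables (n k m Delta : nat) (E : {set {set 'I_n}}) (phi : {set 'I_n} -> {set 'I_n} -> CC).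
Hypothesis sizeE : edge_size_le E k.
Variables (lam0 : CC) (eps : RR).
Local Notation inputs := (@inputs n k m Delta E phi).
Local Notation D := (Delta * k).+1.
Local Notation Z := (restr_poly (weight E phi)).
Local Notation edge := (edge E).
Local Notation verts := (verts E).

Definition edge_offset i := (2 + \sum_(j < i) (size (verts j)).+1)%N.
Definition phi_offset i := (\sum_(j < i) 2 ^ #|edge j|)%N.

Lemma nth_encode_nat i t : (i < #|E|)%N -> (t <= size (verts i))%N ->
  nth 0%N (encode_nat E) (edge_offset i + t) = nth 0%N (size (verts i) :: verts i) t /\
  (edge_offset i + t < size (encode_nat E))%N.
Proof.
move=> iE tv; rewrite /encode_nat /edge_offset -addnA /= ltnS ltnS.
set ss := [seq _ | e <- enum E].
have bl j : (j < #|E|)%N -> nth [::] ss j = size (verts j) :: verts j.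
  by move=> jE; rewrite (nth_map set0) -?cardE // size_verts.
have -> : (\sum_(j < i) (size (verts j)).+1 = \sum_(j < i) size (nth [::] ss j))%N.
  by apply: eq_bigr => j _; rewrite bl // (ltn_trans (ltn_ord j)).
by rewrite -bl //; apply: nth_flatten_block; rewrite ?bl ?size_map -?cardE.
Qed.

Lemma nth_encode_real i j b : (i < #|E|)%N -> (j < 2 ^ #|edge i|)%N ->
  let p := (3 + (2 * (phi_offset i + j) + b))%N in let z := phi (edge i) (subset_of_index (edge i) j) in
  (b < 2)%N -> nth 0 (encode_real E phi lam0 eps) p = nth 0 [:: complex.Re z; complex.Im z] b /\
  (p < size (encode_real E phi lam0 eps))%N.
Proof.
move=> iE je p z b2; rewrite {}/p /encode_real; set q := (2 * _ + b)%N.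
have skip3 (T : Type) (x y0 y1 y2 : T) l r : nth x ([:: y0; y1; y2] ++ l) (3 + r)%N = nth x l r.
  by [].
have size3 (T : Type) (y0 y1 y2 : T) l r : (3 + r < size ([:: y0; y1; y2] ++ l))%N = (r < size l)%N.
  by [].
rewrite skip3 size3 {skip3 size3}; set ss := [seq _ | e <- enum E].
pose g (e : {set 'I_n}) := [seq [:: complex.Re (phi e (subset_of_index e j));
  complex.Im (phi e (subset_of_index e j))] | j <- iota 0 (2 ^ #|e|)].
have bl l : (l < #|E|)%N -> nth [::] ss l = flatten (g (edge l)).
  by move=> lE; rewrite (nth_map set0) -?cardE.
have ng (e : {set 'I_n}) l : (l < 2 ^ #|e|)%N -> nth [::] (g e) l =
    [:: complex.Re (phi e (subset_of_index e l)); complex.Im (phi e (subset_of_index e l))].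
  by move=> le; rewrite (nth_map 0%N) ?size_iota // nth_iota.
have sg (e : {set 'I_n}) : size (flatten (g e)) = (2 * 2 ^ #|e|)%N.
  rewrite size_flatten sumnE big_map /g big_map /= (eq_bigr (fun=> 2%N)) //.
  by rewrite big_const_seq count_predT size_iota iter_addn addn0.
have -> : q = (\sum_(l < i) size (nth [::] ss l) + (\sum_(l < j) size (nth [::] (g (edge i)) l) + b))%N.
  rewrite /q mulnDr -addnA /phi_offset big_distrr /=; congr (_ + (_ + _))%N.
    by apply: eq_bigr => l _; rewrite bl ?sg // (ltn_trans (ltn_ord l)).
  rewrite (eq_bigr (fun=> 2%N)) ?sum_nat_const ?card_ord 1?mulnC // => l _.
  by rewrite ng // (ltn_trans (ltn_ord l)).
have gj : (j < size (g (edge i)))%N by rewrite size_map size_iota.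
have bj : (b < size (nth [::] (g (edge i)) j))%N by rewrite ng.
have [h1 h2] := nth_flatten_block 0 gj bj.
have si : (i < size ss)%N by rewrite size_map -cardE.
have bi : (\sum_(l < j) size (nth [::] (g (edge i)) l) + b < size (nth [::] ss i))%N by rewrite bl.
by have [-> ->] := nth_flatten_block 0 si bi; rewrite bl // h1 ng.
Qed.

Record loaded (s : st) : Prop := Loaded {
  ld_n : nv s vN = n; ld_E : nv s vE = #|E|; ld_K : nv s vK = k; ld_M : nv s vM = m.+1;
  ld_L : nv s vL = m.*2; ld_L1 : nv s vL1 = m.*2.+1; ld_W : nv s vW = (D ^ m.*2)%N;
  ld_Q : nv s vQ = (2 ^ m.*2.+1)%N; ld_X : nv s vX = (D ^ m.*2 + 2 ^ m.*2.+1)%N;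
  ld_P : nv s vP = (n + k)%N;
  ld_in : forall i, (2 <= i < size (encode_nat E))%N -> na s aIN i = nth 0%N (encode_nat E) i;
  ld_rin : forall i, (2 <= i < size (encode_real E phi lam0 eps))%N ->
    ca s 0 i = (nth 0 (encode_real E phi lam0 eps) i)%:C%C }.

Lemma c_parse_ok s : loaded s -> inputs (ev c_parse s).
Proof.
move=> [l0 l1 l2 l3 l4 l5 l6 l7 l8 l9 lin lrin].
rewrite /c_parse; set c1 := nput aP2 (nadd _ _) _; set c2 := cseq (nput aOFF (nadd _ _) _) _.
set s1 := setna s aP2 0 1; set s2 := for_st (ev c1) 19 (n + k) s1.
set s3 := setna (setna s2 aOFF 0 2) aPO 0 0; set s4 := for_st (ev c2) 19 #|E| s3.
have -> : ev (cseqs [:: nput aP2 (ncst 0) (ncst 1); cfor 19 vP c1; nput aOFF (ncst 0) (ncst 2);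
    nput aPO (ncst 0) (ncst 0); cfor 19 vE c2]) s = s4.
  have -> : ev (cseqs [:: nput aP2 (ncst 0) (ncst 1); cfor 19 vP c1; nput aOFF (ncst 0) (ncst 2);
    nput aPO (ncst 0) (ncst 0); cfor 19 vE c2]) s =
     for_st (ev c2) 19 (nv (for_st (ev c1) 19 (nv s1 vP) s1) vE)
       (setna (setna (for_st (ev c1) 19 (nv s1 vP) s1) aOFF 0 2) aPO 0 0) by [].
  by rewrite [nv s1 vP]l9 (fn (for_frame _ _ _ _)) // [nv s1 vE]l1.
have F2 : frame (19%N :: nmods c1) (amods c1) (cmods c1) (camods c1) s1 s2 by apply: for_frame.
have F4 : frame (19%N :: nmods c2) (amods c2) (cmods c2) (camods c2) s3 s4 by apply: for_frame.
have p2 : forall i, (i <= n + k)%N -> na s2 aP2 i = (2 ^ i)%N.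
  apply: (@for_ind (fun j s' => forall i, (i <= j)%N -> na s' aP2 i = (2 ^ i)%N)).
    by move=> i; rewrite leqn0 => /eqP->.
  move=> j s' jl s'j F IH i; rewrite leq_eqVlt => /orP[/eqP->|ij] /=; rewrite s'j addn1.
    by rewrite eqxx IH // expnS mul2n addnn.
  by rewrite (ltn_eqF ij) IH.
have vs z : z \in [:: 0; 1; 2; 3; 4; 5; 6; 7; 8; 9]%N -> nv s4 z = nv s z.
  move=> zz; have z19 : z \notin [:: 19%N] by move: zz; rewrite !inE; do 9 case/orP => [/eqP->//|]; move/eqP->.
  by rewrite (fn F4) // -[RHS]/(nv s1 z) -(fn F2).
have in3 i : na s3 aIN i = na s aIN i by apply: (fa F2).
have in4 i : na s4 aIN i = na s aIN i by rewrite (fa F4) // in3.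
have p24 i : na s4 aP2 i = na s2 aP2 i by rewrite (fa F4).
have [off po] : (forall i, (i <= #|E|)%N -> na s4 aOFF i = edge_offset i) /\ (forall i, (i <= #|E|)%N -> na s4 aPO i = phi_offset i).
  apply: (@for_ind (fun j s' => (forall i, (i <= j)%N -> na s' aOFF i = edge_offset i) /\ (forall i, (i <= j)%N -> na s' aPO i = phi_offset i))).
    by split=> i; rewrite leqn0 => /eqP->; rewrite /edge_offset /phi_offset big_ord0.
  move=> j s' jl s'j F [IH1 IH2].
  have [x1 x2] := nth_encode_nat jl (leq0n _); rewrite addn0 in x1 x2.
  have sz : na s' aIN (na s' aOFF j) = size (verts j).
    rewrite IH1 // (fa F) // in3 lin; first by rewrite x1.
    by rewrite x2 leq_addr.
  have P2j : na s' aP2 (size (verts j)) = (2 ^ size (verts j))%N.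
    rewrite (fa F) //; apply: p2; apply: leq_trans (size_verts_le sizeE jl) (leq_addl _ _).
  have -> : ev c2 s' = setna (setna s' aOFF (nv s' 19 + 1)%N (na s' aOFF (nv s' 19) + na s' aIN (na s' aOFF (nv s' 19)) + 1)%N)
     aPO (nv s' 19 + 1)%N (na s' aPO (nv s' 19) + na (setna s' aOFF (nv s' 19 + 1)%N (na s' aOFF (nv s' 19) + na s' aIN (na s' aOFF (nv s' 19)) + 1)%N) aP2
       (na s' aIN (if (nv s' 19 == nv s' 19 + 1)%N then (na s' aOFF (nv s' 19) + na s' aIN (na s' aOFF (nv s' 19)) + 1)%N else na s' aOFF (nv s' 19))))%N by [].
  (* The second assignment reads the table of offsets after the first has changed it, but only at
     entry [j.+1]. *)
  rewrite s'j addn1 sz (ltn_eqF (ltnSn j)) sz.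
  split=> i; rewrite leq_eqVlt => /orP[/eqP->|ij] /=; rewrite ?eqxx ?(ltn_eqF ij) ?andbF /=.
  - by rewrite IH1 // /edge_offset big_ord_recr /= -!addnA addn1.
  - by rewrite IH1.
  - by rewrite IH2 // P2j /phi_offset big_ord_recr /= size_verts.
  by rewrite IH2.
split; rewrite ?vs ?inE //.
- by move=> i ii; rewrite p24 p2.
- move=> i iE; have [x1 x2] := nth_encode_nat iE (leq0n _); rewrite addn0 in x1 x2.
  by rewrite off 1?ltnW // in4 lin ?x1 // x2 leq_addr.
- move=> i t iE ti; have [x1 x2] := nth_encode_nat iE ti.
  by rewrite off 1?ltnW // in4 -addnA add1n lin ?x1 // x2 /edge_offset -addnA leq_addr.
move=> i j iE ji; rewrite po 1?ltnW //.
have ca4 z : ca s4 0 z = ca s 0 z by rewrite (fca F4) // -[RHS]/(ca s1 0 z) -(fca F2).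
have [x1 x2] := nth_encode_real iE ji (isT : 0 < 2)%N.
have [y1 y2] := nth_encode_real iE ji (isT : 1 < 2)%N.
rewrite !ca4; split.
  by rewrite -[(3 + _)%N]addn0 -addnA lrin ?x1 // x2.
by rewrite -[(4 + _)%N]/(3 + (1 + _))%N [(1 + _)%N]addnC lrin ?y1 // y2.
Qed.

Lemma c_main_ok s lam mu flag : (0 < Delta)%N -> (0 < k)%N -> normalized_activities E phi -> loaded s ->
  exists2 est : nat -> CC, cv (ev (c_main D lam mu flag) s) 0 =
    (if flag then conjc (\prod_(v < n) (mu * est v)) else \prod_(v < n) (mu * est v)) &
  forall v : 'I_n, exists2 f : {poly CC},
    eqmX m.+1 (\prod_(S in seen_sets k m Delta E v (D ^ m.*2)) odd_prod Z S * f)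
              (\prod_(S in seen_sets k m Delta E v (D ^ m.*2)) even_prod Z S) &
    est v = \sum_(i < m.+1) f`_i * lam ^+ i.
Proof.
move=> D0 k0 nor ld.
set s1 := ev c_parse s; have I1 : inputs s1 by apply: c_parse_ok.
set s2 := setc s1 4 1.
have I2 : inputs s2.
  by apply: (@inputs_frame _ _ _ _ _ _ [::] [::] [:: 4%N] [::] s1) => //; split=> // z; rewrite inE => /negbTE zx /=; rewrite zx.
pose good (v : 'I_n) z := exists2 f : {poly CC},
    eqmX m.+1 (\prod_(S in seen_sets k m Delta E v (D ^ m.*2)) odd_prod Z S * f)
              (\prod_(S in seen_sets k m Delta E v (D ^ m.*2)) even_prod Z S) &
    z = \sum_(i < m.+1) f`_i * lam ^+ i.
set c := c_vertex D lam mu; set s3 := for_st (ev c) 16 n s2.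
have -> : ev (c_main D lam mu flag) s = setc s3 0 (if flag then conjc (cv s3 4) else cv s3 4).
  rewrite /s3 -(in_n I2) /s2 /s1 /c_main /c; move: (c_vertex _ _ _) c_parse => c' c''.
  by case: (flag).
suff [est cE gd] : exists2 est : nat -> CC, cv s3 4 = \prod_(v < n) (mu * est v) &
    forall v : 'I_n, (v < n)%N -> good v (est v).
  exists est => [|v]; last exact: gd.
  by rewrite -cE; case: (flag).
apply: (@for_ind (fun j s' => exists2 est : nat -> CC, cv s' 4 = \prod_(v < j) (mu * est v) &
    forall v : 'I_n, (v < j)%N -> good v (est v))).
  by exists (fun=> 0) => //; rewrite big_ord0.
move=> j s' jl s'j F [est cE gd].
have I' : inputs s' by apply: inputs_frame F _ I2.
have [f fE fc] := c_vertex_ok sizeE lam mu D0 k0 nor I' (s'j : nv s' 16 = Ordinal jl).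
pose z := \sum_(i < m.+1) f`_i * lam ^+ i.
have pE : \prod_(v < j) (mu * est v) * (mu * z) = \prod_(v < j.+1) (mu * (if v == j :> nat then z else est v)).
  rewrite big_ord_recr /= eqxx; congr (_ * _).
  by apply: eq_bigr => i _; rewrite (ltn_eqF (ltn_ord i)).
exists (fun v => if v == j then z else est v) => [|v].
  by apply: etrans fc _; rewrite cE.
rewrite ltnS leq_eqVlt => /orP[/eqP vj|vj]; last by rewrite (ltn_eqF vj); apply: gd.
rewrite vj eqxx; exists f => //.
by have -> : v = Ordinal jl by apply: val_inj.
Qed.

End Main.

(** * Running time *)

(** Costs are built from loop bounds by sums and products, so a polynomial bound follows by
    induction and no degree is computed. *)
Definition poly_bounded (B : pred nat) (g : (nat -> nat) -> nat) : Prop :=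
  exists K d, forall f X, (0 < X)%N -> (forall y, B y -> f y <= X)%N -> (g f <= K * X ^ d)%N.

Lemma pb_const B c : poly_bounded B (fun=> c).
Proof. by exists c, 0%N => f X _ _; rewrite expn0 muln1. Qed.

Lemma pb_var (B : pred nat) y : B y -> poly_bounded B (fun f => f y).
Proof. by move=> By; exists 1%N, 1%N => f X _ fX; rewrite mul1n fX. Qed.

Lemma pb_add B g h : poly_bounded B g -> poly_bounded B h -> poly_bounded B (fun f => g f + h f)%N.
Proof.
move=> [K1 [d1 H1]] [K2 [d2 H2]]; exists (K1 + K2)%N, (d1 + d2)%N => f X X0 fX.
rewrite mulnDl; apply: leq_add.
  by apply: leq_trans (H1 f X X0 fX) _; rewrite leq_mul2l leq_pexp2l ?leq_addr ?orbT.
by apply: leq_trans (H2 f X X0 fX) _; rewrite leq_mul2l leq_pexp2l ?leq_addl ?orbT.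
Qed.

Lemma pb_mul B g h : poly_bounded B g -> poly_bounded B h -> poly_bounded B (fun f => g f * h f)%N.
Proof.
move=> [K1 [d1 H1]] [K2 [d2 H2]]; exists (K1 * K2)%N, (d1 + d2)%N => f X X0 fX.
by rewrite expnD mulnACA; apply: leq_mul; [apply: H1|apply: H2].
Qed.

Lemma ncost_poly B tau e : nwf B tau e -> poly_bounded B (ncost e).
Proof.
elim: e tau => [c|x|e1 IH1 e2 IH2|e1 IH1 e2 IH2|e1 IH1 e2 IH2 e3 IH3 e4 IH4|a e IH|x y e IH] tau;
  rewrite /nwf -/nwf => /andP[_ w].
- exact: pb_const.
- exact: pb_const.
- by case/andP: w => /IH1 h1 /IH2 h2; apply: pb_add (pb_add h1 h2) (pb_const _ _).
- by case/andP: w => /IH1 h1 /IH2 h2; apply: pb_add (pb_add h1 h2) (pb_const _ _).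
- case/and4P: w => /IH1 h1 /IH2 h2 /IH3 h3 /IH4 h4.
  exact: pb_add (pb_add (pb_add (pb_add h1 h2) h3) h4) (pb_const _ _).
- by case/andP: w => _ /IH h; apply: pb_add h (pb_const _ _).
by case/and5P: w => _ /pb_var hy _ _ /IH h; apply: pb_add (pb_mul hy (pb_add h (pb_const _ _))) (pb_const _ _).
Qed.

Lemma xcost_poly B tau e : xwf B tau e -> poly_bounded B (xcost e).
Proof.
elim: e tau => [c|x|e|e1 IH1 e2 IH2|e1 IH1 e2 IH2|e1 IH1 e2 IH2|e IH|e1 e2 e3 IH3 e4 IH4|a e|b x y e IH] tau;
  rewrite /xwf -/xwf => /andP[_ w].
- exact: pb_const.
- exact: pb_const.
- by apply: pb_add (ncost_poly w) (pb_const _ _).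
- by case/andP: w => /IH1 h1 /IH2 h2; apply: pb_add (pb_add h1 h2) (pb_const _ _).
- by case/andP: w => /IH1 h1 /IH2 h2; apply: pb_add (pb_add h1 h2) (pb_const _ _).
- by case/andP: w => /IH1 h1 /IH2 h2; apply: pb_add (pb_add h1 h2) (pb_const _ _).
- by apply: pb_add (IH _ w) (pb_const _ _).
- case/and4P: w => /ncost_poly h1 /ncost_poly h2 /IH3 h3 /IH4 h4.
  exact: pb_add (pb_add (pb_add (pb_add h1 h2) h3) h4) (pb_const _ _).
- by case/andP: w => _ /ncost_poly h; apply: pb_add h (pb_const _ _).
by case/and5P: w => _ /pb_var hy _ _ /IH h; apply: pb_add (pb_mul hy (pb_add h (pb_const _ _))) (pb_const _ _).
Qed.

Lemma cost_poly B c : cwf B c -> poly_bounded B (cost c).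
Proof.
elim: c => [|x e|a e1 e2|x e|a e1 e2|c1 IH1 c2 IH2|e1 e2 c1 IH1 c2 IH2|x y c IH]; rewrite /cwf -/cwf.
- by move=> _; apply: pb_const.
- by case/and3P => _ _ /ncost_poly h; apply: pb_add h (pb_const _ _).
- by case/and3P => _ /ncost_poly h1 /ncost_poly h2; apply: pb_add (pb_add h1 h2) (pb_const _ _).
- by case/andP => _ /xcost_poly h; apply: pb_add h (pb_const _ _).
- by case/and3P => _ /ncost_poly h1 /xcost_poly h2; apply: pb_add (pb_add h1 h2) (pb_const _ _).
- by case/andP => /IH1 h1 /IH2 h2; apply: pb_add.
- case/and4P => /ncost_poly h1 /ncost_poly h2 /IH1 h3 /IH2 h4.
  exact: pb_add (pb_add (pb_add (pb_add h1 h2) h3) h4) (pb_const _ _).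
case/and5P => _ /pb_var hy _ _ /andP[_ /IH h].
exact: pb_add (pb_mul hy (pb_add h (pb_const _ _))) (pb_const _ _).
Qed.

(** No variable is a loop bound here, so the polynomial bound applies with [X = 1]. *)
Lemma straight_line_cost c : cwf pred0 c -> exists K, forall f, (cost c f <= K)%N.
Proof.
move=> /cost_poly[K [d H]]; exists K => f.
by have := H f 1%N isT (fun y (h : pred0 y) => False_ind _ (elimF idP (erefl : pred0 y = false) h)); rewrite exp1n muln1.
Qed.

(** * The complete algorithm *)

(** With [c_count], recovers [n] as a natural number from the real cell where [base_code] has put
    it; the machine converts only from naturals to reals, hence the counting. *)
Definition c_count0 : cmd := cseqs [:: cset 1 (ccst 0); nset vN (ncst 0)].

Definition c_count : cmd := cseqs [:: nset vN (nadd (nvar vN) (ncst 1)); cset 1 (cadd (cvar 1) (ccst 1))].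

(** The bound variables for [m = 0]. Complex variables 2 and 3 hold the two sides of the stopping
    test, [eps * thr] and [rho ^+ m * n.+1%:R]. *)
Definition c_prec0 (k : nat) (thr : RR) : cmd :=
  cseqs [:: nset vE (narr aIN (ncst 0)); nset vK (ncst k); nset vP (nadd (nvar vN) (ncst k));
    nset vM (ncst 1); nset vL (ncst 0); nset vL1 (ncst 1); nset vW (ncst 1); nset vQ (ncst 2); nset vX (ncst 3);
    cset 2 (cmul (carr 0 (ncst 2)) (ccst thr%:C%C)); cset 3 (cnat (nadd (nvar vN) (ncst 1)))].

(** The passage from [m] to [m + 1]: all bounds are updated by constant factors and increments, so
    neither a logarithm nor a power has to be computed. *)
Definition c_prec (D : nat) (rho : RR) : cmd :=
  cseqs [:: nset vM (nadd (nvar vM) (ncst 1)); nset vL (nadd (nvar vL) (ncst 2));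
    nset vL1 (nadd (nvar vL1) (ncst 2)); nset vW (nmulc (D * D) (nvar vW)); nset vQ (nmulc 4 (nvar vQ));
    nset vX (nadd (nvar vW) (nvar vQ)); cset 3 (cmul (cvar 3) (ccst rho%:C%C))].

Lemma c_prec_wf D rho : cwf pred0 (c_prec D rho).
Proof.
have w : nwf pred0 0 (nmulc (D * D) (nvar vW)) by apply: nwf_nmulc; vm_compute.
by rewrite /c_prec; move: (nmulc (D * D) _) w => e w; rewrite /cseqs; cbn [foldr cwf]; rewrite w; vm_compute.
Qed.

Definition algorithm J k D rho thr lam mu flag : rcmd :=
  RSeq (prelude J) (RSeq (comp c_count0) (RSeq (RWhR (4 * 1) (4 * 0) (comp c_count))
   (RSeq (comp (c_prec0 k thr)) (RSeq (RWhR (4 * 2) (4 * 3) (comp (c_prec D rho)))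
     (comp (c_main D lam mu flag)))))).

Record counted (j : nat) (s s' : st) : Prop := Counted {
  ct_n : nv s' vN = j; ct_c : cv s' 1 = j%:R; ct_0 : cv s' 0 = cv s 0;
  ct_a : forall a i, na s' a i = na s a i; ct_ca : forall a i, ca s' a i = ca s a i }.

Lemma count_ok s j : counted j s (iter j (ev c_count) (ev c_count0 s)).
Proof.
elim: j => [|j [h1 h2 h3 h4 h5]]; first by split.
rewrite iterS; move: (iter j _ _) h1 h2 h3 h4 h5 => s' h1 h2 h3 h4 h5.
split=> //=; first by rewrite updN_eq h1 addn1.
by rewrite h2 -natr1.
Qed.

Record precise (D k : nat) (rho thr eps : RR) (j : nat) (s s' : st) : Prop := Precise {
  pr_n : nv s' vN = nv s vN; pr_E : nv s' vE = na s aIN 0; pr_K : nv s' vK = k;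
  pr_M : nv s' vM = j.+1; pr_L : nv s' vL = j.*2; pr_L1 : nv s' vL1 = j.*2.+1;
  pr_W : nv s' vW = (D ^ j.*2)%N; pr_Q : nv s' vQ = (2 ^ j.*2.+1)%N;
  pr_X : nv s' vX = (D ^ j.*2 + 2 ^ j.*2.+1)%N; pr_P : nv s' vP = (nv s vN + k)%N;
  pr_2 : cv s' 2 = (eps * thr)%:C%C; pr_3 : cv s' 3 = (rho ^+ j * (nv s vN).+1%:R)%:C%C;
  pr_a : forall a i, na s' a i = na s a i; pr_ca : forall a i, ca s' a i = ca s a i }.

Lemma prec_ok D k rho thr eps s j : ca s 0 2 = eps%:C%C ->
  precise D k rho thr eps j s (iter j (ev (c_prec D rho)) (ev (c_prec0 k thr) s)).
Proof.
move=> e2; elim: j => [|j [h1 h2 h3 h4 h5 h6 h7 h8 h9 h10 h11 h12 h13 h14]].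
  split=> //=; first by rewrite e2 -rmorphM.
  by rewrite expr0 mul1r addn1 rmorph_nat.
rewrite iterS; move: (iter j _ _) h1 h2 h3 h4 h5 h6 h7 h8 h9 h10 h11 h12 h13 h14 => s' h1 h2 h3 h4 h5 h6 h7 h8 h9 h10 h11 h12 h13 h14.
have W' : (D * D * nv s' vW = D ^ j.+1.*2)%N by rewrite h7 doubleS !expnS mulnA.
have Q' : (4 * nv s' vQ = 2 ^ j.+1.*2.+1)%N by rewrite h8 doubleS !expnS !mulnA.
have -> : ev (c_prec D rho) s' = setc (setn (setn (setn (setn (setn (setn s' vM (nv s' vM + 1)%N)
   vL (nv s' vL + 2)%N) vL1 (nv s' vL1 + 2)%N) vW (D ^ j.+1.*2)%N) vQ (2 ^ j.+1.*2.+1)%N) vX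
   (D ^ j.+1.*2 + 2 ^ j.+1.*2.+1)%N) 3 (cv s' 3 * rho%:C%C).
  rewrite -W' -Q' /c_prec /cseqs; cbn [foldr ev nev cev]; rewrite !nev_nmulc.
  by [].
split=> //=.
- by rewrite /updN /= h4 addn1.
- by rewrite /updN /= h5 addn2 doubleS.
- by rewrite /updN /= h6 addn2 doubleS.
by rewrite h12 -rmorphM exprSr mulrAC.
Qed.

(** A nonempty edge is counted at its vertices; the summand 1 is for the empty edge. *)
Lemma edges_le n (E : {set {set 'I_n}}) Delta : max_degree_le E Delta -> (#|E| <= n * Delta + 1)%N.
Proof.
move=> deg; apply: (@leq_trans #|[set e in E | e != set0] :|: [set set0]|).
  by apply/subset_leq_card/subsetP => e eE; rewrite !inE eE /=; case: eqP.
apply: leq_trans (leq_card_setU _ _) _; rewrite cards1 leq_add2r.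
apply: (@leq_trans #|\bigcup_(v : 'I_n) [set e in E | v \in e]|).
  apply/subset_leq_card/subsetP => e; rewrite inE => /andP[eE /set0Pn[v ve]].
  by apply/bigcupP; exists v; rewrite // inE eE.
apply: (@leq_trans (\sum_(v : 'I_n) vdegree E v)).
  by elim/big_rec2: _ => [|v A B _ AB]; rewrite ?cards0 // (leq_trans (leq_card_setU _ _)) // leq_add2l.
apply: (@leq_trans (\sum_(v : 'I_n) Delta)); first by apply: leq_sum => v _; apply: deg.
by rewrite sum_nat_const card_ord.
Qed.

Lemma size_flatten_le (T : Type) (S : eqType) (f : S -> seq T) (l : seq S) c :
  (forall x, x \in l -> (size (f x) <= c)%N) -> (size (flatten (map f l)) <= c * size l)%N.
Proof.
elim: l => //= x l IH H; rewrite size_cat mulnS leq_add ?H ?mem_head // IH // => y yl.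
by rewrite H // inE yl orbT.
Qed.

Lemma size_encode_nat n (E : {set {set 'I_n}}) k : edge_size_le E k ->
  (size (encode_nat E) <= 2 + k.+1 * #|E|)%N.
Proof.
move=> sz; rewrite /encode_nat size_cat leq_add2l cardE.
apply: size_flatten_le => e; rewrite mem_enum => eE.
by rewrite /= size_map -cardE ltnS sz.
Qed.

Lemma size_encode_real n (E : {set {set 'I_n}}) phi lam eps k : edge_size_le E k ->
  (size (encode_real E phi lam eps) <= 3 + 2 ^ k.+1 * #|E|)%N.
Proof.
move=> sz; rewrite /encode_real size_cat leq_add2l cardE.
apply: size_flatten_le => e; rewrite mem_enum => eE.
apply: leq_trans (size_flatten_le (c := 2) _) _; first by [].
by rewrite size_iota expnS leq_mul2l leq_exp2l // sz.
Qed.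

Lemma scale_time a b q e d Y t : (t <= a + q * e + b)%N -> (e <= d * Y)%N -> (0 < Y)%N ->
  (t <= (a + q * d + b) * Y)%N.
Proof.
move=> tb eY Y0; apply: leq_trans tb _; rewrite !mulnDl -mulnA.
by rewrite !leq_add ?leq_mul2l ?eY ?orbT // leq_pmulr.
Qed.

(** Time is measured by [n.+1 * D ^ m.*2], which dominates every loop bound up to a constant; [m] is
    still a parameter, the moment at which the search stops. *)
Lemma algorithm_ok Delta k lam mu flag rho thr : (0 < Delta)%N -> (2 <= k)%N ->
  let D := (Delta * k).+1 in
  exists K d, forall n (E : {set {set 'I_n}}) phi lam0 eps m,
    max_degree_le E Delta -> edge_size_le E k ->
    (forall j, (j < m)%N -> eps * thr < rho ^+ j * n.+1%:R) -> rho ^+ m * n.+1%:R <= eps * thr ->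
    exists m' t s, [/\ rrun (algorithm (10 + k) k D rho thr lam mu flag)
        (nth 0%N (encode_nat E), nth 0 (encode_real E phi lam0 eps)) t m',
      (t <= K * (n.+1 * D ^ m.*2) ^ d)%N, loaded k m Delta E phi lam0 eps s &
      sim m' (ev (c_main D lam mu flag) s)].
Proof.
(* [2 ^ J] has to reach both [nregs = 2 ^ 8] and [2 ^ k.+1], the largest number of real input cells
   per edge. *)
move=> D0 k2 D; set J := (10 + k)%N.
have w1 : cwf pred0 c_count0 by vm_compute.
have w2 : cwf pred0 c_count by vm_compute.
have w3 : cwf pred0 (c_prec0 k thr) by vm_compute.
have w4 := c_prec_wf D rho; have w5 := c_main_wf D lam mu flag.
have [K1 H1] := straight_line_cost w1; have [K2 H2] := straight_line_cost w2.
have [K3 H3] := straight_line_cost w3; have [K4 H4] := straight_line_cost w4.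
have [K5 [d H5]] := cost_poly w5.
pose K0 := (J + 4 * nregs + 10 * 2 ^ J * (Delta + 2) + 10 + K1 + (K2 + 4) + K3 + (K4 + 4))%N.
exists (K0 + K5 * (Delta + k + 3) ^ d)%N, d.+1 => n E phi lam0 eps m deg sz before after.
set ni := encode_nat E; set ri := encode_real E phi lam0 eps.
have ng : (nregs <= 2 ^ 8)%N by vm_compute.
have kJ : (2 ^ k.+1 <= 2 ^ J)%N by rewrite leq_exp2l // /J; lia.
have J3 : (3 <= 2 ^ J)%N by rewrite -[3%N]/((2 ^ 2).-1) (leq_trans (leq_pred _)) // leq_exp2l.
have kk : (k.+1 <= 2 ^ J)%N by apply: leq_trans (ltnW (ltn_expl _ _)) kJ.
have sn : (size ni <= 2 ^ J * (nth 0 ni 1).+1)%N.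
  by apply: leq_trans (size_encode_nat sz) _; rewrite mulnS leq_add ?leq_mul2r ?kk ?orbT // ltnW.
have sr : (size ri <= 2 ^ J * (nth 0 ni 1).+1)%N.
  by apply: leq_trans (size_encode_real _ _ _ sz) _; rewrite mulnS leq_add ?leq_mul2r ?kJ ?orbT.
have [|m0 [t0 [s0 [r0 b0 sm0 [i0 i1 i2 i3]]]]] := @prelude_ok J ni ri _ sn sr.
  by apply: leq_trans ng _; rewrite leq_exp2l //; lia.
have [m1 [t1 [r1 b1 sm1]]] := comp_ok w1 sm0.
have ct j := count_ok s0 j.
have [||m2 [t2 [r2 b2 sm2]]] := @while_ok pred0 c_count m1 (ev c_count0 s0) 1 0 n w2 isT isT sm1.
- by move=> j jn; rewrite (ct_c (ct j)) (ct_0 (ct j)) i3 -!(rmorph_nat (@real_complex RR)) /= ltr_nat.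
- by rewrite (ct_c (ct n)) (ct_0 (ct n)) i3 ltxx.
have [h1 h2 h3 h4 h5] := ct n.
set s2 := iter n _ _ in r2 sm2 h1 h2 h3 h4 h5.
have [m3 [t3 [r3 b3 sm3]]] := comp_ok w3 sm2.
have e2 : ca s2 0 2 = eps%:C%C by rewrite h5 i2.
have pr j := prec_ok D k rho thr j e2.
have [||m4 [t4 [r4 b4 sm4]]] := @while_ok pred0 (c_prec D rho) m3 (ev (c_prec0 k thr) s2) 2 3 m w4 isT isT sm3.
- by move=> j jm; rewrite (pr_2 (pr j)) (pr_3 (pr j)) h1 /=; apply: before.
- by rewrite (pr_2 (pr m)) (pr_3 (pr m)) h1 /=; apply: le_gtF.
have pm := pr m; set s4 := iter m _ _ in r4 sm4 pm.
have ld : loaded k m Delta E phi lam0 eps s4.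
  case: pm => p_1 p_2 p_3 p_4 p_5 p_6 p_7 p_8 p_9 p_10 p_11 p_12 p_13 p_14; split=> //.
  - by rewrite p_1 h1.
  - by rewrite p_2 h4 i0.
  - by rewrite p_10 h1.
  - by move=> i ii; rewrite p_13 h4 i1.
  by move=> i ii; rewrite p_14 h5 i2.
have [m5 [t5 [r5 b5 sm5]]] := comp_ok w5 sm4.
exists m5, (t0 + (t1 + (t2 + (t3 + (t4 + t5)))))%N, s4; split=> //.
  by do 5 (apply: run_seq; [eassumption|]).
(* As [D >= 2], the bound [vQ] on the number of subsets is at most twice the number of walks. *)
have W1 : (2 ^ m.*2 <= D ^ m.*2)%N by case: (m) => [//|j]; rewrite leq_exp2r // /D ltnS muln_gt0 D0 ltnW.
set W := (D ^ m.*2)%N in W1 *; set Y := (n.+1 * W)%N.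
have m2W : (m.*2 < W)%N by apply: leq_trans (ltn_expl _ _) W1.
have W0 : (0 < W)%N by apply: leq_trans m2W.
have Y0 : (0 < Y)%N by rewrite muln_gt0.
have nY : (n.+1 <= Y)%N by apply: leq_pmulr.
have WY : (W <= Y)%N by apply: leq_pmull.
have eE := edges_le deg.
have b5' : (t5 <= K5 * ((Delta + k + 3) * Y) ^ d)%N.
  apply: leq_trans b5 _; apply: H5; first by rewrite muln_gt0 Y0 andbT; lia.
  case: ld => l0 l1 l2 l3 l4 l5 l6 l7 l8 l9 _ _.
  have Q1 : (2 ^ m.*2.+1 <= 2 * W)%N by rewrite expnS leq_mul2l.
  have aY a : (a <= a * Y)%N by rewrite leq_pmulr.
  have DY := aY Delta; have kY := aY k.
  have nD : (n * Delta <= Delta * Y)%N by rewrite mulnC leq_mul2l (ltnW nY) orbT.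
  have E4 : ((Delta + k + 3) * Y = Delta * Y + k * Y + 3 * Y)%N by rewrite !mulnDl.
  rewrite E4; move: (Delta * Y)%N (k * Y)%N DY kY nD => u v DY kY nD.
  move: (m2W) l4 l5; rewrite -addnn => mW l4 l5.
  rewrite -/W in l6 l8; move: (2 ^ _)%N (#|E|) Q1 eE l1 l7 l8 => q e Q1 eE l1 l7 l8.
  move: (nv s4) l0 l1 l2 l3 l4 l5 l6 l7 l8 l9 => g l0 l1 l2 l3 l4 l5 l6 l7 l8 l9.
  move: (n * Delta)%N nD eE => nd nD eE.
  clearbody W Y; clear -DY kY nD Q1 eE nY WY mW l0 l1 l2 l3 l4 l5 l6 l7 l8 l9.
  (* The ten bound variables, one at a time. *)
  by do 10 (case=> [_|]; [lia|]).
have eY : (#|E|.+1 <= (Delta + 2) * Y)%N.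
  have : (n * Delta <= Delta * Y)%N by rewrite mulnC leq_mul2l (ltnW nY) orbT.
  by rewrite mulnDl; move: (Delta * Y)%N (n * Delta)%N eE => u v; lia.
have t0' : (t0 <= (J + 4 * nregs + 10 * 2 ^ J * (Delta + 2) + 10) * Y)%N.
  exact: scale_time b0 eY Y0.
have t1' : (t1 <= K1 * Y)%N by apply: leq_trans b1 (leq_trans (H1 _) _); rewrite leq_pmulr.
have t2' : (t2 <= (K2 + 4) * Y)%N.
  apply: leq_trans b2 _; have h : (n * (cost c_count (nv (ev c_count0 s0)) + 2) <= Y * (K2 + 2))%N.
    by rewrite leq_mul ?leq_add2r ?H2 // ltnW.
  by move: (n * _)%N h => x h; rewrite !mulnDl ![(_ * Y)%N]mulnC; lia.
have t3' : (t3 <= K3 * Y)%N by apply: leq_trans b3 (leq_trans (H3 _) _); rewrite leq_pmulr.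
have t4' : (t4 <= (K4 + 4) * Y)%N.
  apply: leq_trans b4 _; have h : (m * (cost (c_prec D rho) (nv (ev (c_prec0 k thr) s2)) + 2) <= Y * (K4 + 2))%N.
    rewrite leq_mul ?leq_add2r ?H4 // (leq_trans _ WY) // (leq_trans _ (ltnW m2W)) //.
    by rewrite -addnn leq_addr.
  by move: (m * _)%N h => x h; rewrite !mulnDl ![(_ * Y)%N]mulnC; lia.
have K0Y : (t0 + (t1 + (t2 + (t3 + t4))) <= K0 * Y)%N.
  by rewrite /K0 [X in (_ <= X)%N]mulnDl [X in (_ <= X + _)%N]mulnDl [X in (_ <= X + _ + _)%N]mulnDl
    [X in (_ <= X + _ + _ + _)%N]mulnDl; lia.
have YY : (Y <= Y ^ d.+1)%N by rewrite expnS leq_pmulr ?expn_gt0 ?Y0.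
have Yd : (Y ^ d <= Y ^ d.+1)%N by rewrite leq_pexp2l.
rewrite mulnDl; move: b5'; rewrite expnMn mulnA => b5'.
have e1 : (K0 * Y <= K0 * Y ^ d.+1)%N by rewrite leq_mul2l YY orbT.
have e5 : (K5 * (Delta + k + 3) ^ d * Y ^ d <= K5 * (Delta + k + 3) ^ d * Y ^ d.+1)%N.
  by rewrite leq_mul2l Yd orbT.
rewrite -/W -/Y; move: (leq_trans K0Y e1) (leq_trans b5' e5).
by move: (K0 * _)%N (K5 * _ * _)%N => u v; lia.
Qed.

(** * Choice of the precision and the resulting time *)

Lemma expr_unbounded (x y : RR) : 1 < x -> exists q, y <= x ^+ q.
Proof.
move=> x1; pose d := x - 1; have d0 : 0 < d by rewrite subr_gt0.
have bern q : 1 + q%:R * d <= x ^+ q.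
  elim: q => [|q IH]; first by rewrite mul0r addr0.
  rewrite exprS; apply: (@le_trans _ _ (x * (1 + q%:R * d))); last by rewrite ler_wpM2l // (le_trans ler01) ?ltW.
  have xE : x = 1 + d by rewrite /d; ring.
  have q0 : 0 <= q%:R * d * d :> RR := mulr_ge0 (mulr_ge0 (ler0n _ q) (ltW d0)) (ltW d0).
  rewrite xE -natr1; nra.
exists (Num.bound (y / d)); apply: le_trans (bern _).
have [y0|y0] := ltP y 0; first by apply: le_trans (ltW y0) _; rewrite addr_ge0 // mulr_ge0 // ltW.
apply: (@le_trans _ _ ((Num.bound (y / d))%:R * d)); last by rewrite lerDr.
by rewrite -ler_pdivrMr // ltW // archi_boundP // divr_ge0 // ltW.
Qed.

(** The least such [m]: the search stops there, and the failure of the test at [m - 1] bounds [m]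
    from above in [time_bound]. *)
Lemma precision_index (rho N tau : RR) : 0 < rho < 1 -> 0 < N -> 0 < tau ->
  exists2 m, (forall j, (j < m)%N -> tau < rho ^+ j * N) & rho ^+ m * N <= tau.
Proof.
move=> /andP[r0 r1] N0 t0.
have ex : exists m, rho ^+ m * N <= tau.
  have [|q qN] := @expr_unbounded rho^-1 (N / tau); first by rewrite invf_gt1.
  exists q; rewrite mulrC -ler_pdivlMr ?exprn_gt0 // -exprVn.
  by rewrite mulrC -ler_pdivrMr.
case: (ex_minnP ex) => m mm mmin; exists m => // j jm.
by rewrite ltNge; apply/negP => /mmin; rewrite leqNgt jm.
Qed.

(** Choose [q] with [D ^ 2 <= rho ^- q]. As the test still fails at [m - 1], the power
    [rho ^- (m - 1)] is at most [(n + 1) / (eps thr)], and [D ^ (2 m)] is at most [D ^ 2] times its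
    [q]-th power. *)
Lemma time_bound (D : nat) (rho thr : RR) : (0 < D)%N -> 0 < rho < 1 -> 0 < thr <= 1 ->
  exists (C : RR) q, 0 <= C /\ forall n m (eps : RR), 0 < eps < 1 ->
    (forall j, (j < m)%N -> eps * thr < rho ^+ j * n.+1%:R) ->
    (n.+1 * D ^ m.*2)%:R <= C * (n.+1%:R ^+ q * eps^-1 ^+ q).
Proof.
move=> D0 /andP[r0 r1] /andP[t0 t1].
have [|q Dq] := @expr_unbounded rho^-1 (D ^ 2)%:R; first by rewrite invf_gt1.
pose C : RR := (D ^ 2)%:R * thr^-1 ^+ q.
have tV : 1 <= thr^-1 by rewrite invf_ge1.
have C1 : 1 <= C by rewrite mulr_ege1 ?exprn_ege1 // ler1n expn_gt0 D0.
have C0 : 0 <= C by apply: le_trans C1.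
exists C, q.+1; split=> // n m eps /andP[e0 e1] before.
have N1 : 1 <= n.+1%:R :> RR by rewrite ler1n.
have eV : 1 <= eps^-1 by rewrite invf_ge1 // ltW.
have [N0 e0'] : 0 <= n.+1%:R :> RR /\ 0 <= eps^-1 by rewrite ler0n invr_ge0 ltW.
have rV0 : 0 <= rho^-1 by rewrite invr_ge0 ltW.
have tV0 : 0 <= thr^-1 by rewrite invr_ge0 ltW.
have W : (D ^ m.*2)%:R <= C * (n.+1%:R ^+ q * eps^-1 ^+ q).
  case: m before => [|j] before.
    by rewrite double0 expn0 mulr_ege1 // mulr_ege1 // exprn_ege1.
  have b := before j (ltnSn j).
  have b' : rho^-1 ^+ j <= n.+1%:R * eps^-1 * thr^-1.
    rewrite exprVn -[X in X <= _]mul1r ler_pdivrMr ?exprn_gt0 //.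
    have -> : n.+1%:R * eps^-1 * thr^-1 * rho ^+ j = (rho ^+ j * n.+1%:R) / (eps * thr).
      by rewrite invfM; ring.
    by rewrite ler_pdivlMr ?mulr_gt0 // mul1r ltW.
  rewrite doubleS -addn2 addnC expnD natrM /C -mulrA ler_wpM2l //.
  have -> : (D ^ j.*2)%:R = (D ^ 2)%:R ^+ j :> RR by rewrite -muln2 mulnC expnM natrX.
  apply: (@le_trans _ _ ((rho^-1 ^+ q) ^+ j)); first by rewrite lerXn2r ?nnegrE ?exprn_ge0.
  by rewrite -exprM mulnC exprM mulrC -!exprMn lerXn2r ?nnegrE ?exprn_ge0 ?mulr_ge0.
rewrite natrM; apply: (@le_trans _ _ (n.+1%:R * (C * (n.+1%:R ^+ q * eps^-1 ^+ q)))).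
  by rewrite ler_wpM2l.
rewrite mulrCA ler_wpM2l //.
have -> : n.+1%:R ^+ q.+1 * eps^-1 ^+ q.+1 = n.+1%:R * (n.+1%:R ^+ q * eps^-1 ^+ q) * eps^-1 :> RR.
  by rewrite !exprS; ring.
by rewrite ler_peMr // !mulr_ge0 // exprn_ge0.
Qed.

Lemma vertex_estimates_suffice n k m Delta (E : {set {set 'I_n}}) phi lam eps rho (est : nat -> CC) :
  max_degree_le E Delta -> edge_size_le E k -> symmetric_activities E phi ->
  normalized_activities E phi -> dominant_activities E phi -> 0 < eps < 1 ->
  cmod lam < 1 -> cmod lam <= rho ->
  rho ^+ m * n.+1%:R <= eps * ((1 - cmod lam) ^+ 2 / 2%:R) ->
  (forall v : 'I_n, exists2 f : {poly CC},
    eqmX m.+1 (\prod_(S in seen_sets k m Delta E v ((Delta * k).+1 ^ m.*2))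
                 odd_prod (restr_poly (weight E phi)) S * f)
              (\prod_(S in seen_sets k m Delta E v ((Delta * k).+1 ^ m.*2))
                 even_prod (restr_poly (weight E phi)) S) &
    est v = \sum_(i < m.+1) f`_i * lam ^+ i) ->
  cmod (\prod_(v < n) est v - partition_function E phi lam) <= eps * cmod (partition_function E phi lam).
Proof.
move=> deg sz sym nor dom e01 l1 lr small H.
have zf := lee_yang sym nor dom.
apply: (relative_error zf nor l1 lr e01 small) => v vn.
have [f fE ->] := H (Ordinal vn).
apply: (factor_estimate (v := Ordinal vn) zf nor l1 _ _ fE).
  by apply: coef0_prod1 => S _; apply: coef0_prod1 => U _; apply/restr_poly_coef0/weight0.
exact: visited_congruence deg sz nor.
Qed.

Theorem theorem1p4 (Delta k : nat) (lam : CC) :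
  (0 < Delta)%N -> (2 <= k)%N -> cmod lam != 1 ->
  exists (P : program) (c : nat) (C : RR),
    forall (n : nat) (E : {set {set 'I_n}})
           (phi : {set 'I_n} -> {set 'I_n} -> CC) (eps : RR),
      max_degree_le E Delta ->
      edge_size_le E k ->
      symmetric_activities E phi ->
      normalized_activities E phi ->
      dominant_activities E phi ->
      0 < eps < 1 ->
      exists (t : nat) (s' : state),
        halts_within P (init_state (encode_nat E) (encode_real E phi lam eps)) t s' /\
        t%:R <= C * (n.+1)%:R ^+ c * eps^-1 ^+ c /\
        cmod (output s' - partition_function E phi lam)
          <= eps * cmod (partition_function E phi lam).

Proof.
move=> D0 k2 lam1.
pose flag := 1 < cmod lam.
pose lam' := if flag then (conjc lam)^-1 else lam.
(* The final conjugation turns [conjc lam ^+ n] into the factor [lam ^+ n] of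
   [partition_function_inv]. *)
pose mu := if flag then conjc lam else 1.
have a1 : cmod lam' < 1.
  rewrite /lam' /flag; case: (ltP 1 (cmod lam)) => h; last by rewrite lt_neqAle lam1.
  by rewrite cmodV cmod_conj invf_lt1 // (lt_trans ltr01).
have a0 : 0 <= cmod lam' := cmod_ge0 lam'.
(* The maximum with 1/2 keeps [rho] positive when [lam] is 0, as [precision_index] requires. *)
pose rho := Num.max (cmod lam') 2%:R^-1.
pose thr := (1 - cmod lam') ^+ 2 / 2%:R.
have lr : cmod lam' <= rho by rewrite le_max lexx.
have rho01 : 0 < rho < 1.
  rewrite lt_max gt_max a1 invr_gt0 ltr0n orbT /= invf_lt1 ?ltr1n //.
have thr01 : 0 < thr <= 1.
  rewrite /thr divr_gt0 ?exprn_gt0 ?subr_gt0 // ler_pdivrMr // mul1r.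
  by move: (cmod lam') a0 a1 => x x0 x1; rewrite expr2 /=; nra.
have [K [d alg]] := algorithm_ok lam' mu flag rho thr D0 k2.
have [C [q [C0 tb]]] := time_bound (ltn0Sn (Delta * k)) rho01 thr01.
set P := algorithm _ _ _ _ _ _ _ _ in alg.
exists (asm P 0), (q * d)%N, (K%:R * C ^+ d) => n E phi eps deg sz sym nor dom e01.
have /andP[e0 e1] := e01; have /andP[t0 _] := thr01.
have [|m before after] := @precision_index rho n.+1%:R (eps * thr) rho01 (ltr0Sn _ n).
  exact: mulr_gt0.
have [m' [t [s [r tK ld sm]]]] := alg n E phi lam eps m deg sz before after.
exists t, (State (rsize P) m'.1 m'.2); split; first exact: asm_halts r.
split.
  apply: (@le_trans _ _ (K%:R * (C * (n.+1%:R ^+ q * eps^-1 ^+ q)) ^+ d)).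
    apply: (@le_trans _ _ (K * (n.+1 * (Delta * k).+1 ^ m.*2) ^ d)%:R); first by rewrite ler_nat.
    rewrite natrM natrX ler_wpM2l // lerXn2r ?nnegrE ?mulr_ge0 ?exprn_ge0 ?invr_ge0 ?(ltW e0) //.
    exact: tb before.
  by rewrite !exprMn -!exprM !mulrA.
have [est cE gd] := c_main_ok sz lam' mu flag D0 (ltnW k2) nor ld.
have main := vertex_estimates_suffice deg sz sym nor dom e01 a1 lr after gd.
have [_ [hc _]] := sm; have [x0 x1] := hc 0%N isT.
have -> : output (State (rsize P) m'.1 m'.2) = cv (ev (c_main (Delta * k).+1 lam' mu flag) s) 0.
  move: (cv _ 0) x0 x1 => z x0 x1.
  change (Complex (m'.2 (4 * 0)%N) (m'.2 (4 * 0).+1) = z).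
  by rewrite x0 x1; case: z {x0 x1}.
rewrite cE big_split /= prodr_const card_ord.
move: main; rewrite /lam' /mu; case: ifP => fl main; last by rewrite expr1n mul1r.
have l0 : lam != 0 by rewrite -cmod_gt0 (lt_trans ltr01).
rewrite (partition_function_inv l0 sym) rmorphM rmorphXn /= conjcK -mulrBr -rmorphB !cmodM !cmod_conj.
by rewrite mulrCA ler_wpM2l // cmodX exprn_ge0 // cmod_ge0.
Qed.
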